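(* Let $\mu\in\mathbb{R}^n$, $\varepsilon\sim N(0,I_n)$ and $y=\mu+\varepsilon$. Let $\hat\mu:\mathbb{R}^n\to\mathbb{R}^n$ be such that every component of $x\mapsto\hat\mu(\mu+x)$ belongs to $W^{1,2}(\gamma_n)$, write $\hat\mu=\hat\mu(y)$, and define $$\widehat{\mathsf{SURE}}=\|\hat\mu-y\|^2+2\operatorname{div}\hat\mu(y)-n .$$ Then $$\mathbb{E}\Big[\big(\widehat{\mathsf{SURE}}-\|\hat\mu-\mu\|^2\big)^2\Big]=\mathbb{E}\Big[4\|y-\hat\mu(y)\|^2+4\operatorname{trace}\big((\nabla\hat\mu(y))^2\big)-2n\Big].$$ Consequently, $$\hat R_{\mathrm{SURE}}=4\|y-\hat\mu(y)\|^2+4\operatorname{trace}\big((\nabla\hat\mu(y))^2\big)-2n$$ is an unbiased estimate of $R_{\mathrm{SURE}}=\mathbb{E}\big[(\widehat{\mathsf{SURE}}-\|\hat\mu-\mu\|^2)^2\big]$, i.e. $\mathbb{E}[\hat R_{\mathrm{SURE}}]=R_{\mathrm{SURE}}$.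
   Context: $\|\cdot\|$ is the Euclidean norm; $\operatorname{div}\hat\mu=\sum_i\partial\hat\mu_i/\partial y_i$; $\nabla\hat\mu$ is the $n\times n$ matrix whose columns are the gradients of the components of $\hat\mu$ (weak derivatives). $\gamma_n$ is the standard Gaussian measure on $\mathbb{R}^n$ and $W^{1,2}(\gamma_n)$ is the set of locally integrable, weakly differentiable $g:\mathbb{R}^n\to\mathbb{R}$ with $\int(g^2+\|\nabla g\|^2)\,d\gamma_n<\infty$. *)

(* Defs.v *)
From HB Require Import structures.
From mathcomp Require Import all_boot all_order all_algebra.
From mathcomp Require Import all_classical all_reals all_analysis.

Set Implicit Arguments.
Unset Strict Implicit.
Unset Printing Implicit Defensive.

Import Order.TTheory GRing.Theory Num.Theory.
Import numFieldNormedType.Exports.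

Local Open Scope classical_set_scope.
Local Open Scope ring_scope.

(* R^n is 'rV[R]_n.  The library gives it a topology and a norm but no
   measurable structure; as for tuples, we take the sigma-algebra generated by
   the coordinates, i.e. the Borel sigma-algebra. *)
Definition rV_display : measure_display.
Proof. exact: default_measure_display. Qed.

Section measurable_rV.
Context {R : realType} {n : nat}.

Let coors : 'I_n -> 'rV[R]_n -> R := fun i x => x ord0 i.

Let rV_set0 : g_sigma_preimage coors set0.
Proof. exact: sigma_algebra0. Qed.

Let rV_setC A : g_sigma_preimage coors A -> g_sigma_preimage coors (~` A).
Proof. exact: sigma_algebraC. Qed.

Let rV_bigcup (F : _^nat) : (forall i, g_sigma_preimage coors (F i)) ->
  g_sigma_preimage coors (\bigcup_i (F i)).
Proof. exact: sigma_algebra_bigcup. Qed.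

HB.instance Definition _ := @isMeasurable.Build rV_display 'rV[R]_n
  (g_sigma_preimage coors) rV_set0 rV_setC rV_bigcup.

End measurable_rV.

Lemma measurable_fun_rVP {R : realType} {n : nat} {d}
    {T : measurableType d} (f : T -> 'rV[R]_n) :
  measurable_fun [set: T] f <->
  forall i, measurable_fun [set: T] (fun x => f x ord0 i : R).
Proof.
split=> [mf i|mf].
  move=> _ A mA; rewrite setTI.
  have -> : (fun x => f x ord0 i) @^-1` A = f @^-1` [set v | A (v ord0 i)] by [].
  rewrite -[X in measurable X]setTI; apply: mf => //.
  apply: sub_sigma_algebra => /=; rewrite -bigcup_seq/=.
  by exists i; [rewrite /= mem_index_enum|exists A => //; rewrite setTI].
move=> _ A mA.
have sA : sigma_algebra [set: 'rV[R]_n] [set B | measurable (f @^-1` B)].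
  split=> /=.
  - by rewrite preimage_set0.
  - by move=> B mB; rewrite setTD preimage_setC; exact: measurableC.
  - by move=> F mF; rewrite preimage_bigcup; exact: bigcupT_measurable.
rewrite setTI; apply: (mA _ (conj sA _)) => B.
rewrite -bigcup_seq/= => -[i _ [C mC <-]] /=.
rewrite setTI -[X in measurable X]setTI.
exact: (mf i).
Qed.

Section power_measure.
Context {R : realType}.
Local Open Scope ereal_scope.

Definition rV_cons n (p : 'rV[R]_n * measurableTypeR R) : 'rV[R]_n.+1 :=
  row_mx (p.2%:M : 'rV[R]_1) p.1.

Lemma measurable_rV_cons n : measurable_fun setT (@rV_cons n).
Proof.
apply/measurable_fun_rVP => i.
rewrite (_ : (fun x => _) = fun p : 'rV[R]_n * measurableTypeR R =>
    match fintype.split (i : 'I_(1 + n)) with inl _ => p.2 : R | inr j => p.1 ord0 j end).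
  case: fintype.split => j.
    exact: measurable_snd.
  have /measurable_fun_rVP := @measurable_fst _ _ 'rV[R]_n (measurableTypeR R).
  exact.
apply/funext => p; rewrite /rV_cons [LHS]mxE; case: fintype.split => // j.
by rewrite !mxE !ord1 eqxx mulr1n.
Qed.

(* The n-fold product measure; each step prepends a coordinate. *)
Fixpoint power_measure (m : {sigma_finite_measure set (measurableTypeR R) -> \bar R})
    (n : nat) : set 'rV[R]_n -> \bar R :=
  match n with
  | 0%N => @dirac _ 'rV[R]_0 0%R R
  | n'.+1 => pushforward (@power_measure m n' \x m) (@rV_cons n')
  end.
Arguments power_measure m n A : clear implicits.

Variables (m : {sigma_finite_measure set (measurableTypeR R) -> \bar R}).

Let power_measure_isMeasure n : exists mu : {measure set 'rV[R]_n -> \bar R},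
  power_measure m n = mu.
Proof.
elim: n => [|n [mu /= ->]]; first by exists (@dirac _ 'rV[R]_0 0%R R).
pose nu : {measure set _ -> \bar R} := mu \x m.
have mc := @measurable_rV_cons n.
by exists (measure_function_pushforward__canonical__measure_function_Measure nu mc).
Qed.

Let power_measure0 n : power_measure m n set0 = 0.
Proof. by have [mu ->] := power_measure_isMeasure n; exact: measure0. Qed.

Let power_measure_ge0 n A : 0 <= power_measure m n A.
Proof. by have [mu ->] := power_measure_isMeasure n; exact: measure_ge0. Qed.

Let power_measure_sigma_additive n : semi_sigma_additive (power_measure m n).
Proof.
have [mu ->] := power_measure_isMeasure n.
exact: measure_semi_sigma_additive.
Qed.

HB.instance Definition _ n := isMeasure.Build _ _ _ (power_measure m n)
  (power_measure0 n) (@power_measure_ge0 n) (@power_measure_sigma_additive n).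

End power_measure.
Arguments power_measure {R} m n A.

Definition lebesgue_rV (R : realType) (n : nat) : set 'rV[R]_n -> \bar R :=
  power_measure lebesgue_measure n.
Arguments lebesgue_rV {R n}.

HB.instance Definition _ (R : realType) (n : nat) :=
  Measure.on (@lebesgue_rV R n).

Definition std_gaussian (R : realType) (n : nat) : set 'rV[R]_n -> \bar R :=
  power_measure (normal_prob (0 : R) 1) n.
Arguments std_gaussian {R n}.

HB.instance Definition _ (R : realType) (n : nat) :=
  Measure.on (@std_gaussian R n).

Section sobolev.
Context {R : realType} {n : nat}.
Implicit Types (g phi : 'rV[R]_n -> R) (G : 'rV[R]_n -> 'rV[R]_n).

(* The library norm `|x| on 'rV[R]_n is the sup norm. *)
Definition enorm (x : 'rV[R]_n) : R := Num.sqrt (\sum_(i < n) x ord0 i ^+ 2).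

Definition partial (i : 'I_n) phi : 'rV[R]_n -> R :=
  fun x => 'D_(delta_mx ord0 i) phi x.

(* C^oo: all iterated partial derivatives exist and are differentiable. *)
Definition smooth phi := forall (s : seq 'I_n) (x : 'rV[R]_n),
  differentiable (foldr partial phi s) x.

Definition test_function phi :=
  smooth phi /\ compact (closure [set x | phi x != 0]).

Definition locally_integrable_rV g :=
  measurable_fun [set: 'rV[R]_n] g /\
  forall K : set 'rV[R]_n, compact K ->
    (\int[lebesgue_rV]_(x in K) `|g x|%:E < +oo)%E.

(* G is a version of the weak gradient of g; it is unique up to a Lebesgue-null
   set. *)
Definition is_weak_gradient g G := forall i : 'I_n,
  locally_integrable_rV (fun x => G x ord0 i) /\
  forall phi, test_function phi ->
    (\int[lebesgue_rV]_x (g x * partial i phi x)%:E =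
     - \int[lebesgue_rV]_x (G x ord0 i * phi x)%:E)%E.

Definition W12_gaussian g :=
  locally_integrable_rV g /\
  exists2 G, is_weak_gradient g G &
    (\int[std_gaussian]_x (g x ^+ 2 + enorm (G x) ^+ 2)%:E < +oo)%E.

(* D is a version of the weak derivative of f: the j-th column of D is the weak
   gradient of the j-th component of f, so D x i j = d_i f_j (x). *)
Definition is_weak_derivative (f : 'rV[R]_n -> 'rV[R]_n)
    (D : 'rV[R]_n -> 'M[R]_n) := forall j : 'I_n,
  is_weak_gradient (fun x => f x ord0 j) (fun x => (col j (D x))^T).

Definition divergence (D : 'rV[R]_n -> 'M[R]_n) : 'rV[R]_n -> R :=
  fun x => \sum_(i < n) D x i i.

Definition SURE (f : 'rV[R]_n -> 'rV[R]_n) (D : 'rV[R]_n -> 'M[R]_n) y : R :=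
  enorm (f y - y) ^+ 2 + 2 * divergence D y - n%:R.

Definition R_SURE_hat (f : 'rV[R]_n -> 'rV[R]_n) (D : 'rV[R]_n -> 'M[R]_n) y : R :=
  4 * enorm (y - f y) ^+ 2 + 4 * \tr (D y *m D y) - 2 * n%:R.

End sobolev.

Section estimation.
Context {d} {Omega : measurableType d} {R : realType} (P : probability Omega R).

Definition std_normal_vector n (eps : {RV P >-> 'rV[R]_n}) :=
  forall A : set 'rV[R]_n, measurable A -> distribution P eps A = std_gaussian A.

Definition R_SURE n (f : 'rV[R]_n -> 'rV[R]_n) (D : 'rV[R]_n -> 'M[R]_n)
    (mu : 'rV[R]_n) (y : Omega -> 'rV[R]_n) : \bar R :=
  'E_P[fun w => (SURE f D (y w) - enorm (f (y w) - mu) ^+ 2) ^+ 2].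

(* Integrability makes the expectation well defined and finite. *)
Definition unbiased_estimate (X : Omega -> R) (theta : \bar R) :=
  P.-integrable [set: Omega] (EFin \o X) /\ ('E_P[X] = theta)%E.

End estimation.

(* Main.v *)
(* Write D for the n x n matrix with D i j = d_i v_j, and delta v for the
   divergence x . v - div v associated with the Gaussian measure. If
   v x = 2 muhat (mu + x) - x - 2 mu, then SURE - |muhat - mu|^2 = - delta v at
   y = mu + x, so that the theorem amounts to the identity
     E (delta v)^2 = E |v|^2 + E tr (D^2),
   up to a term delta (4 muhat (mu + x) - 3 x - 4 mu), whose mean is 0.

   In terms of Hermite polynomials H_a, the adjoint of d_i is the map
   H_a |-> H_(a + e_i), and the commutation relation d_i delta v = delta (d_i v) + v_i
   yields the identity when one of the two fields in the polarized form is a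
   finite Hermite sum. Since the Hermite polynomials are dense in L^2, the Hermite
   partial sums of v and of its derivatives converge in L^2, which gives the
   identity in W^{1,2}. Density itself is proved without Fourier analysis: the
   bounded functions that multiply the closure of the span into itself include the
   Gaussians exp (- c (x_i - z)^2), through the exponential series, hence the
   indicators of slabs, as pointwise limits of polynomials in a Gaussian, hence
   all indicators.

   Both gradients that occur, the one of x |-> muhat (mu + x) in W^{1,2} and the
   given one of muhat, agree almost everywhere after translation. *)

Require Import Defs.
From HB Require Import structures.
From mathcomp Require Import all_boot all_order all_algebra.
From mathcomp Require Import all_classical all_reals all_analysis.
From mathcomp Require Import measurable_realfun ring lra.

Set Implicit Arguments.
Unset Strict Implicit.
Unset Printing Implicit Defensive.

Import Order.TTheory GRing.Theory Num.Theory.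
Import numFieldNormedType.Exports.

Local Open Scope classical_set_scope.
Local Open Scope ring_scope.

(** * Square integrable functions *)

(** Nothing guarantees beforehand that [x ord0 i * v i x] is square integrable. Until late in the
    argument delta v is therefore a mere measurable function, paired only with functions that stay
    in L^2 after multiplication by each coordinate, such as Hermite sums and bounded functions. Let
    q_N be the divergence of the Hermite truncation of v. Both <delta v, q_N> and |q_N|^2 tend to
    the right-hand side of the identity. Testing q_N on the bounded truncations of delta v bounds
    the norms of the latter by that limit, so delta v lies in L^2; then 2 <delta v, q_N> <= |delta
    v|^2 + |q_N|^2 gives the reverse bound.

    Derivatives enter this argument only through their pairings with Hermite tensors. To extract
    these pairings from a weak gradient, one needs compactly supported smooth functions close to a
    Hermite polynomial times the Gaussian density; they are built from exp (- 1/t). In return,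
    truncation commutes with differentiation up to one degree, which is why the derivatives of the
    partial sums converge too. *)

Section square_integrable.
Context d (T : measurableType d) (R : realType).
Variable mu : {measure set T -> \bar R}.
Implicit Types f g h : T -> R.

Definition sq_integrable f :=
  measurable_fun setT f /\ (\int[mu]_x (f x ^+ 2)%:E < +oo)%E.

(** The real integral is the finite part of the extended one, hence a default value when the product
    is not integrable; this is where the square integrability conditions in the rules of bilinearity
    come from. *)
Definition dot f g : R := \int[mu]_x (f x * g x).

Lemma sq_integrable_mul f g : sq_integrable f -> sq_integrable g ->
  mu.-integrable setT (fun x => (f x * g x)%:E).
Proof.
move=> [mf fy] [mg gy].
apply: (@le_integrable _ _ _ mu setT _ _ (fun x => (f x ^+ 2 + g x ^+ 2)%:E)) => //.
- by apply/measurable_EFinP/measurable_funM.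
- move=> x _; rewrite !abse_EFin lee_fin normrM [leRHS]ger0_norm ?addr_ge0 ?sqr_ge0//.
  rewrite -(real_normK (num_real (f x))) -(real_normK (num_real (g x))).
  have := sqr_ge0 (`|f x| - `|g x|); have := normr_ge0 (f x).
  have := normr_ge0 (g x); nra.
- under eq_fun do rewrite EFinD; apply: integrableD => //; apply/integrableP.
  + split; first exact/measurable_EFinP/measurable_funX.
    by under eq_integral do rewrite abse_EFin ger0_norm ?sqr_ge0//.
  + split; first exact/measurable_EFinP/measurable_funX.
    by under eq_integral do rewrite abse_EFin ger0_norm ?sqr_ge0//.
Qed.

Lemma sq_integrable_le f g : measurable_fun setT f -> sq_integrable g ->
  (forall x, `|f x| <= `|g x|) -> sq_integrable f.
Proof.
move=> mf [mg gy] fg; split=> //; apply: le_lt_trans gy.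
apply: ge0_le_integral => //.
- by move=> x _; rewrite lee_fin sqr_ge0.
- by apply/measurable_EFinP/measurable_funX.
- by apply/measurable_EFinP/measurable_funX.
- move=> x _; rewrite lee_fin -(real_normK (num_real (f x))).
  by rewrite -(real_normK (num_real (g x))) lerXn2r ?nnegrE.
Qed.

Lemma integrable_sq f : measurable_fun setT f ->
  mu.-integrable setT (fun x => (f x ^+ 2)%:E) -> sq_integrable f.
Proof.
move=> mf /integrableP[_]; under eq_integral do rewrite abse_EFin ger0_norm ?sqr_ge0//.
by [].
Qed.

Lemma sq_integrable0 : sq_integrable (fun=> 0).
Proof.
split=> //; under eq_integral do rewrite expr0n/=.
by rewrite integral0.
Qed.

Lemma sq_integrableZ a f : sq_integrable f -> sq_integrable (fun x => a * f x).
Proof.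
move=> hf; have [mf _] := hf; apply: integrable_sq; first exact: measurable_funM.
under eq_fun do rewrite exprMn EFinM.
by apply: integrableZl => //; exact: (sq_integrable_mul hf hf).
Qed.

Lemma sq_integrableD f g : sq_integrable f -> sq_integrable g ->
  sq_integrable (f \+ g).
Proof.
move=> hf hg; have [[mf _] [mg _]] := (hf, hg).
apply: integrable_sq; first exact: measurable_funD.
rewrite [X in integrable _ _ X](_ : _ =
  (fun x => ((f x * f x)%:E + (2 * (f x * g x))%:E + (g x * g x)%:E)%E)); last first.
  by apply/funext => x /=; rewrite -!EFinD; congr EFin; ring.
apply: integrableD => //; last exact: sq_integrable_mul.
apply: integrableD => //; first exact: sq_integrable_mul.
by under eq_fun do rewrite EFinM; apply: integrableZl => //; exact: sq_integrable_mul.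
Qed.

Lemma sq_integrableB f g : sq_integrable f -> sq_integrable g ->
  sq_integrable (f \- g).
Proof.
move=> hf hg; rewrite (_ : f \- g = f \+ (fun x => -1 * g x)).
  by apply: sq_integrableD => //; exact: sq_integrableZ.
by apply/funext => x /=; rewrite mulN1r.
Qed.

Lemma sq_integrable_sum (I : Type) (s : seq I) (F : I -> T -> R) :
  (forall i, sq_integrable (F i)) ->
  sq_integrable (fun x => \sum_(i <- s) F i x).
Proof.
move=> hF; elim: s => [|i s IH].
  by under eq_fun do rewrite big_nil; exact: sq_integrable0.
by under eq_fun do rewrite big_cons; exact: sq_integrableD.
Qed.

Lemma dotC f g : dot f g = dot g f.
Proof. by rewrite /dot; apply: eq_Rintegral => x _; rewrite mulrC. Qed.

Lemma dotDl f g h : sq_integrable f -> sq_integrable g -> sq_integrable h ->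
  dot (f \+ g) h = dot f h + dot g h.
Proof.
move=> hf hg hh; rewrite /dot -RintegralD//; try exact: sq_integrable_mul.
by apply: eq_Rintegral => x _; rewrite mulrDl.
Qed.

Lemma dotZl a f g : sq_integrable f -> sq_integrable g ->
  dot (fun x => a * f x) g = a * dot f g.
Proof.
move=> hf hg; rewrite /dot -RintegralZl//; last exact: sq_integrable_mul.
by apply: eq_Rintegral => x _; rewrite mulrA.
Qed.

Lemma dotDr f g h : sq_integrable f -> sq_integrable g -> sq_integrable h ->
  dot h (f \+ g) = dot h f + dot h g.
Proof. by move=> *; rewrite dotC dotDl// !(dotC h). Qed.

Lemma dotZr a f g : sq_integrable f -> sq_integrable g ->
  dot g (fun x => a * f x) = a * dot g f.
Proof. by move=> *; rewrite dotC dotZl// dotC. Qed.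

Lemma dotBl f g h : sq_integrable f -> sq_integrable g -> sq_integrable h ->
  dot (f \- g) h = dot f h - dot g h.
Proof.
move=> hf hg hh; rewrite /dot -RintegralB//; try exact: sq_integrable_mul.
by apply: eq_Rintegral => x _; rewrite mulrBl.
Qed.

Lemma dotBr f g h : sq_integrable f -> sq_integrable g -> sq_integrable h ->
  dot h (f \- g) = dot h f - dot h g.
Proof. by move=> *; rewrite dotC dotBl// !(dotC h). Qed.

Lemma dot0l f : dot (fun=> 0) f = 0.
Proof.
rewrite /dot; under eq_Rintegral do rewrite mul0r.
by rewrite Rintegral_cst// mul0r.
Qed.

Lemma dot_suml (I : Type) (s : seq I) (F : I -> T -> R) g :
  (forall i, sq_integrable (F i)) -> sq_integrable g ->
  dot (fun x => \sum_(i <- s) F i x) g = \sum_(i <- s) dot (F i) g.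
Proof.
move=> hF hg; elim: s => [|i s IH].
  rewrite big_nil (_ : (fun x => _) = fun=> 0) ?dot0l//.
  by apply/funext => x; rewrite big_nil.
rewrite big_cons -IH -dotDl//; last exact: sq_integrable_sum.
by congr dot; apply/funext => x; rewrite big_cons.
Qed.

Lemma dot_sumr (I : Type) (s : seq I) (F : I -> T -> R) g :
  (forall i, sq_integrable (F i)) -> sq_integrable g ->
  dot g (fun x => \sum_(i <- s) F i x) = \sum_(i <- s) dot g (F i).
Proof.
by move=> hF hg; rewrite dotC dot_suml//; apply: eq_bigr => i _; rewrite dotC.
Qed.

Lemma dot_ge0 f : 0 <= dot f f.
Proof. by apply: Rintegral_ge0 => x _; rewrite -expr2 sqr_ge0. Qed.

Lemma sq_integralE f : sq_integrable f ->
  (\int[mu]_x (f x ^+ 2)%:E)%E = (dot f f)%:E.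
Proof.
move=> hf; rewrite /dot /Rintegral fineK//; apply: integrable_fin_num => //.
exact: sq_integrable_mul.
Qed.

Lemma cauchy_schwarz f g : sq_integrable f -> sq_integrable g ->
  dot f g ^+ 2 <= dot f f * dot g g.
Proof.
move=> hf hg.
have key t : 0 <= dot f f + 2 * t * dot f g + t ^+ 2 * dot g g.
  have htg := sq_integrableZ t hg.
  have := dot_ge0 (f \+ (fun x => t * g x)).
  rewrite dotDl ?dotDr ?dotZl ?dotZr//; try exact: sq_integrableD.
  by rewrite (dotC g f) => H; apply: le_trans H _; rewrite le_eqVlt; apply/orP; left; apply/eqP; ring.
have := dot_ge0 g; rewrite le_eqVlt => /predU1P[c0|c0].
  rewrite -c0 mulr0; have [->|b0] := eqVneq (dot f g) 0; first by rewrite expr0n.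
  (* Degenerate case: the quadratic in t is affine, and this t makes it negative. *)
  have := key (- (dot f f + 1) / dot f g); rewrite -c0 mulr0 addr0.
  have := dot_ge0 f => a0.
  rewrite (_ : _ + _ = - dot f f - 2); last by field.
  lra.
have := key (- dot f g / dot g g).
rewrite (_ : _ + _ + _ = (dot f f * dot g g - dot f g ^+ 2) / dot g g).
  by rewrite pmulr_lge0 ?invr_gt0// subr_ge0.
by field; rewrite gt_eqF.
Qed.

Definition cvgL2 (F : nat -> T -> R) f := dot (F m \- f) (F m \- f) @[m --> \oo] --> (0 : R).

Lemma cvg_dot0 (F G : nat -> T -> R) (l : R) :
  (forall m, sq_integrable (F m)) -> (forall m, sq_integrable (G m)) ->
  dot (F m) (F m) @[m --> \oo] --> (0 : R) ->
  dot (G m) (G m) @[m --> \oo] --> l ->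
  dot (F m) (G m) @[m --> \oo] --> (0 : R).
Proof.
move=> hF hG F0 Gl.
have : Num.sqrt (dot (F m) (F m) * dot (G m) (G m)) @[m --> \oo] --> (0 : R).
  rewrite -[X in _ --> X]sqrtr0 -(mul0r l).
  by apply: continuous_cvg; [exact: sqrt_continuous|exact: cvgM].
move=> H; apply/norm_cvg0P; move: H; apply: squeeze_cvgr; last exact: cvg_cst.
apply: nearW => m; rewrite normr_ge0/= -sqrtr_sqr ler_wsqrtr//.
exact: cauchy_schwarz.
Qed.

Lemma cvgL2_dot (F G : nat -> T -> R) f g :
  (forall m, sq_integrable (F m)) -> (forall m, sq_integrable (G m)) ->
  sq_integrable f -> sq_integrable g -> cvgL2 F f -> cvgL2 G g ->
  dot (F m) (G m) @[m --> \oo] --> dot f g.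
Proof.
move=> hF hG hf hg Ff Gg.
rewrite (_ : (fun m => dot (F m) (G m)) = (fun m => dot (F m \- f) (G m \- g) +
   dot (F m \- f) g + dot (G m \- g) f + dot f g)); last first.
  apply/funext => m; rewrite !(dotBl, dotBr)//; try exact: sq_integrableB.
  by rewrite (dotC g f) (dotC (G m) f); ring.
rewrite -[X in _ --> X]add0r; apply: cvgD; last exact: cvg_cst.
rewrite -[X in _ --> X]addr0; apply: cvgD; last first.
  by apply: (cvg_dot0 _ _ Gg (cvg_cst (dot f f))) => // m; exact: sq_integrableB.
rewrite -[X in _ --> X]addr0; apply: cvgD; last first.
  by apply: (cvg_dot0 _ _ Ff (cvg_cst (dot g g))) => // m; exact: sq_integrableB.
by apply: (cvg_dot0 _ _ Ff Gg) => m; exact: sq_integrableB.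
Qed.

Lemma cvgL2_cst f : cvgL2 (fun=> f) f.
Proof.
rewrite /cvgL2 (_ : f \- f = (fun=> 0)) ?dot0l; first exact: cvg_cst.
by apply/funext => x /=; rewrite subrr.
Qed.

Lemma dominated_cvgL2 (F : nat -> T -> R) f h :
  (forall m, measurable_fun setT (F m)) -> measurable_fun setT f ->
  sq_integrable h -> (forall m x, `|F m x - f x| <= `|h x|) ->
  (forall x, F m x @[m --> \oo] --> f x) -> cvgL2 F f.
Proof.
move=> mF mf hh dom Ff.
have hB m : sq_integrable (F m \- f).
  by apply: (sq_integrable_le _ hh (dom m)); exact: measurable_funB.
have [|||||_ _ H] := @dominated_convergence _ _ _ mu setT measurableT
  (fun m x => ((F m x - f x) ^+ 2)%:E) (cst 0%E) (fun x => (h x ^+ 2)%:E).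
- by move=> m; apply/measurable_EFinP/measurable_funX/measurable_funB.
- exact: measurable_cst.
- apply: aeW => x _; apply/cvg_EFin; first exact: nearW.
  rewrite /cst/= -[0](expr0n R 2).
  rewrite [X in X @ _](_ : _ = (fun m => (F m x - f x) ^+ 2))//.
  apply: (@continuous_cvg _ _ _ _ _ _ (fun y : R => y ^+ 2)).
    exact: exprn_continuous.
  rewrite -(subrr (f x)); apply: cvgB; [exact: Ff|exact: cvg_cst].
- exact: sq_integrable_mul.
- apply: aeW => x m _; rewrite abse_EFin lee_fin ger0_norm ?sqr_ge0//.
  by rewrite -real_normK ?num_real// -[leRHS]real_normK ?num_real// lerXn2r ?nnegrE.
move: H; rewrite integral_cst// mul0e => H.
suff: (dot (F m \- f) (F m \- f))%:E @[m --> \oo] --> 0%:E by move/fine_cvgP => [].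
apply: cvg_trans H; apply: near_eq_cvg; apply: nearW => m.
by rewrite -sq_integralE.
Qed.

End square_integrable.

(** * The Gaussian and Lebesgue measures on R^n *)

Section density.
Context d (T : measurableType d) (R : realType).
Variables (nu : {finite_measure set T -> \bar R}).
Variables (mu : {sigma_finite_measure set T -> \bar R}) (w : T -> R).
Hypothesis mw : measurable_fun setT w.
Hypothesis w0 : forall x, 0 <= w x.
Hypothesis nuE : forall A, measurable A -> (nu A = \int[mu]_(x in A) (w x)%:E)%E.
Local Open Scope ereal_scope.

(** By [nuE], [w] has the same integral over every measurable set as the Radon-Nikodym derivative,
    so the two agree almost everywhere and the change of variables known for the derivative
    transfers to [w]. *)
Lemma ge0_integral_density (f : T -> \bar R) :
  measurable_fun setT f -> (forall x, 0 <= f x) ->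
  \int[nu]_x f x = \int[mu]_x (f x * (w x)%:E).
Proof.
move=> mf f0.
have mEw : measurable_fun setT (EFin \o w) by exact/measurable_EFinP.
have dom : nu `<< mu.
  apply/null_content_dominatesP => A mA A0; rewrite nuE//.
  by apply: null_set_integral => //; exact: measurable_funTS.
have iRN := Radon_Nikodym_SigmaFinite.f_integrable dom.
have mRN := measurable_int _ iRN.
rewrite -(Radon_Nikodym_SigmaFinite.change_of_variables dom f0 measurableT mf).
apply: ae_eq_integral => //; try exact: emeasurable_funM.
apply: ae_eqe_mul2l; apply: integral_ae_eq => // A _ mA.
by rewrite -(Radon_Nikodym_SigmaFinite.f_integral dom)// nuE.
Qed.

Lemma integral_density (f : T -> \bar R) : measurable_fun setT f ->
  \int[nu]_x f x = \int[mu]_x (f x * (w x)%:E).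
Proof.
move=> mf; rewrite integralE [RHS]integralE.
congr (_ - _).
  rewrite ge0_integral_density//; last exact: measurable_funepos.
  apply: eq_integral => x _; rewrite !funeposE.
  by rewrite maxe_pMl ?lee_fin// mul0e.
rewrite ge0_integral_density//; last exact: measurable_funeneg.
apply: eq_integral => x _; rewrite !funenegE.
by rewrite maxe_pMl ?lee_fin// mul0e mulNe.
Qed.

End density.

Section rV_coordinates.
Context {R : realType}.

Lemma measurable_coord n (i : 'I_n) :
  measurable_fun setT (fun x : 'rV[R]_n => x ord0 i : R).
Proof. by move: i; apply/(@measurable_fun_rVP R n _ _ id); exact: measurable_id. Qed.

Lemma measurable_rV_add n (a : 'rV[R]_n) : measurable_fun setT (fun x => a + x).
Proof.
apply/measurable_fun_rVP => i.
under eq_fun do rewrite mxE.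
by apply: measurable_funD => //; exact: measurable_coord.
Qed.

Definition rV_uncons n (x : 'rV[R]_n.+1) : 'rV[R]_n * measurableTypeR R :=
  (rsubmx (x : 'rV[R]_(1 + n)), x ord0 ord0).

Lemma rV_consK n : cancel (@rV_cons R n) (@rV_uncons n).
Proof.
case=> x t; rewrite /rV_uncons /rV_cons row_mxKr; congr pair.
rewrite [LHS]mxE; case: fintype.splitP => j //= _.
by rewrite (ord1 j) mxE eqxx mulr1n.
Qed.

Lemma rV_cons0 n p : @rV_cons R n p ord0 ord0 = p.2.
Proof. by have := rV_consK p => /(congr1 snd). Qed.

Lemma rV_consS n p i : @rV_cons R n p ord0 (lift ord0 i) = p.1 ord0 i.
Proof.
have := rV_consK p => /(congr1 fst)/= <-; rewrite [RHS]mxE; congr (_ _ _).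
exact/val_inj.
Qed.

Lemma measurable_rV_uncons n : measurable_fun setT (@rV_uncons n).
Proof.
apply: measurable_fun_pair; last exact: measurable_coord.
apply/measurable_fun_rVP => i.
under eq_fun do rewrite mxE.
exact: measurable_coord.
Qed.

Lemma rV_consD n (a : 'rV[R]_n.+1) p :
  a + rV_cons p = rV_cons ((rV_uncons a).1 + p.1, a ord0 ord0 + p.2).
Proof.
apply/rowP => i; rewrite mxE; have [j ->|->] := unliftP ord0 i; last by rewrite !rV_cons0.
rewrite !rV_consS/= [RHS]mxE [in RHS]mxE; congr (_ + _); congr (a _ _).
exact/val_inj.
Qed.

End rV_coordinates.

(** * Tonelli and Fubini for the product measures *)

Section power_measure_integral.
Context {R : realType}.
Variable m : {sigma_finite_measure set (measurableTypeR R) -> \bar R}.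
Local Open Scope ereal_scope.

Lemma power_measureS n A :
  power_measure m n.+1 A = pushforward (power_measure m n \x m) (@rV_cons R n) A.
Proof. by []. Qed.

(** Tonelli and Fubini at the next dimension require this. The exhaustion consists of rectangles,
    read through [rV_uncons]; both factors are taken increasing so that one index serves for the
    two. *)
Let power_measure_sigma_finite n : sigma_finite setT (power_measure m n).
Proof.
elim: n => [|n IH].
  exists (fun=> setT); first by rewrite bigcup_const.
  by move=> i; split => //=; rewrite diracT ltry.
have [nu nuE] : exists nu : {measure set 'rV[R]_n -> \bar R},
    power_measure m n = nu :> (set _ -> _) by exists (power_measure m n).
have /sigma_finiteP[F [TF ndF Foo]] := IH.
have /sigma_finiteP[G [TG ndG Goo]] := sigma_finiteT m.
exists (fun k => @rV_uncons R n @^-1` (F k `*` G k)).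
  rewrite -preimage_bigcup -[LHS](preimage_setT (@rV_uncons R n)); congr (_ @^-1` _).
  rewrite -setXTT TF TG predeqE => -[x y]; split.
    move=> [/= [i _ Fnx] [k _ Gky]]; exists (maxn i k) => //; split.
    - by move: x Fnx; exact/subsetPset/ndF/leq_maxl.
    - by move: y Gky; exact/subsetPset/ndG/leq_maxr.
  by move=> [k _ []/= ? ?]; split; exists k.
move=> k; have [mF Fk] := Foo k; have [mG Gk] := Goo k; split.
  rewrite -[X in measurable X]setTI; apply: measurable_rV_uncons => //.
  exact: measurableX.
rewrite power_measureS /pushforward -comp_preimage (_ : _ \o _ = id).
  by rewrite preimage_id nuE product_measure1E// -nuE lte_mul_pinfty// ge0_fin_numE.
by apply/funext => p /=; exact: rV_consK.
Qed.

HB.instance Definition _ n := Measure_isSigmaFinite.Build _ _ _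
  (power_measure m n) (power_measure_sigma_finite n).

Lemma ge0_integral_power_measureS n (f : 'rV[R]_n.+1 -> \bar R) :
  measurable_fun setT f -> (forall x, 0 <= f x) ->
  \int[power_measure m n.+1]_x f x =
  \int[power_measure m n]_x \int[m]_t f (rV_cons (x, t)).
Proof.
move=> mf f0.
rewrite (@eq_measure_integral _ _ _ _ (pushforward (power_measure m n \x m) (@rV_cons R n)))//.
  exact: measurable_rV_cons.
move=> mc.
rewrite (ge0_integral_pushforward mc)//.
rewrite preimage_setT fubini_tonelli1//.
  by apply: measurableT_comp => //; exact: measurable_rV_cons.
by move=> p /=.
Qed.

Lemma integrable_power_measureS n (f : 'rV[R]_n.+1 -> R) : measurable_fun setT f ->
  \int[power_measure m n]_x \int[m]_t `|f (rV_cons (x, t))|%:E < +oo ->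
  (power_measure m n.+1).-integrable setT (EFin \o f).
Proof.
move=> mf fy; apply/integrableP; split; first exact/measurable_EFinP.
rewrite ge0_integral_power_measureS//.
by apply: measurableT_comp => //; exact/measurable_EFinP.
Qed.

Lemma integral_power_measureS n (f : 'rV[R]_n.+1 -> \bar R) :
  (power_measure m n.+1).-integrable setT f ->
  \int[power_measure m n.+1]_x f x =
  \int[power_measure m n]_x \int[m]_t f (rV_cons (x, t)).
Proof.
move=> fi; have mf := measurable_int _ fi.
have mfc : measurable_fun setT (f \o @rV_cons R n).
  by apply: measurableT_comp => //; exact: measurable_rV_cons.
have ifc : (power_measure m n \x m).-integrable setT (f \o @rV_cons R n).
  apply/integrable12ltyP => //.
  rewrite -(ge0_integral_power_measureS (f := fun x => `|f x|))//; last first.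
    exact: measurableT_comp.
  by move/integrableP : fi => [].
rewrite (@eq_measure_integral _ _ _ _ (pushforward (power_measure m n \x m) (@rV_cons R n)))//.
  exact: measurable_rV_cons.
move=> mc.
rewrite (integral_pushforward (@measurable_rV_cons R n))//.
by rewrite preimage_setT -integral12_prod_meas1.
Qed.

(** Integrability and value go through the induction together: splitting off the first coordinate by
    Fubini uses the integrability of the remaining product. *)
Lemma integral_tensor n (f : 'I_n -> R -> R) :
  (forall i, m.-integrable setT (EFin \o f i)) ->
  (power_measure m n).-integrable setT (fun x => (\prod_i f i (x ord0 i))%:E) /\
  (\int[power_measure m n]_x (\prod_i f i (x ord0 i)))%R =
  (\prod_i (\int[m]_t f i t))%R.
Proof.
elim: n f => [|n IH] f fi.
  rewrite big_ord0; under eq_fun do rewrite big_ord0.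
  under eq_Rintegral do rewrite big_ord0.
  rewrite /Rintegral integral_dirac// diracT mul1e; split => //.
  apply/integrableP; split => //; rewrite integral_dirac// diracT mul1e.
  by rewrite abse_EFin ltry.
have [IHi IHE] := IH (fun i => f (lift ord0 i)) (fun i => fi _).
have cE x t : (\prod_i f i (rV_cons (x, t) ord0 i))%R =
    (f ord0 t * \prod_i f (lift ord0 i) (x ord0 i))%R.
  rewrite big_ord_recl rV_cons0; congr (_ * _)%R.
  by apply: eq_bigr => i _; rewrite rV_consS.
have mf i : measurable_fun setT (f i).
  by apply/measurable_EFinP; exact: (measurable_int _ (fi i)).
set F := fun x : 'rV[R]_n.+1 => _.
have iF : (power_measure m n.+1).-integrable setT F.
  apply: (@integrable_power_measureS n (fun x => \prod_i f i (x ord0 i))%R).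
    apply: measurable_prod => i _; apply: measurableT_comp => //.
    exact: measurable_coord.
  under eq_integral => x _.
    under eq_integral => t _ do rewrite cE normrM EFinM muleC.
    rewrite ge0_integralZl//; last first.
      by apply/measurable_EFinP; apply: measurableT_comp => //; exact: mf.
    over.
  rewrite ge0_integralZr//; last 2 first.
  - by apply/measurable_EFinP/measurableT_comp => //; move/measurable_int: IHi => /measurable_EFinP.
  - exact: integral_ge0.
  have /integrableP[_ /= f0y] := fi ord0.
  have /integrableP[_ /= Fy] := IHi.
  by rewrite lte_mul_pinfty// ?ge0_fin_numE// ?integral_ge0// => x _.
split => //.
rewrite /Rintegral integral_power_measureS//.
rewrite /F; under eq_integral => x _.
  under eq_integral => t _ do rewrite cE EFinM muleC.
  rewrite integralZl//; last exact: fi.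
  over.
under eq_integral => x _.
  rewrite -[X in _ * X](fineK (integrable_fin_num measurableT (fi ord0))).
  over.
rewrite integralZr// fineM//; last exact: integrable_fin_num.
by rewrite big_ord_recl mulrC -IHE.
Qed.

End power_measure_integral.

(** * Translation invariance of Lebesgue measure *)

Section lebesgue_translation.
Context {R : realType}.
Local Open Scope ereal_scope.

Lemma lebesgue_measure_translation (a : R) (A : set R) : measurable A ->
  pushforward lebesgue_measure ((fun t => a + t)%R : R -> measurableTypeR R) A =
  lebesgue_measure A.
Proof.
move=> mA.
have ma : measurable_fun setT ((fun t => a + t)%R : R -> measurableTypeR R).
  exact: measurable_funD.
apply/esym/lebesgue_measure_unique => //= _ [[b c]] _ <-.
rewrite /pushforward /=.
rewrite (_ : _ @^-1` _ = [set` `](b - a)%R, (c - a)%R]]).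
  rewrite !lebesgue_measure_itv/= !lte_fin ltrD2r.
  by case: ifPn => // _; rewrite -!EFinB; congr EFin; ring.
by apply/seteqP; split => t /=; rewrite !in_itv/= ltrBlDl lerBrDl.
Qed.

Lemma ge0_integral_lebesgue_translation (a : R) (f : R -> \bar R) :
  measurable_fun setT f -> (forall t, 0 <= f t) ->
  \int[lebesgue_measure]_t f (a + t)%R = \int[lebesgue_measure]_t f t.
Proof.
move=> mf f0.
have ma : measurable_fun setT ((fun t => a + t)%R : measurableTypeR R -> measurableTypeR R).
  exact: measurable_funD.
transitivity (\int[pushforward lebesgue_measure ((fun t => a + t)%R : measurableTypeR R -> measurableTypeR R)]_t f t).
  by rewrite (ge0_integral_pushforward ma)// preimage_setT.
by apply: eq_measure_integral => A mA _; exact: lebesgue_measure_translation.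
Qed.

Lemma ge0_integral_lebesgue_rV_translation n (a : 'rV[R]_n) (f : 'rV[R]_n -> \bar R) :
  measurable_fun setT f -> (forall x, 0 <= f x) ->
  \int[lebesgue_rV]_x f (a + x)%R = \int[lebesgue_rV]_x f x.
Proof.
elim: n a f => [|n IH] a f mf f0.
  by apply: eq_integral => x _; congr f; apply/rowP => -[].
have mfa : measurable_fun setT (fun x => f (a + x)%R).
  by apply: measurableT_comp => //; exact: measurable_rV_add.
rewrite /lebesgue_rV (ge0_integral_power_measureS lebesgue_measure mfa (fun x => f0 _)).
rewrite (ge0_integral_power_measureS lebesgue_measure mf f0).
have mfc : measurable_fun setT (f \o @rV_cons R n).
  by apply: measurableT_comp => //; exact: measurable_rV_cons.
rewrite -[RHS](IH (rV_uncons a).1); last 2 first.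
- exact: (measurable_fun_fubini_tonelli_F (m2 := lebesgue_measure) (f \o @rV_cons R n) mfc (fun p => f0 _)).
- by move=> x; exact: integral_ge0.
apply: eq_integral => x _; rewrite -[RHS](ge0_integral_lebesgue_translation (a ord0 ord0))//.
  by apply: eq_integral => t _; rewrite rV_consD.
exact: (measurable_fun_pair2 _ mfc).
Qed.

Lemma integral_lebesgue_rV_translation n (a : 'rV[R]_n) (f : 'rV[R]_n -> \bar R) :
  measurable_fun setT f ->
  \int[lebesgue_rV]_x f (a + x)%R = \int[lebesgue_rV]_x f x.
Proof.
move=> mf; rewrite integralE [RHS]integralE.
rewrite -(ge0_integral_lebesgue_rV_translation a (measurable_funepos mf))//.
rewrite -(ge0_integral_lebesgue_rV_translation a (measurable_funeneg mf))//.
congr (_ - _).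
  by apply: eq_integral => x _; rewrite !funeposE.
by apply: eq_integral => x _; rewrite !funenegE.
Qed.

End lebesgue_translation.

(** * The density of the Gaussian measure *)

Section gaussian_density.
Context {R : realType}.
Local Notation w := (normal_pdf (0 : R) 1).

Lemma normal_pdf_gt0 (t : R) : 0 < w t.
Proof.
rewrite normal_pdfE ?oner_neq0// mulr_gt0 ?normal_peak_gt0 ?oner_neq0//.
exact: expR_gt0.
Qed.

Definition gaussian_density n (x : 'rV[R]_n) : R := \prod_i w (x ord0 i).

Lemma gaussian_density_gt0 n (x : 'rV[R]_n) : 0 < gaussian_density x.
Proof. by apply: prodr_gt0 => i _; exact: normal_pdf_gt0. Qed.

Lemma measurable_gaussian_density n : measurable_fun setT (@gaussian_density n).
Proof.
apply: measurable_prod => i _; apply: measurableT_comp (measurable_coord i).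
exact: measurable_normal_pdf.
Qed.

Local Open Scope ereal_scope.

Lemma integral_normal_prob (f : R -> \bar R) : measurable_fun setT f ->
  \int[normal_prob 0%R 1%R]_t f t = \int[lebesgue_measure]_t (f t * (w t)%:E).
Proof.
move=> mf.
apply: (@integral_density _ (measurableTypeR R) R
  (normal_prob (0 : R)%R 1) lebesgue_measure w) => //.
- exact: measurable_normal_pdf.
- by move=> t; exact: normal_pdf_ge0.
Qed.

Lemma ge0_integral_std_gaussian n (f : 'rV[R]_n -> \bar R) :
  measurable_fun setT f -> (forall x, 0 <= f x) ->
  \int[std_gaussian]_x f x = \int[lebesgue_rV]_x (f x * (gaussian_density x)%:E).
Proof.
elim: n f => [|n IH] f mf f0.
  rewrite /std_gaussian /lebesgue_rV !integral_dirac//=; last first.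
    apply: emeasurable_funM => //; apply/measurable_EFinP.
    exact: measurable_gaussian_density.
  by rewrite diracT !mul1e /gaussian_density big_ord0 mule1.
have mg := @measurable_gaussian_density n.+1.
have mfg : measurable_fun setT (fun x => f x * (gaussian_density x)%:E).
  by apply: emeasurable_funM => //; exact/measurable_EFinP.
have mfc : measurable_fun setT (f \o @rV_cons R n).
  by apply: measurableT_comp => //; exact: measurable_rV_cons.
rewrite /std_gaussian /lebesgue_rV !ge0_integral_power_measureS//; last first.
  by move=> x; rewrite mule_ge0// lee_fin ltW// gaussian_density_gt0.
rewrite [LHS]IH; last 2 first.
- exact: (measurable_fun_fubini_tonelli_F (m2 := normal_prob (0 : R)%R 1) (f \o @rV_cons R n) mfc (fun p => f0 _)).
- by move=> x; exact: integral_ge0.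
apply: eq_integral => x _.
have mfx : measurable_fun setT (fun t : measurableTypeR R => f (rV_cons (x, t))).
  exact: (measurable_fun_pair2 _ mfc).
have mw : measurable_fun setT (fun t : measurableTypeR R => (w t)%:E).
  by apply/measurable_EFinP; exact: measurable_normal_pdf.
rewrite integral_normal_prob// -ge0_integralZr//; last 3 first.
- exact: emeasurable_funM.
- by move=> t _; rewrite mule_ge0// lee_fin normal_pdf_ge0.
- by rewrite lee_fin ltW// gaussian_density_gt0.
apply: eq_integral => t _; rewrite -muleA -EFinM; congr (_ * (_)%:E).
rewrite {2}/gaussian_density big_ord_recl rV_cons0; congr (_ * _)%R.
by apply: eq_bigr => i _; rewrite rV_consS.
Qed.

Lemma integral_std_gaussian n (f : 'rV[R]_n -> \bar R) : measurable_fun setT f ->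
  \int[std_gaussian]_x f x = \int[lebesgue_rV]_x (f x * (gaussian_density x)%:E).
Proof.
move=> mf; rewrite integralE [RHS]integralE.
have g0 x : (0 <= gaussian_density x :> R)%R by rewrite ltW// gaussian_density_gt0.
congr (_ - _).
  rewrite ge0_integral_std_gaussian//; last exact: measurable_funepos.
  apply: eq_integral => x _; rewrite !funeposE.
  by rewrite maxe_pMl ?lee_fin// mul0e.
rewrite ge0_integral_std_gaussian//; last exact: measurable_funeneg.
apply: eq_integral => x _; rewrite !funenegE.
by rewrite maxe_pMl ?lee_fin// mul0e mulNe.
Qed.

Lemma std_gaussian_null n (A : set 'rV[R]_n) : measurable A ->
  lebesgue_rV A = 0 -> std_gaussian A = 0.
Proof.
move=> mA A0; have := @ge0_integral_std_gaussian n (fun x => (\1_A x)%:E).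
rewrite integral_indic// setIT => ->//; last first.
  exact/measurable_EFinP/measurable_indic.
transitivity (\int[lebesgue_rV]_(x in A) (gaussian_density x)%:E).
  rewrite [RHS]integral_mkcond; apply: eq_integral => x _; rewrite patchE indicE.
  by case: ifPn => _; rewrite /= ?mul1e ?mul0e.
apply: null_set_integral => //.
by apply/measurable_funTS/measurable_EFinP; exact: measurable_gaussian_density.
Qed.

Lemma std_gaussian_setT n : @std_gaussian R n setT = 1.
Proof.
have one_i : (normal_prob (0 : R)%R 1).-integrable setT (EFin \o cst 1%R).
  exact: finite_measure_integrable_cst.
have [ione Eone] := integral_tensor (fun _ : 'I_n => one_i).
rewrite -[LHS]mul1e -(integral_cst _ measurableT).
rewrite (eq_integral (fun x : 'rV[R]_n => (\prod_(i < n) cst 1 (x ord0 i))%:E)%R); last first.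
  by move=> x _; rewrite big1.
rewrite -[LHS]fineK; last exact: integrable_fin_num ione.
congr EFin; rewrite [LHS]Eone big1// => i _.
rewrite Rintegral_cst// mul1r.
by rewrite [X in fine X]probability_setT.
Qed.

HB.instance Definition _ n := @Measure_isProbability.Build _ _ R
  (@std_gaussian R n) (std_gaussian_setT n).

End gaussian_density.

(** * Hermite polynomials and integration by parts *)

Section gaussian_growth.
Context {R : realType}.
Implicit Types (c C t : R) (f g : R -> R) (p q : {poly R}).

(** The rate [c] acts as a budget against the decay exp (- t^2 / 2) of the density: rates add under
    products, polynomials have every positive rate, and rate 1/4 still leaves an integrable
    function. *)
Definition gaussian_growth c f :=
  exists C, forall t, `|f t| <= C * expR (c * t ^+ 2).

Lemma gaussian_growthM c d f g : gaussian_growth c f -> gaussian_growth d g ->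
  gaussian_growth (c + d) (f \* g).
Proof.
move=> [C hC] [D hD]; exists (C * D) => t.
by rewrite normrM mulrDl expRD mulrACA ler_pM.
Qed.

Lemma gaussian_growthD c f g : gaussian_growth c f -> gaussian_growth c g ->
  gaussian_growth c (f \+ g).
Proof.
move=> [C hC] [D hD]; exists (C + D) => t.
by rewrite mulrDl (le_trans (ler_normD _ _))// lerD.
Qed.

Lemma gaussian_growth_cst c a : 0 <= c -> gaussian_growth c (cst a).
Proof.
move=> c0; exists `|a| => t; rewrite ler_peMr//.
by rewrite -[leLHS]expR0 ler_expR mulr_ge0// sqr_ge0.
Qed.

Lemma gaussian_growth_id c : 0 < c -> gaussian_growth c id.
Proof.
move=> c0; exists (1 + c^-1) => t.
apply: (@le_trans _ _ ((1 + c^-1) * (1 + c * t ^+ 2))); last first.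
  by rewrite ler_wpM2l ?expR_ge1Dx// addr_ge0// invr_ge0 ltW.
apply: (@le_trans _ _ (1 + t ^+ 2)).
  rewrite -(real_normK (num_real t)); have := normr_ge0 t.
  have := sqr_ge0 (`|t| - 1); nra.
rewrite (_ : (1 + c^-1) * _ = 1 + t ^+ 2 + (c^-1 + c * t ^+ 2)); last first.
  by field; rewrite gt_eqF.
have c1 := ltW c0.
by rewrite lerDl addr_ge0 ?invr_ge0// mulr_ge0 ?sqr_ge0.
Qed.

Lemma gaussian_growth_poly c p : 0 < c -> gaussian_growth c (horner p).
Proof.
elim/poly_ind: p c => [|p a IH] c c0.
  by rewrite hornerC_ext; apply: gaussian_growth_cst; exact: ltW.
have -> : horner (p * 'X + a%:P) = (horner p \* id) \+ cst a.
  by apply/funext => t /=; rewrite !hornerE.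
apply: gaussian_growthD; last by apply: gaussian_growth_cst; exact: ltW.
rewrite (splitr c); apply: gaussian_growthM; first by apply: IH; lra.
by apply: gaussian_growth_id; lra.
Qed.

Local Notation w := (normal_pdf (0 : R) 1).
Local Notation gamma := (normal_prob (0 : R) 1).

Lemma normal_pdf0E s t : s != 0 ->
  normal_pdf 0 s t = normal_peak s * expR (- (t ^+ 2 / (2 * s ^+ 2))).
Proof. by move=> s0; rewrite normal_pdfE// /normal_fun subr0 mulNr mulr_natl. Qed.

Lemma normal_pdf01E t : w t = normal_peak 1 * expR (- (t ^+ 2 / 2)).
Proof. by rewrite normal_pdf0E ?oner_neq0// expr1n mulr1. Qed.

Lemma gaussian_growth_integrable f : measurable_fun setT f ->
  gaussian_growth (4^-1) f -> gamma.-integrable setT (EFin \o f).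
Proof.
move=> mf [C hC]; have C0 : 0 <= C.
  by have := hC 0; rewrite expr0n mulr0 expR0 mulr1; exact: le_trans.
apply/integrableP; split; first exact/measurable_EFinP.
rewrite (integral_normal_prob (f := fun t => `|(f t)%:E|%E)); last first.
  by apply: measurableT_comp => //; exact/measurable_EFinP.
(* Rate 1/4 leaves the decay exp (- t^2 / 4), the shape of the normal density of variance 2, whose
   integral is 1; [K] adjusts the peaks. *)
pose s : R := Num.sqrt 2.
have s0 : s != 0 by rewrite gt_eqF// sqrtr_gt0.
pose K := C * normal_peak 1 / normal_peak s.
have K0 : 0 <= K by rewrite divr_ge0 ?mulr_ge0 ?normal_peak_ge0.
apply: (@le_lt_trans _ _ (\int[lebesgue_measure]_t (K%:E * (normal_pdf 0 s t)%:E))%E).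
  apply: ge0_le_integral => //=.
  - by move=> t _; rewrite mule_ge0// lee_fin normal_pdf_ge0.
  - apply: emeasurable_funM; first exact/measurable_EFinP/measurableT_comp.
    by apply/measurable_EFinP; exact: measurable_normal_pdf.
  - apply: emeasurable_funM => //.
    by apply/measurable_EFinP; exact: measurable_normal_pdf.
  - move=> t _; rewrite -!EFinM lee_fin normal_pdf01E (normal_pdf0E _ s0).
    have KE : K * normal_peak s = C * normal_peak 1.
      by rewrite /K divfK// gt_eqF// normal_peak_gt0.
    rewrite [leRHS]mulrA KE mulrCA (mulrC C) -(mulrA _ C).
    rewrite ler_wpM2l ?normal_peak_ge0//.
    apply: (@le_trans _ _ ((C * expR (4^-1 * t ^+ 2)) * expR (- (t ^+ 2 / 2)))).
      by rewrite ler_wpM2r ?expR_ge0.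
    rewrite -mulrA -expRD ler_wpM2l// ler_expR sqr_sqrtr//.
    by rewrite le_eqVlt; apply/orP; left; apply/eqP; field.
rewrite ge0_integralZl//=.
- by rewrite integral_normal_pdf mule1 ltry.
- by apply/measurable_EFinP; exact: measurable_normal_pdf.
- by move=> t _; rewrite lee_fin normal_pdf_ge0.
Qed.

Lemma measurable_horner p : measurable_fun setT (horner p).
Proof. by apply: continuous_measurable_fun; exact: continuous_horner. Qed.

Lemma integrable_horner p : gamma.-integrable setT (EFin \o horner p).
Proof.
apply: gaussian_growth_integrable; first exact: measurable_horner.
by apply: gaussian_growth_poly; rewrite invr_gt0.
Qed.

Definition gaussian_mean p : R := \int[gamma]_t p.[t].

Lemma gaussian_meanD p q : gaussian_mean (p + q) = gaussian_mean p + gaussian_mean q.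
Proof.
rewrite /gaussian_mean -RintegralD//; try exact: integrable_horner.
by apply: eq_Rintegral => t _; rewrite hornerD.
Qed.

Lemma gaussian_meanZ a p : gaussian_mean (a *: p) = a * gaussian_mean p.
Proof.
rewrite /gaussian_mean -RintegralZl//; last exact: integrable_horner.
by apply: eq_Rintegral => t _; rewrite hornerZ.
Qed.

Lemma is_derive_normal_pdf t : is_derive t 1 w (- t * w t).
Proof.
pose q : {poly R} := (- 2^-1) *: 'X^2.
have wE : w = normal_peak 1 \*: (expR \o horner q).
  apply/funext => x; rewrite normal_pdf01E /q [RHS]/= hornerZ hornerXn.
  by congr (_ * expR _); field.
have H := is_deriveZ (normal_peak 1) (is_derive1_comp (is_derive_expR _) (is_derive_poly q t)).
rewrite wE; apply: (is_derive_eq H).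
rewrite /q derivZ derivXn !hornerZ hornerMn hornerXn /=.
rewrite /GRing.scale/= !hornerZ hornerXn expr1 -mulr_natr.
by field.
Qed.

Lemma integral_derivative_eq0 (F f : R -> R) :
  (forall t, is_derive t 1 F (f t)) -> continuous f ->
  lebesgue_measure.-integrable setT (EFin \o f) ->
  F n%:R @[n --> \oo] --> (0 : R) -> F (- n%:R) @[n --> \oo] --> (0 : R) ->
  (\int[lebesgue_measure]_t (f t)%:E = 0)%E.
Proof.
move=> dF cf fi F0 F0'.
have cF : continuous F.
  by move=> x; apply/differentiable_continuous/derivable1_diffP; have [] := dF x.
(* The shift to n + 1 keeps the interval nondegenerate, as the fundamental theorem requires. *)
have FTC n : (\int[lebesgue_measure]_t (((EFin \o f) \_ `[(- n.+1%:R)%R, n.+1%:R]) t) =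
    (F n.+1%:R - F (- n.+1%:R))%:E)%E.
  rewrite -integral_mkcond (continuous_FTC2 (F := F)) ?EFinB//.
  - by rewrite -subr_gt0 opprK -natrD ltr0n.
  - exact: continuous_subspaceT.
  - split=> [x _||]; first by have [] := dF x.
      by apply: cvg_at_right_filter; exact: cF.
    by apply: cvg_at_left_filter; exact: cF.
  - by move=> x _; rewrite derive1E; have [_ ->] := dF x.
have [|||||_ _ H] := @dominated_convergence _ _ R (@lebesgue_measure R) setT measurableT
  (fun n => (EFin \o f) \_ `[(- n.+1%:R)%R, n.+1%:R]) (EFin \o f) (abse \o (EFin \o f)).
- move=> n; apply/(measurable_restrictT _ _).1 => //.
  by apply: measurable_funTS; have /measurable_int := fi.
- by have /measurable_int := fi.
- apply: aeW => t _; apply: cvg_near_cst.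
  near=> n; rewrite patchE mem_set//= in_itv/=.
  rewrite -ler_norml; apply: (@le_trans _ _ n%:R); last by rewrite ler_nat.
  by near: n; exact: nbhs_infty_ger.
- exact: integrable_abse.
- apply: aeW => t n _; rewrite patchE; case: ifPn => // _.
  by rewrite abse0 abse_ge0.
have H0 : (fun n => (F n.+1%:R - F (- n.+1%:R))%:E) @ \oo --> (0%:E : \bar R).
  apply: cvg_EFin; first exact: nearW.
  rewrite -(subr0 (0 : R)).
  rewrite [X in X @ _](_ : _ = (fun n => F n.+1%:R - F (- n.+1%:R)))//.
  by apply: cvgB; rewrite (@cvg_shiftS _ (fun n => _)).
move: H; under eq_fun do rewrite FTC.
by move=> H; exact: (cvg_unique (@ereal_hausdorff R) H H0).
Unshelve. all: by end_near. Qed.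

(** The sequence [s] lets one statement serve both ends of the line: it is applied to n and to -
    n. *)
Lemma gaussian_growth_cvg0 (f : R -> R) : gaussian_growth 4^-1 f ->
  forall s : nat -> R, (forall n, n%:R <= `|s n|) -> f (s n) * w (s n) @[n --> \oo] --> (0 : R).
Proof.
move=> [C hC] s hs; have C0 : 0 <= C.
  by have := hC 0; rewrite expr0n mulr0 expR0 mulr1; exact: le_trans.
apply/norm_cvg0P.
(* This majorant comes from exp (- s^2 / 4) <= 1 / (1 + s^2 / 4) and s^2 >= n^2 >= n. *)
have H : C * normal_peak 1 * (1 + 4^-1 * n%:R)^-1 @[n --> \oo] --> (0 : R).
  rewrite -[X in _ --> X](mulr0 (C * normal_peak 1)); apply: cvgMr.
  apply/gtr0_cvgV0; first by apply: nearW => n; rewrite ltr_pwDl// mulr_ge0.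
  apply/cvgryPge => A; near=> n.
  apply: (@le_trans _ _ (4^-1 * n%:R)); last by rewrite lerDr.
  rewrite -ler_pdivrMl//; near: n; exact: nbhs_infty_ger.
move: H; apply: squeeze_cvgr; last exact: cvg_cst.
near=> n; rewrite normr_ge0/= normrM [`|w _|]ger0_norm ?normal_pdf_ge0//.
apply: (@le_trans _ _ (C * expR (4^-1 * s n ^+ 2) * w (s n))).
  by rewrite ler_wpM2r ?normal_pdf_ge0.
rewrite normal_pdf01E mulrACA ler_wpM2l ?mulr_ge0 ?normal_peak_ge0// -expRD.
rewrite (_ : _ - _ = - (4^-1 * s n ^+ 2)); last by field.
rewrite expRN lef_pV2 ?posrE ?expR_gt0 ?ltr_pwDl ?mulr_ge0//.
apply: le_trans (expR_ge1Dx _); rewrite lerD2l ler_wpM2l//.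
rewrite -real_normK ?num_real//.
apply: (@le_trans _ _ (n%:R ^+ 2)); last by rewrite lerXn2r ?nnegrE.
by rewrite -natrX ler_nat; case: (n) => // m; rewrite expnS leq_pmulr.
Unshelve. all: by end_near. Qed.

(** Since w' = - t w, the function (t p - p') w is the derivative of - p w, which tends to 0 at both
    ends. *)
Lemma gaussian_ibp p : gaussian_mean ('X * p) = gaussian_mean p^`().
Proof.
apply/eqP; rewrite -subr_eq0; apply/eqP.
have -> : gaussian_mean ('X * p) - gaussian_mean p^`() = gaussian_mean ('X * p - p^`()).
  by rewrite gaussian_meanD -[in RHS]scaleN1r gaussian_meanZ mulN1r.
rewrite /gaussian_mean /Rintegral.
rewrite (integral_normal_prob (f := fun t => (('X * p - p^`()).[t])%:E)); last first.
  by apply/measurable_EFinP; exact: measurable_horner.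
set q := 'X * p - p^`().
have gp (r : {poly R}) : gaussian_growth 4^-1 (horner r).
  by apply: gaussian_growth_poly; rewrite invr_gt0.
have dF t : is_derive t 1 (fun t => - (p.[t] * w t)) (q.[t] * w t).
  have H := is_deriveN (is_deriveM (is_derive_poly p t) (is_derive_normal_pdf t)).
  apply: (is_derive_eq H).
  by rewrite /GRing.scale/= /q hornerD hornerN hornerM hornerX; ring.
rewrite (integral_derivative_eq0 dF)//.
- move=> t; apply: continuousM; first exact: continuous_horner.
  by apply: continuous_normal_pdf; exact: oner_neq0.
- have /integrableP[_] := integrable_horner q.
  rewrite (integral_normal_prob (f := fun t => (`|(q.[t])%:E|)%E)); last first.
    by apply: measurableT_comp => //; apply/measurable_EFinP; exact: measurable_horner.
  move=> H; apply/integrableP; split.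
    apply/measurable_EFinP/measurable_funM; first exact: measurable_horner.
    exact: measurable_normal_pdf.
  apply: le_lt_trans H; rewrite le_eqVlt; apply/orP; left; apply/eqP.
  apply: eq_integral => t _ /=.
  by rewrite -EFinM normrM [`|w _|]ger0_norm ?normal_pdf_ge0.
- rewrite -[X in _ --> X]oppr0; apply: cvgN.
  apply: (gaussian_growth_cvg0 (gp p) (s := fun n => n%:R)) => n.
  by rewrite normr_nat.
- rewrite -[X in _ --> X]oppr0; apply: cvgN.
  apply: (gaussian_growth_cvg0 (gp p) (s := fun n => - n%:R)) => n.
  by rewrite normrN normr_nat.
Qed.

(** The probabilists' Hermite polynomials: p |-> t p - p' is the adjoint of differentiation for the
    Gaussian measure. *)
Fixpoint hermite k : {poly R} :=
  if k is k'.+1 then 'X * hermite k' - (hermite k')^`() else 1.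

Lemma hermiteS k : hermite k.+1 = 'X * hermite k - (hermite k)^`().
Proof. by []. Qed.

Lemma deriv_hermite k : (hermite k)^`() = k%:R *: hermite k.-1.
Proof.
elim: k => [|k IH]; first by rewrite derivC scale0r.
rewrite hermiteS derivB derivM derivX mul1r IH derivZ.
case: k IH => [|k] IH.
  by rewrite /= !scale0r mulr0 addr0 subr0 scale1r.
rewrite -scalerAr -addrA -scalerBr -hermiteS.
by rewrite -[in RHS]natr1 scalerDl scale1r addrC.
Qed.

Lemma gaussian_mean_hermiteS k q :
  gaussian_mean (hermite k.+1 * q) = gaussian_mean (hermite k * q^`()).
Proof.
have -> : hermite k.+1 * q = 'X * (hermite k * q) +
    (-1) *: (hermite k * q)^`() + hermite k * q^`().
  by rewrite hermiteS derivM scaleN1r; ring.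
by rewrite !gaussian_meanD gaussian_meanZ gaussian_ibp mulN1r subrr add0r.
Qed.

Lemma gaussian_mean1 : gaussian_mean 1 = 1.
Proof.
rewrite /gaussian_mean (_ : horner 1 = cst 1); last first.
  by apply/funext => t; rewrite hornerE.
by rewrite Rintegral_cst// mul1r [X in fine X]probability_setT.
Qed.

Lemma hermite_orthogonal j k :
  gaussian_mean (hermite j * hermite k) = if j == k then j`!%:R else 0.
Proof.
elim: j k => [|j IH] [|k].
- by rewrite mulr1 gaussian_mean1.
- by rewrite mulrC gaussian_mean_hermiteS derivC mulr0 -(scale0r 0) gaussian_meanZ mul0r.
- by rewrite gaussian_mean_hermiteS derivC mulr0 -(scale0r 0) gaussian_meanZ mul0r.
- rewrite gaussian_mean_hermiteS deriv_hermite -scalerAr gaussian_meanZ IH eqSS.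
  by case: eqP => [->|_]; rewrite ?mulr0// factS natrM.
Qed.

End gaussian_growth.

(** * The Gaussian divergence *)

Section hermite_tensor.
Context {R : realType} {n : nat}.
Local Notation gamma := (@std_gaussian R n).
Local Notation sqint := (sq_integrable gamma).
Local Notation "<< f , g >>" := (dot gamma f g) (at level 0, format "<< f ,  g >>") : ring_scope.
Implicit Types (a b : 'I_n -> nat) (i j k : 'I_n) (x : 'rV[R]_n).

Definition tensor_poly (P : 'I_n -> {poly R}) x : R := \prod_i (P i).[x ord0 i].

Lemma measurable_tensor_poly P : measurable_fun setT (tensor_poly P).
Proof.
apply: measurable_prod => i _; apply: measurableT_comp (measurable_coord i).
exact: measurable_horner.
Qed.

Lemma tensor_polyM P Q x :
  tensor_poly P x * tensor_poly Q x = tensor_poly (fun i => P i * Q i) x.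
Proof. by rewrite /tensor_poly -big_split/=; apply: eq_bigr => i _; rewrite hornerM. Qed.

Lemma integral_tensor_poly P :
  gamma.-integrable setT (EFin \o tensor_poly P) /\
  \int[gamma]_x tensor_poly P x = \prod_i gaussian_mean (P i).
Proof.
exact: (@integral_tensor R (normal_prob (0 : R) 1) n (fun i => horner (P i))
  (fun i => integrable_horner (P i))).
Qed.

Lemma sq_integrable_tensor_poly P : sqint (tensor_poly P).
Proof.
apply: integrable_sq; first exact: measurable_tensor_poly.
under eq_fun do rewrite expr2 tensor_polyM.
by have [] := integral_tensor_poly (fun i => P i * P i).
Qed.

Lemma dot_tensor_poly P Q :
  << tensor_poly P, tensor_poly Q >> = \prod_i gaussian_mean (P i * Q i).
Proof.
have [_ <-] := integral_tensor_poly (fun i => P i * Q i).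
by apply: eq_Rintegral => x _; rewrite tensor_polyM.
Qed.

Definition raise i a : 'I_n -> nat := fun k => (a k + (k == i))%N.
(** The subtraction is truncated: [lower i a] is [a] when [a i] is 0. This is harmless because the
    coefficient in [dhermE] then vanishes. *)
Definition lower i a : 'I_n -> nat := fun k => (a k - (k == i))%N.

Definition herm a := tensor_poly (fun k => @hermite R (a k)).

Definition dherm i a := tensor_poly
  (fun k => if k == i then (@hermite R (a k))^`() else @hermite R (a k)).

Lemma sqint_herm a : sqint (herm a).
Proof. exact: sq_integrable_tensor_poly. Qed.

Lemma sqint_dherm i a : sqint (dherm i a).
Proof. exact: sq_integrable_tensor_poly. Qed.

(** The recurrence of the Hermite polynomials in coordinate i; it exhibits raising the index as
    multiplication by x_i minus d_i. *)
Lemma coord_herm i a x : x ord0 i * herm a x = herm (raise i a) x + dherm i a x.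
Proof.
rewrite /herm /dherm /tensor_poly !(bigD1 i (P := predT))//= /raise eqxx addn1.
rewrite hermiteS hornerD hornerN hornerM hornerX.
rewrite (eq_bigr (fun k => (@hermite R (a k)).[x ord0 k]) (P := fun k => k != i)
  (F1 := fun k => (@hermite R (a k + (k == i))%N).[x ord0 k])); last first.
  by move=> k /negbTE ->; rewrite addn0.
rewrite (eq_bigr (fun k => (@hermite R (a k)).[x ord0 k]) (P := fun k => k != i)
  (F1 := fun k => (if k == i then _ else _).[_])); last by move=> k /negbTE ->.
ring.
Qed.

Lemma dhermE i a x : dherm i a x = (a i)%:R * herm (lower i a) x.
Proof.
rewrite /herm /dherm /tensor_poly !(bigD1 i (P := predT))//= eqxx deriv_hermite.
rewrite hornerZ -mulrA; congr (_ * (_ * _)).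
  by rewrite /lower eqxx subn1.
by apply: eq_bigr => k ki; rewrite /lower (negbTE ki) subn0.
Qed.

Lemma dot_herm a b : << herm a, herm b >> =
  \prod_k (if a k == b k then (a k)`!%:R else 0).
Proof. by rewrite dot_tensor_poly; apply: eq_bigr => k _; exact: hermite_orthogonal. Qed.

Lemma dot_herm_gt0 a : 0 < << herm a, herm a >>.
Proof.
rewrite dot_herm; apply: prodr_gt0 => k _.
by rewrite eqxx ltr0n fact_gt0.
Qed.

Lemma dot_herm_neq a b : a <> b -> << herm a, herm b >> = 0.
Proof.
move=> ab; have [k kab] : exists k, a k != b k.
  apply/existsP; apply: contra_notT ab => /existsPn H; apply/funext => k.
  by apply/eqP; rewrite -[_ == _]negbK.
by rewrite dot_herm (bigD1 k)//= (negbTE kab) mul0r.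
Qed.

Lemma dot_dherm i a b : << dherm i a, herm b >> = << herm a, herm (raise i b) >>.
Proof.
rewrite !dot_tensor_poly; apply: eq_bigr => k _; rewrite /raise.
case: eqP => _; last by rewrite addn0.
by rewrite addn1 (mulrC (hermite (a k))) gaussian_mean_hermiteS mulrC.
Qed.

(* [G i] is the i-th partial derivative of [g] in the weak sense obtained by
   testing against Hermite polynomials, the adjoint of the i-th derivative
   being the map [herm a |-> herm (raise i a)]. *)
Definition gaussian_sobolev (g : 'rV[R]_n -> R) (G : 'I_n -> 'rV[R]_n -> R) :=
  [/\ sqint g, forall i, sqint (G i) &
      forall i a, << G i, herm a >> = << g, herm (raise i a) >>].

Lemma gaussian_sobolev_herm a : gaussian_sobolev (herm a) (fun i => dherm i a).
Proof.
split=> [|i|i b]; [exact: sqint_herm|exact: sqint_dherm|exact: dot_dherm].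
Qed.

Lemma gaussian_sobolev_lin (I : Type) (s : seq I) (c : I -> R)
    (g : I -> 'rV[R]_n -> R) (G : I -> 'I_n -> 'rV[R]_n -> R) :
  (forall l, gaussian_sobolev (g l) (G l)) ->
  gaussian_sobolev (fun x => \sum_(l <- s) c l * g l x)
                   (fun i x => \sum_(l <- s) c l * G l i x).
Proof.
move=> hg.
have h1 l : sqint (g l) by have [] := hg l.
have h2 l i : sqint (G l i) by have [] := hg l.
split=> [|i|i a].
- by apply: sq_integrable_sum => l; exact: sq_integrableZ.
- by apply: sq_integrable_sum => l; exact: sq_integrableZ.
- rewrite !dot_suml; try by move=> l; exact: sq_integrableZ.
  + apply: eq_bigr => l _; rewrite !dotZl//; try exact: sqint_herm.
    by have [_ _ ->] := hg l.
  + exact: sqint_herm.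
  + exact: sqint_herm.
Qed.

(** d_i of [herm (raise j a)] has coefficient a_i + [i = j]. The part with a_i is again raised in
    direction j, so it moves to [G j] as a derivative; the extra unit when i = j is the commutator
    of d_i with the adjoint of d_j. *)
Lemma dot_sobolev_dherm_raise g G i j a : gaussian_sobolev g G ->
  << g, dherm i (raise j a) >> =
  << G j, dherm i a >> + (i == j)%:R * << g, herm a >>.
Proof.
move=> [hg hG gG].
have dE b f : sqint f -> << f, dherm i b >> = (b i)%:R * << f, herm (lower i b) >>.
  move=> hf; rewrite -dotZr//; last exact: sqint_herm.
  by congr dot; apply/funext => x; rewrite dhermE.
rewrite !dE// gG /raise; have [->|ij] := eqVneq i j.
  rewrite mul1r addn1.
  have -> : lower j (fun k => a k + (k == j))%N = a.
    by apply/funext => k; rewrite /lower addnK.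
  have [aj|aj] := posnP (a j).
    by rewrite aj mul0r add0r mul1r.
  have -> : (fun k => lower j a k + (k == j))%N = a.
    apply/funext => k; rewrite /lower; case: eqP => [->|_]; last by rewrite addn0 subn0.
    by rewrite subnK.
  by rewrite -natr1 mulrDl mul1r.
rewrite addn0 mul0r addr0; congr (_ * dot _ _ (herm _)).
apply/funext => k; rewrite /lower; case: (eqVneq k i) => [->|_].
  by rewrite (negbTE ij) !addn0.
by rewrite !subn0.
Qed.

Section divergence.
Variables (v : 'I_n -> 'rV[R]_n -> R) (V : 'I_n -> 'I_n -> 'rV[R]_n -> R).
Hypothesis vV : forall i, gaussian_sobolev (v i) (V i).

(** Index order: [V i j] stands for the j-th derivative of [v i]. *)
Definition gaussian_div x : R := \sum_i (x ord0 i * v i x - V i i x).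

Let hv i : sqint (v i). Proof. by have [] := vV i. Qed.
Let hV i j : sqint (V i j). Proof. by have [] := vV i. Qed.

Lemma measurable_gaussian_div : measurable_fun setT gaussian_div.
Proof.
apply: measurable_sum => i; apply: measurable_funB; last by have [] := hV i i.
by apply: measurable_funM; [exact: measurable_coord|have [] := hv i].
Qed.

(** Multiplication by the coordinate is moved from [v i] to [f], since x_i v_i is not yet known to
    be square integrable; this explains the second condition on [f]. *)
Lemma dot_gaussian_div f : sqint f -> (forall i, sqint (fun x => x ord0 i * f x)) ->
  << gaussian_div, f >> =
  \sum_i (<< v i, fun x => x ord0 i * f x >> - << V i i, f >>).
Proof.
move=> hf hxf; rewrite {1}/dot.
have step (s : seq 'I_n) :
  gamma.-integrable setT (fun x => ((\sum_(i <- s) (x ord0 i * v i x - V i i x)) * f x)%:E) /\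
  \int[gamma]_x ((\sum_(i <- s) (x ord0 i * v i x - V i i x)) * f x) =
  \sum_(i <- s) (<< v i, fun x => x ord0 i * f x >> - << V i i, f >>).
  elim: s => [|i s [IHi IHe]].
    rewrite big_nil; under eq_fun do rewrite big_nil mul0r.
    under eq_Rintegral do rewrite big_nil mul0r.
    by rewrite Rintegral_cst// mul0r; split => //; exact: integrable0.
  have i1 := sq_integrable_mul (hv i) (hxf i).
  have i2 := sq_integrable_mul (hV i i) hf.
  have i12 : gamma.-integrable setT (fun x => (v i x * (x ord0 i * f x) - V i i x * f x)%:E).
    by under eq_fun do rewrite EFinB; exact: integrableB.
  have E x : (\sum_(i0 <- i :: s) (x ord0 i0 * v i0 x - V i0 i0 x)) * f x =
    (v i x * (x ord0 i * f x) - V i i x * f x) +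
    (\sum_(i <- s) (x ord0 i * v i x - V i i x)) * f x.
    by rewrite big_cons; ring.
  split.
    by under eq_fun do rewrite E EFinD; exact: integrableD.
  under eq_Rintegral do rewrite E.
  by rewrite RintegralD// RintegralB// IHe big_cons.
by have [_ ->] := step (index_enum 'I_n).
Qed.

Lemma sqint_coord_tensor_poly i P : sqint (fun x => x ord0 i * tensor_poly P x).
Proof.
rewrite (_ : (fun x => _) = tensor_poly (fun k => if k == i then 'X * P k else P k)).
  exact: sq_integrable_tensor_poly.
apply/funext => x; rewrite /tensor_poly !(bigD1 i (P := predT))//= eqxx hornerM hornerX mulrA.
by congr (_ * _); apply: eq_bigr => k /negbTE ->.
Qed.

(** The divergence is the adjoint of the gradient: in [coord_herm] the raised term cancels the
    pairing of [V i i], by the defining property of [gaussian_sobolev], and the derivative term is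
    left. *)
Lemma dot_gaussian_div_herm a :
  << gaussian_div, herm a >> = \sum_i << v i, dherm i a >>.
Proof.
rewrite dot_gaussian_div; [|exact: sqint_herm|by move=> i; exact: sqint_coord_tensor_poly].
apply: eq_bigr => i _; have [_ _ ->] := vV i.
rewrite (_ : (fun x => _) = herm (raise i a) \+ dherm i a); last first.
  by apply/funext => x; rewrite coord_herm.
rewrite dotDr//; [|exact: sqint_herm|exact: sqint_dherm].
by rewrite addrC addKr.
Qed.

(** The relation d_j delta v = delta (d_j v) + v_j, tested against [herm a]: raising in direction j
    on the left stands for d_j, and the sum on the right is delta (d_j v) moved to the gradient of
    [herm a]. *)
Lemma dot_gaussian_div_raise j a : << gaussian_div, herm (raise j a) >> =
  \sum_i << V i j, dherm i a >> + << v j, herm a >>.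
Proof.
rewrite dot_gaussian_div_herm.
rewrite (eq_bigr (fun i => << V i j, dherm i a >> + (i == j)%:R * << v i, herm a >>)).
  rewrite big_split/=; congr (_ + _).
  rewrite (bigD1 j)//= eqxx mul1r big1 ?addr0// => i /negbTE ->.
  by rewrite mul0r.
by move=> i _; exact: dot_sobolev_dherm_raise.
Qed.

End divergence.

End hermite_tensor.

Lemma cvg_finite_sum (R : realType) (I : Type) (s : seq I) (F : nat -> I -> R) (l : I -> R) :
  (forall i, F m i @[m --> \oo] --> l i) ->
  \sum_(i <- s) F m i @[m --> \oo] --> \sum_(i <- s) l i.
Proof.
move=> Fl; elim: s => [|i s IH].
  by rewrite big_nil; under eq_fun do rewrite big_nil; exact: cvg_cst.
by rewrite big_cons; under eq_fun do rewrite big_cons; exact: cvgD.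
Qed.

(** * Hermite truncation and the norm of the divergence *)

Section hermite_projection.
Context {R : realType} {n : nat}.
Local Notation gamma := (@std_gaussian R n).
Local Notation sqint := (sq_integrable gamma).
Local Notation "<< f , g >>" := (dot gamma f g) (at level 0, format "<< f ,  g >>") : ring_scope.
Implicit Types (a b : 'I_n -> nat) (i j k : 'I_n) (x : 'rV[R]_n).

Definition hermite_span (s : seq (R * ('I_n -> nat))) x : R :=
  \sum_(u <- s) u.1 * herm u.2 x.

Lemma sqint_hermite_span s : sqint (hermite_span s).
Proof. by apply: sq_integrable_sum => u; apply: sq_integrableZ; exact: sqint_herm. Qed.

Lemma dot_hermite_span_eq0 f s (P : pred ('I_n -> nat)) : sqint f ->
  (forall a, P a -> << f, herm a >> = 0) -> all (fun u => P u.2) s ->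
  << f, hermite_span s >> = 0.
Proof.
move=> hf fP; rewrite dot_sumr//; last by move=> u; apply: sq_integrableZ; exact: sqint_herm.
elim: s => [|u s IH] /=; first by rewrite big_nil.
move=> /andP[Pu Ps]; rewrite big_cons IH// addr0 dotZr//; last exact: sqint_herm.
by rewrite fP// mulr0.
Qed.

Lemma hermite_span_bounded (s : seq (R * ('I_n -> nat))) :
  exists N, all (fun u => [forall k, (u.2 k < N)%N]) s.
Proof.
elim: s => [|u s [N HN]]; first by exists 0.
exists (maxn N (\max_k u.2 k).+1) => /=; apply/andP; split.
  by apply/forallP => k; rewrite leq_max orbC ltnS leq_bigmax.
apply: sub_all HN => w /forallP H; apply/forallP => k.
by rewrite leq_max H.
Qed.

Definition hermite_coef g a : R := << g, herm a >> / << herm a, herm a >>.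

(** The multi-indices in a cube of side N form a finite type, over which big sums range. *)
Definition idx N (r : {ffun 'I_n -> 'I_N}) : 'I_n -> nat := fun k => r k.

Definition hermite_proj N g x : R := \sum_(r : {ffun 'I_n -> 'I_N})
  hermite_coef g (idx r) * herm (idx r) x.

Definition hermite_dproj N g i x : R := \sum_(r : {ffun 'I_n -> 'I_N})
  hermite_coef g (idx r) * dherm i (idx r) x.

Lemma gaussian_sobolev_proj N g :
  gaussian_sobolev (hermite_proj N g) (hermite_dproj N g).
Proof. by apply: gaussian_sobolev_lin => r; exact: gaussian_sobolev_herm. Qed.

Lemma dot_hermite_proj N g a : (forall k, (a k < N)%N) ->
  << hermite_proj N g, herm a >> = << g, herm a >>.
Proof.
move=> aN; pose r0 : {ffun 'I_n -> 'I_N} := [ffun k => Ordinal (aN k)].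
have r0a : idx r0 = a by apply/funext => k; rewrite /idx ffunE.
rewrite /hermite_proj dot_suml//; [|by move=> r; apply: sq_integrableZ; exact: sqint_herm|exact: sqint_herm].
rewrite (bigD1 r0)//= big1 => [|r rr0].
  rewrite addr0 dotZl; [|exact: sqint_herm|exact: sqint_herm].
  by rewrite r0a /hermite_coef divfK// gt_eqF// dot_herm_gt0.
rewrite dotZl; [|exact: sqint_herm|exact: sqint_herm].
rewrite dot_herm_neq ?mulr0//; rewrite -r0a => E; move/eqP: rr0; apply.
by apply/ffunP => k; apply/val_inj; exact: (congr1 (@^~ k) E).
Qed.

(** Testing a derivative at index a tests the function at [raise i a], so it is the raised index
    that must lie in the cube. *)
Lemma dot_hermite_dproj N g G i a : gaussian_sobolev g G ->
  (forall k, (raise i a k < N)%N) ->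
  << hermite_dproj N g i, herm a >> = << G i, herm a >>.
Proof.
move=> [_ _ ->] aN; rewrite -(dot_hermite_proj _ aN).
by have [_ _ ->] := gaussian_sobolev_proj N g.
Qed.

Lemma orthogonal_best_approx f p q : sqint f -> sqint p -> sqint q ->
  << f \- p, p >> = 0 -> << f \- p, q >> = 0 ->
  << f \- p, f \- p >> <= << f \- q, f \- q >>.
Proof.
move=> hf hp hq fpp fpq.
have key h l : sqint h -> sqint l -> << h, l >> = 0 ->
    << h, h >> <= << h \+ l, h \+ l >>.
  move=> hh hk hk0; rewrite dotDl ?dotDr//; try exact: sq_integrableD.
  by rewrite (dotC _ l h) hk0 addr0 add0r lerDl; exact: dot_ge0.
have -> : f \- q = (f \- p) \+ (p \- q).
  by apply/funext => x /=; rewrite addrA subrK.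
apply: key; try exact: sq_integrableB.
by rewrite dotBr ?fpp ?fpq ?subrr//; exact: sq_integrableB.
Qed.

Let dotBB f g : << f \- g, f \- g >> = << g \- f, g \- f >>.
Proof. by apply: eq_Rintegral => x _ /=; ring. Qed.

Definition hermite_dense := forall f, sqint f -> forall e, 0 < e ->
  exists s, << f \- hermite_span s, f \- hermite_span s >> < e.

Hypothesis dense : hermite_dense.

Lemma cvg_hermite_proj g G : gaussian_sobolev g G ->
  cvgL2 gamma (hermite_proj^~ g) g.
Proof.
move=> gG; have [hg _ _] := gG; apply/cvgr0Pnorm_lt => e e0.
have [s hs] := dense hg e0; have [N0 hN0] := hermite_span_bounded s.
near=> N; rewrite ger0_norm ?dot_ge0// dotBB; apply: le_lt_trans hs.
have [hp _ _] := gaussian_sobolev_proj N g.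
have orth a : (forall k, (a k < N)%N) -> << g \- hermite_proj N g, herm a >> = 0.
  move=> aN; rewrite dotBl//; last exact: sqint_herm.
  by rewrite dot_hermite_proj// subrr.
apply: orthogonal_best_approx => //; first exact: sqint_hermite_span.
- rewrite dot_sumr; [|by move=> r; apply: sq_integrableZ; exact: sqint_herm|exact: sq_integrableB].
  rewrite big1// => r _; rewrite dotZr; [|exact: sqint_herm|exact: sq_integrableB].
  by rewrite orth ?mulr0// => k; exact: ltn_ord.
- apply: (dot_hermite_span_eq0 (P := fun a => [forall k, (a k < N)%N])).
  + exact: sq_integrableB.
  + by move=> a /forallP; exact: orth.
  + apply: sub_all hN0 => u /forallP H; apply/forallP => k.
    apply: leq_trans (H k) _; near: N; exact: nbhs_infty_ge.
Unshelve. all: by end_near. Qed.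

(** [hermite_dproj N g i] is the orthogonal projection of [G i], not on the cube of side N, but on
    the indices that remain in it after raising in direction i. For N > N0 these contain the cube of
    side N0, so best approximation and density still apply. *)
Lemma cvg_hermite_dproj g G i : gaussian_sobolev g G ->
  cvgL2 gamma (fun N => hermite_dproj N g i) (G i).
Proof.
move=> gG; have [_ hG _] := gG; apply/cvgr0Pnorm_lt => e e0.
have [s hs] := dense (hG i) e0; have [N0 hN0] := hermite_span_bounded s.
near=> N; rewrite ger0_norm ?dot_ge0// dotBB; apply: le_lt_trans hs.
have [_ /(_ i) hp _] := gaussian_sobolev_proj N g.
have orth a : (forall k, (raise i a k < N)%N) -> << G i \- hermite_dproj N g i, herm a >> = 0.
  move=> aN; rewrite dotBl//; last exact: sqint_herm.
  by rewrite (dot_hermite_dproj gG)// subrr.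
apply: orthogonal_best_approx => //; first exact: sqint_hermite_span.
- rewrite dot_sumr; [|by move=> r; apply: sq_integrableZ; exact: sqint_dherm|exact: sq_integrableB].
  rewrite big1// => r _; rewrite dotZr; [|exact: sqint_dherm|exact: sq_integrableB].
  rewrite (_ : dherm i (idx r) = (fun x => (idx r i)%:R * herm (lower i (idx r)) x)); last first.
    by apply/funext => x; rewrite dhermE.
  rewrite dotZr; [|exact: sqint_herm|exact: sq_integrableB].
  have [->|ri] := posnP (idx r i); first by rewrite mul0r mulr0.
  rewrite orth ?mulr0// => k; rewrite /raise /lower.
  case: eqP => [->|_]; last by rewrite addn0 subn0 ltn_ord.
  by rewrite subnK// ltn_ord.
- apply: (dot_hermite_span_eq0 (P := fun a => [forall k, (a k < N0)%N])) => //.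
  + exact: sq_integrableB.
  + move=> a /forallP aN0; apply: orth => k.
    apply: (@leq_ltn_trans (a k).+1); first by rewrite /raise -addn1 leq_add2l leq_b1.
    apply: (leq_ltn_trans (aN0 k)); near: N; exact: nbhs_infty_gt.
Unshelve. all: by end_near. Qed.

Section divergence_norm.
Variables (v : 'I_n -> 'rV[R]_n -> R) (V : 'I_n -> 'I_n -> 'rV[R]_n -> R).
Hypothesis vV : forall i, gaussian_sobolev (v i) (V i).
Let hv i : sqint (v i). Proof. by have [] := vV i. Qed.
Let hV i j : sqint (V i j). Proof. by have [] := vV i. Qed.

(** The divergence of the truncated field. By [qE] it is a finite Hermite sum, so it may be paired
    with any divergence. *)
Let q N := gaussian_div (fun i => hermite_proj N (v i)) (fun i => hermite_dproj N (v i)).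

Let qE N x : q N x = \sum_j \sum_(r : {ffun 'I_n -> 'I_N})
  hermite_coef (v j) (idx r) * herm (raise j (idx r)) x.
Proof.
apply: eq_bigr => j _; rewrite /hermite_proj /hermite_dproj mulr_sumr -sumrB.
by apply: eq_bigr => r _; rewrite mulrCA coord_herm; ring.
Qed.

Let sqint_q N : sqint (q N).
Proof.
rewrite (funext (qE N)).
apply: sq_integrable_sum => j; apply: sq_integrable_sum => r.
by apply: sq_integrableZ; exact: sqint_herm.
Qed.

(** The polarized identity. The field [u] is kept arbitrary because two instances are used: the
    given field, for the cross term, and the truncated field itself, for the norm of [q N]. *)
Lemma dot_gaussian_div_q N (u : 'I_n -> 'rV[R]_n -> R) (U : 'I_n -> 'I_n -> 'rV[R]_n -> R) :
  (forall i, gaussian_sobolev (u i) (U i)) ->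
  << gaussian_div u U, q N >> =
  \sum_j (\sum_i << U i j, hermite_dproj N (v j) i >> + << u j, hermite_proj N (v j) >>).
Proof.
move=> uU.
have hu i : sqint (u i) by have [] := uU i.
have hU i j : sqint (U i j) by have [] := uU i.
have lin (I : Type) (s : seq I) (c : I -> R) (a : I -> 'I_n -> nat) :
    << gaussian_div u U, fun x => \sum_(l <- s) c l * herm (a l) x >> =
    \sum_(l <- s) c l * << gaussian_div u U, herm (a l) >>.
  have hh l : sqint (fun x => c l * herm (a l) x).
    by apply: sq_integrableZ; exact: sqint_herm.
  have hxh i l : sqint (fun x => c l * (x ord0 i * herm (a l) x)).
    by apply: sq_integrableZ; exact: sqint_coord_tensor_poly.
  have xE i : (fun x => x ord0 i * (\sum_(l <- s) c l * herm (a l) x)) =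
      (fun x => \sum_(l <- s) c l * (x ord0 i * herm (a l) x)).
    by apply/funext => x; rewrite mulr_sumr; apply: eq_bigr => l _; rewrite mulrCA.
  rewrite (dot_gaussian_div uU); last 2 first.
  - exact: sq_integrable_sum.
  - by move=> i; rewrite xE; exact: sq_integrable_sum.
  under eq_bigr => i _ do rewrite xE !dot_sumr// -sumrB.
  rewrite exchange_big/=; apply: eq_bigr => l _.
  rewrite (dot_gaussian_div uU) ?mulr_sumr; last 2 first.
  - exact: sqint_herm.
  - by move=> i; exact: sqint_coord_tensor_poly.
  apply: eq_bigr => i _; rewrite mulrBr !dotZr//; [exact: sqint_herm|exact: sqint_coord_tensor_poly].
have -> : q N = fun x => \sum_(l : 'I_n * {ffun 'I_n -> 'I_N})
    hermite_coef (v l.1) (idx l.2) * herm (raise l.1 (idx l.2)) x.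
  by apply/funext => x; rewrite qE pair_bigA.
rewrite lin -(pair_bigA _ (fun j (r : {ffun 'I_n -> 'I_N}) => hermite_coef (v j) (idx r) *
  << gaussian_div u U, herm (raise j (idx r)) >>))/=.
apply: eq_bigr => j _.
under eq_bigr => r _ do rewrite (dot_gaussian_div_raise uU) mulrDr mulr_sumr.
rewrite big_split/= exchange_big/=; congr (_ + _).
  apply: eq_bigr => i _; rewrite dot_sumr//; last first.
    by move=> r; apply: sq_integrableZ; exact: sqint_dherm.
  by apply: eq_bigr => r _; rewrite dotZr//; exact: sqint_dherm.
rewrite dot_sumr//; last first.
  by move=> r; apply: sq_integrableZ; exact: sqint_herm.
by apply: eq_bigr => r _; rewrite dotZr//; exact: sqint_herm.
Qed.

Let rhs := \sum_j (\sum_i << V i j, V j i >> + << v j, v j >>).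

Let hP N i : sqint (hermite_proj N (v i)).
Proof. by have [] := gaussian_sobolev_proj N (v i). Qed.
Let hD N i j : sqint (hermite_dproj N (v i) j).
Proof. by have [] := gaussian_sobolev_proj N (v i). Qed.

Let cvg_cross : << gaussian_div v V, q N >> @[N --> \oo] --> rhs.
Proof.
under eq_fun do rewrite (dot_gaussian_div_q _ vV).
apply: cvg_finite_sum => j; apply: cvgD.
  apply: cvg_finite_sum => i; apply: cvgL2_dot => //; first exact: cvgL2_cst.
  exact: cvg_hermite_dproj.
by apply: cvgL2_dot => //; [exact: cvgL2_cst|exact: cvg_hermite_proj (vV j)].
Qed.

Let cvg_norm : << q N, q N >> @[N --> \oo] --> rhs.
Proof.
under eq_fun => N do rewrite (dot_gaussian_div_q _ (fun i => gaussian_sobolev_proj N (v i))).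
apply: cvg_finite_sum => j; apply: cvgD.
  by apply: cvg_finite_sum => i; apply: cvgL2_dot => //; exact: cvg_hermite_dproj.
by apply: cvgL2_dot => //; exact: cvg_hermite_proj (vV j).
Qed.

Let le_2dot f g : sqint f -> sqint g -> 2 * << f, g >> <= << f, f >> + << g, g >>.
Proof.
move=> hf hg; have := dot_ge0 gamma (f \- g).
rewrite dotBl ?dotBr//; try exact: sq_integrableB.
rewrite (dotC _ g f); lra.
Qed.

(* Truncating the divergence to [-M, M] makes it a legitimate square integrable
   test function against which [q N] converges weakly. *)
Let trunc (M : nat) x := if `|gaussian_div v V x| <= M%:R then gaussian_div v V x else 0.

Let mdiv := measurable_gaussian_div vV.

Let measurable_trunc M : measurable_fun setT (trunc M).
Proof.
apply: measurable_fun_ifT => //.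
by apply: measurable_fun_ler => //; exact: measurableT_comp.
Qed.

Let sqint_cst c : sqint (cst c).
Proof.
split => //; rewrite (eq_integral (cst (c ^+ 2)%:E))// integral_cst//.
by rewrite [X in (_ * X)%E]std_gaussian_setT mule1 ltry.
Qed.

Let trunc_le M x : `|trunc M x| <= M%:R.
Proof. by rewrite /trunc; case: ifPn => // _; rewrite normr0. Qed.

Let sqint_trunc M : sqint (trunc M).
Proof.
apply: (sq_integrable_le _ (sqint_cst M%:R)) => // x.
by rewrite (le_trans (trunc_le _ _))// normr_nat.
Qed.

Let sqint_coord_trunc M i : sqint (fun x => x ord0 i * trunc M x).
Proof.
have h1 := sq_integrableZ M%:R (sqint_coord_tensor_poly i (fun=> 1 : {poly R})).
have mt : measurable_fun setT (fun x : 'rV[R]_n => x ord0 i * trunc M x).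
  by apply: measurable_funM => //; exact: measurable_coord.
apply: (sq_integrable_le mt h1) => x.
rewrite /tensor_poly big1 ?mulr1 => [|k _]; last by rewrite hornerE.
by rewrite mulrC !normrM normr_nat ler_wpM2r.
Qed.

(** Lower semicontinuity of the norm. As [trunc M] is bounded, [q N] tested on it converges to the
    pairing of the divergence with [trunc M], which is the squared norm of [trunc M]; then 2 <q N,
    t> <= |q N|^2 + |t|^2 passes to the limit. *)
Let trunc_norm_le M : << trunc M, trunc M >> <= rhs.
Proof.
have E : << gaussian_div v V, trunc M >> = << trunc M, trunc M >>.
  apply: eq_Rintegral => x _; rewrite /trunc; case: ifPn => // _.
  by rewrite !mulr0.
have weak : << q N, trunc M >> @[N --> \oo] --> << trunc M, trunc M >>.
  rewrite -E (dot_gaussian_div vV)//.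
  under eq_fun => N do rewrite (dot_gaussian_div (fun i => gaussian_sobolev_proj N (v i)))//.
  apply: cvg_finite_sum => i; apply: cvgB.
    by apply: cvgL2_dot => //; [exact: cvg_hermite_proj (vV i)|exact: cvgL2_cst].
  by apply: cvgL2_dot => //; [exact: cvg_hermite_dproj|exact: cvgL2_cst].
suff : 2 * << trunc M, trunc M >> <= rhs + << trunc M, trunc M >> by lra.
have H1 : 2 * << q N, trunc M >> @[N --> \oo] --> 2 * << trunc M, trunc M >>.
  by apply: cvgMr.
have H2 : << q N, q N >> + << trunc M, trunc M >> @[N --> \oo] --> rhs + << trunc M, trunc M >>.
  by apply: cvgD => //; exact: cvg_cst.
apply: (ler_cvg_to H1 H2); apply: nearW => N; exact: le_2dot.
Qed.

(** Letting M grow in [trunc_norm_le] gives the upper bound together with square integrability; only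
    then can the divergence be compared with [q N] in L^2, which gives the lower bound. *)
Theorem gaussian_div_norm : sqint (gaussian_div v V) /\
  << gaussian_div v V, gaussian_div v V >> = rhs.
Proof.
have sq_le : (\int[gamma]_x (gaussian_div v V x ^+ 2)%:E <= rhs%:E)%E.
  have H : (\int[gamma]_x (trunc M x ^+ 2)%:E)%E @[M --> \oo] -->
      (\int[gamma]_x (gaussian_div v V x ^+ 2)%:E)%E.
    rewrite (eq_integral (fun x => limn (fun M => (trunc M x ^+ 2)%:E))); last first.
      move=> x _; apply/esym/cvg_lim => //; apply: cvg_near_cst.
      near=> M; rewrite /trunc ifT//; near: M; exact: nbhs_infty_ger.
    apply: (cvg_monotone_convergence measurableT (g' := fun M x => (trunc M x ^+ 2)%:E)).
    - by move=> M; apply/measurable_EFinP/measurable_funX.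
    - by move=> M x _; rewrite lee_fin sqr_ge0.
    - move=> x _ M1 M2 M12; rewrite lee_fin /trunc.
      case: ifPn => [h|_]; last by rewrite expr0n sqr_ge0.
      by rewrite (le_trans h) ?ler_nat.
  apply: (cvge_to_le H); apply: nearW => M.
  by rewrite sq_integralE// lee_fin.
have hT : sqint (gaussian_div v V) by split => //; exact: le_lt_trans sq_le (ltry _).
split => //; apply/eqP; rewrite eq_le; apply/andP; split.
  by rewrite -lee_fin -sq_integralE.
suff : 2 * rhs <= << gaussian_div v V, gaussian_div v V >> + rhs by lra.
have H1 : 2 * << gaussian_div v V, q N >> @[N --> \oo] --> 2 * rhs by apply: cvgMr.
have H2 : << gaussian_div v V, gaussian_div v V >> + << q N, q N >> @[N --> \oo] -->
    << gaussian_div v V, gaussian_div v V >> + rhs.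
  by apply: cvgD => //; exact: cvg_cst.
by apply: (ler_cvg_to H1 H2); apply: nearW => N; exact: le_2dot.
Unshelve. all: by end_near. Qed.

End divergence_norm.
End hermite_projection.

(** * Density of the Hermite polynomials *)

Lemma bernoulli_ge (R : realFieldType) (u : R) m : 0 <= u <= 1 ->
  1 - m%:R * u <= (1 - u) ^+ m.
Proof.
move=> /andP[u0 u1]; elim: m => [|m IH]; first by rewrite mul0r subr0 expr0.
rewrite exprS; apply: (@le_trans _ _ ((1 - u) * (1 - m%:R * u))); last first.
  by rewrite ler_wpM2l// subr_ge0.
rewrite -natr1; have := ler0n R m => m0; nra.
Qed.

Section threshold.
Context {R : realType}.
Implicit Types s : R.

(** Polynomials in s, so that good multipliers are stable under them, approximating a step at 1/2;
    powers of 1 - s^k play the same part in elementary proofs of the Stone-Weierstrass theorem. *)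
Definition threshold k s := 1 - (1 - s ^+ k) ^+ (k * 2 ^ k).

Lemma threshold_itv k s : 0 <= s <= 1 -> 0 <= threshold k s <= 1.
Proof.
move=> /andP[s0 s1].
have a0 : 0 <= 1 - s ^+ k by rewrite subr_ge0 exprn_ile1.
have a1 : 1 - s ^+ k <= 1 by rewrite lerBlDr lerDl exprn_ge0.
by rewrite /threshold subr_ge0 exprn_ile1//= lerBlDr lerDl exprn_ge0.
Qed.

(* The exponent [k * 2 ^ k] is large enough to send [(1 - s ^+ k)] to 0 when
   [s >= 1/2], and [(k * 2 ^ k) * s ^+ k] still tends to 0 when [s < 1/2]. *)
Lemma cvg_threshold s : 0 < s <= 1 ->
  threshold k s @[k --> \oo] --> (if 2^-1 <= s then 1 else 0 : R).
Proof.
move=> /andP[s0 s1]; have ss : 0 <= s <= 1 by rewrite (ltW s0).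
case: ifPn => [s2|].
  rewrite -[X in _ --> X]subr0; apply: cvgB; first exact: cvg_cst.
  (* (1 - s^k)^(k 2^k) <= exp (- k (2 s)^k) <= exp (- k), which includes s = 1/2 itself. *)
  have := @cvgn_expR R; apply: squeeze_cvgr; last exact: cvg_cst.
  apply: nearW => k.
  have a0 : 0 <= 1 - s ^+ k by rewrite subr_ge0 exprn_ile1// ltW.
  rewrite exprn_ge0//=; apply: (@le_trans _ _ (expR (- s ^+ k) ^+ (k * 2 ^ k))).
    by rewrite lerXn2r ?nnegrE ?expR_ge0// expR_ge1Dx.
  rewrite -expRM_natl ler_expR mulrN lerN2 natrM -mulrA ler_peMr//.
  rewrite natrX -exprMn exprn_ege1//.
  by rewrite -ler_pdivrMl// mulr1.
rewrite -ltNge => s2.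
have q1 : 0 < 2 * s < 1 by rewrite mulr_gt0//= -ltr_pdivlMl// mulr1.
(* Then k (2 s)^k = k exp (- k b), and exp u >= u^2 / 2 at u = k b bounds it by 2 / (b^2 k). *)
pose b := - ln (2 * s).
have b0 : 0 < b by rewrite oppr_gt0 ln_lt0.
have H : 2 / b ^+ 2 * (k%:R^-1) @[k --> \oo] --> (0 : R).
  rewrite -[X in _ --> X](mulr0 (2 / b ^+ 2)); apply: cvgMr.
  apply/gtr0_cvgV0; last exact: cvgr_idn.
  by near=> k; rewrite ltr0n; near: k; exact: nbhs_infty_gt.
move: H; apply: squeeze_cvgr; last exact: cvg_cst.
near=> k; have k0 : (0 < k)%N by near: k; exact: nbhs_infty_gt.
have /andP[-> _] /= := threshold_itv k ss.
have sk : 0 <= s ^+ k <= 1 by rewrite exprn_ge0 ?exprn_ile1// ltW.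
apply: (@le_trans _ _ ((k * 2 ^ k)%:R * s ^+ k)).
  by rewrite /threshold lerBlDl -lerBlDr; exact: bernoulli_ge.
rewrite natrM natrX -mulrA -exprMn.
have -> : (2 * s) ^+ k = (expR (k%:R * b))^-1.
  by rewrite -expRN -mulrN /b opprK expRM_natl lnK// posrE; case/andP: q1.
rewrite ler_pdivrMr ?expR_gt0//.
apply: (@le_trans _ _ (2 / b ^+ 2 * k%:R^-1 * ((k%:R * b) ^+ 2 / 2))).
  rewrite le_eqVlt; apply/orP; left; apply/eqP; field.
  by rewrite pnatr_eq0 -lt0n k0 gt_eqF.
rewrite ler_wpM2l ?mulr_ge0 ?invr_ge0 ?exprn_ge0 ?(ltW b0)//.
have kb : 0 <= k%:R * b by rewrite mulr_ge0// ltW.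
by have := expR_ge1Dxn 1 kb; rewrite (_ : 2`! = 2%N)//; lra.
Unshelve. all: by end_near. Qed.

End threshold.

(** * Bounded multipliers of the closure of the Hermite span *)

Section hermite_density.
Context {R : realType} {n : nat}.
Local Notation gamma := (@std_gaussian R n).
Local Notation sqint := (sq_integrable gamma).
Local Notation "<< f , g >>" := (dot gamma f g) (at level 0, format "<< f ,  g >>") : ring_scope.
Implicit Types (a b : 'I_n -> nat) (i j k : 'I_n) (x : 'rV[R]_n) (f g : 'rV[R]_n -> R).

Definition in_hermite_span f := exists s, f = hermite_span s.

Lemma in_hermite_span_herm a : in_hermite_span (herm a).
Proof. by exists [:: (1, a)]; apply/funext => x; rewrite /hermite_span big_seq1 mul1r. Qed.

Lemma in_hermite_spanD f g : in_hermite_span f -> in_hermite_span g -> in_hermite_span (f \+ g).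
Proof.
move=> [s ->] [t ->]; exists (s ++ t); apply/funext => x.
by rewrite /hermite_span big_cat.
Qed.

Lemma in_hermite_spanZ c f : in_hermite_span f -> in_hermite_span (fun x => c * f x).
Proof.
move=> [s ->]; exists [seq (c * u.1, u.2) | u <- s]; apply/funext => x.
rewrite /hermite_span big_map mulr_sumr; apply: eq_bigr => u _ /=.
by rewrite mulrA.
Qed.

Lemma in_hermite_span_coord i f : in_hermite_span f ->
  in_hermite_span (fun x => x ord0 i * f x).
Proof.
move=> [s ->]; elim: s => [|[c a] s IH].
  exists [::]; apply/funext => x.
  by rewrite /hermite_span !big_nil mulr0.
rewrite (_ : (fun x => _) = (fun x => c * (herm (raise i a) \+
    (fun x => (a i)%:R * herm (lower i a) x)) x) \+
    (fun x => x ord0 i * hermite_span s x)).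
  apply: in_hermite_spanD => //; apply: in_hermite_spanZ; apply: in_hermite_spanD.
    exact: in_hermite_span_herm.
  by apply: in_hermite_spanZ; exact: in_hermite_span_herm.
apply/funext => x /=; rewrite /hermite_span big_cons/= -dhermE -coord_herm; ring.
Qed.

Lemma in_hermite_span_poly i (p : {poly R}) f : in_hermite_span f ->
  in_hermite_span (fun x => p.[x ord0 i] * f x).
Proof.
move=> hf; elim/poly_ind: p => [|p c IH].
  rewrite (_ : (fun x => _) = (fun x => 0 * f x)); first exact: in_hermite_spanZ.
  by apply/funext => x; rewrite horner0.
rewrite (_ : (fun x => _) =
    (fun x => x ord0 i * (p.[x ord0 i] * f x)) \+ (fun x => c * f x)).
  apply: in_hermite_spanD; last exact: in_hermite_spanZ.
  exact: in_hermite_span_coord.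
by apply/funext => x /=; rewrite hornerMXaddC; ring.
Qed.

Definition approximable f := sqint f /\ forall e, 0 < e ->
  exists s, << f \- hermite_span s, f \- hermite_span s >> < e.

Lemma approximable_span f : in_hermite_span f -> approximable f.
Proof.
move=> [s ->]; split=> [|e e0]; first exact: sqint_hermite_span.
exists s; rewrite (_ : _ \- _ = (fun=> 0)) ?dot0l//.
by apply/funext => x /=; rewrite subrr.
Qed.

Lemma dotD_le f g : sqint f -> sqint g ->
  << f \+ g, f \+ g >> <= 2 * << f, f >> + 2 * << g, g >>.
Proof.
move=> hf hg; have := dot_ge0 gamma (f \- g).
have := sq_integrableD hf hg; have := sq_integrableB hf hg => h1 h2.
rewrite dotBl// !dotBr// dotDl// !dotDr// (dotC _ g f); lra.
Qed.

Lemma approximableD f g : approximable f -> approximable g -> approximable (f \+ g).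
Proof.
move=> [hf af] [hg ag]; split=> [|e e0]; first exact: sq_integrableD.
have e4 : 0 < e / 4 by rewrite divr_gt0.
have [s hs] := af _ e4; have [t ht] := ag _ e4; exists (s ++ t).
rewrite (_ : _ \- _ = (f \- hermite_span s) \+ (g \- hermite_span t)); last first.
  by apply/funext => x /=; rewrite /hermite_span big_cat/=; ring.
apply: le_lt_trans (dotD_le _ _) _; try exact: sq_integrableB (sqint_hermite_span _).
lra.
Qed.

Lemma approximableZ c f : approximable f -> approximable (fun x => c * f x).
Proof.
move=> [hf af]; split=> [|e e0]; first exact: sq_integrableZ.
have c1 : 0 < c ^+ 2 + 1 by have := sqr_ge0 c; lra.
have [s hs] := af _ (divr_gt0 e0 c1).
exists [seq (c * u.1, u.2) | u <- s].
rewrite (_ : _ \- _ = (fun x => c * (f \- hermite_span s) x)); last first.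
  apply/funext => x /=; rewrite /hermite_span big_map mulrBr mulr_sumr.
  by congr (_ - _); apply: eq_bigr => u _ /=; rewrite mulrA.
have hfs := sq_integrableB hf (sqint_hermite_span s).
have := hs; rewrite dotZl//; last exact: sq_integrableZ.
rewrite dotZr// mulrA -expr2 ltr_pdivlMr// => H; apply: le_lt_trans H.
by rewrite mulrC ler_wpM2l ?dot_ge0// lerDl.
Qed.

Lemma approximable_sum (I : Type) (s : seq I) (F : I -> 'rV[R]_n -> R) :
  (forall l, approximable (F l)) -> approximable (fun x => \sum_(l <- s) F l x).
Proof.
move=> aF; elim: s => [|l s IH].
  apply: approximable_span; exists [::]; apply/funext => x.
  by rewrite /hermite_span !big_nil.
by under eq_fun do rewrite big_cons; exact: approximableD.
Qed.

Lemma approximable_cvg (F : nat -> 'rV[R]_n -> R) f : sqint f ->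
  (forall m, approximable (F m)) -> cvgL2 gamma F f -> approximable f.
Proof.
move=> hf aF Ff; split => // e e0.
have e4 : 0 < e / 4 by rewrite divr_gt0.
have /cvgr0Pnorm_lt/(_ _ e4)[m _ /(_ m (leqnn m))/=] := Ff.
rewrite ger0_norm ?dot_ge0// => hm.
have [hFm /(_ _ e4)[s hs]] := aF m; exists s.
rewrite (_ : _ \- _ = (F m \- hermite_span s) \+ (fun x => -1 * (F m \- f) x)); last first.
  by apply/funext => x /=; ring.
have h1 := sq_integrableB hFm hf.
apply: le_lt_trans (dotD_le _ _) _.
- exact: sq_integrableB (sqint_hermite_span _).
- exact: sq_integrableZ.
rewrite dotZl ?dotZr//; last exact: sq_integrableZ.
lra.
Qed.

(* These functions form an algebra closed under bounded pointwise limits, and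
   multiplication by them preserves the closure of the Hermite span. *)
Definition good_multiplier f := [/\ measurable_fun setT f,
  exists C, forall x, `|f x| <= C &
  forall a, approximable (fun x => f x * herm a x)].

Lemma sqint_bounded_mul f C g : measurable_fun setT f -> (forall x, `|f x| <= C) ->
  sqint g -> sqint (fun x => f x * g x).
Proof.
move=> mf fC hg; apply: (sq_integrable_le _ (sq_integrableZ C hg)).
  by apply: measurable_funM => //; case: hg.
move=> x; rewrite !normrM ler_wpM2r//.
exact: le_trans (fC x) (ler_norm C).
Qed.

(** The definition speaks only of products with Hermite tensors; boundedness extends it to their
    whole closure, which is what makes good multipliers stable under products. *)
Lemma good_multiplier_approximable f g : good_multiplier f -> approximable g ->
  approximable (fun x => f x * g x).
Proof.
move=> [mf [C fC] af] [hg ag].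
have hfg := sqint_bounded_mul mf fC hg.
split => // e e0.
have C1 : 0 < C ^+ 2 + 1 by have := sqr_ge0 C; lra.
have e4 : 0 < e / 4 by rewrite divr_gt0.
(* Multiplication by [f] costs a factor C^2, and the 1 added to it keeps the divisor positive; the
   two errors of e / 4 absorb the factors 2 of [dotD_le]. *)
have [s hs] := ag _ (divr_gt0 e4 C1).
have hgs := sq_integrableB hg (sqint_hermite_span s).
have hfgs := sqint_bounded_mul mf fC hgs.
have : approximable (fun x => f x * hermite_span s x).
  rewrite (_ : (fun x => _) = (fun x => \sum_(u <- s) u.1 * (f x * herm u.2 x))).
    by apply: approximable_sum => u; exact: approximableZ.
  by apply/funext => x; rewrite /hermite_span mulr_sumr; apply: eq_bigr => u _; rewrite mulrCA.
move=> [hfs /(_ _ e4)[t ht]]; exists t.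
rewrite (_ : _ \- _ = (fun x => f x * (g \- hermite_span s) x) \+
    ((fun x => f x * hermite_span s x) \- hermite_span t)); last first.
  by apply/funext => x /=; ring.
apply: le_lt_trans (dotD_le _ _) _ => //.
  exact: sq_integrableB (sqint_hermite_span _).
have : << fun x => f x * (g \- hermite_span s) x, fun x => f x * (g \- hermite_span s) x >>
    <= C ^+ 2 * << g \- hermite_span s, g \- hermite_span s >>.
  rewrite -dotZl//; apply: le_Rintegral => //.
  - exact: sq_integrable_mul.
  - by apply: sq_integrable_mul => //; exact: sq_integrableZ.
  - move=> x _; rewrite mulrACA -[leRHS]mulrA -!expr2 ler_wpM2r ?sqr_ge0//.
    rewrite -(real_normK (num_real (f x))) lerXn2r ?nnegrE//.
    exact: le_trans (fC x).
have : << g \- hermite_span s, g \- hermite_span s >> * (C ^+ 2 + 1) < e / 4.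
  by rewrite -ltr_pdivlMr.
have := dot_ge0 gamma (g \- hermite_span s); have := sqr_ge0 C; lra.
Qed.

Lemma good_multiplier_cst c : good_multiplier (cst c).
Proof.
split => //; first by exists `|c|.
by move=> a; apply: approximableZ; apply: approximable_span; exact: in_hermite_span_herm.
Qed.

Lemma good_multiplierD f g : good_multiplier f -> good_multiplier g -> good_multiplier (f \+ g).
Proof.
move=> [mf [C fC] af] [mg [D gD] ag]; split; first exact: measurable_funD.
  by exists (C + D) => x; rewrite (le_trans (ler_normD _ _))// lerD.
move=> a; rewrite (_ : (fun x => _) = (fun x => f x * herm a x) \+ (fun x => g x * herm a x)).
  exact: approximableD.
by apply/funext => x /=; rewrite mulrDl.
Qed.

Lemma good_multiplierM f g : good_multiplier f -> good_multiplier g -> good_multiplier (f \* g).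
Proof.
move=> gf [mg [D gD] ag]; have [mf [C fC] af] := gf.
split; first exact: measurable_funM.
  by exists (C * D) => x; rewrite normrM ler_pM.
move=> a; under eq_fun do rewrite -mulrA.
exact: good_multiplier_approximable.
Qed.

Lemma good_multiplierX f m : good_multiplier f -> good_multiplier (fun x => f x ^+ m).
Proof.
move=> gf; elim: m => [|m IH].
  by under eq_fun do rewrite expr0; exact: good_multiplier_cst.
by under eq_fun do rewrite exprS; exact: good_multiplierM.
Qed.

Lemma good_multiplier_onem f : good_multiplier f -> good_multiplier (fun x => 1 - f x).
Proof.
move=> gf; rewrite (_ : (fun x => _) = cst 1 \+ (cst (-1) \* f)).
  apply: good_multiplierD; first exact: good_multiplier_cst.
  by apply: good_multiplierM => //; exact: good_multiplier_cst.
by apply/funext => x /=; rewrite mulN1r.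
Qed.

Lemma good_multiplier_cvg (F : nat -> 'rV[R]_n -> R) f C :
  (forall m, good_multiplier (F m)) -> (forall m x, `|F m x| <= C) ->
  (forall x, F m x @[m --> \oo] --> f x) -> good_multiplier f.
Proof.
move=> gF FC Ff.
have mF m : measurable_fun setT (F m) by have [] := gF m.
have mf : measurable_fun setT f.
  by apply: (measurable_fun_cvg (h := F)) => // x _; exact: Ff.
have fC x : `|f x| <= C.
  by apply: (cvgr_to_le (cvg_norm (Ff x))); apply: nearW => m; exact: FC.
split => //; first by exists C.
move=> a; have hfa := sqint_bounded_mul mf fC (sqint_herm a).
apply: (@approximable_cvg (fun m x => F m x * herm a x)) => //.
  by move=> m; have [] := gF m.
apply: (dominated_cvgL2 (h := fun x => 2 * C * herm a x)).
- by move=> m; apply: measurable_funM => //; exact: measurable_tensor_poly.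
- by case: hfa.
- by apply: sq_integrableZ; exact: sqint_herm.
- move=> m x; rewrite -mulrBl !normrM ler_wpM2r//.
  rewrite (le_trans (ler_normB _ _))// (le_trans (lerD (FC m x) (fC x)))//.
  by rewrite [`|2|]ger0_norm// mulrDl mul1r lerD// ler_norm.
- by move=> x; apply: cvgMl; exact: Ff.
Qed.

End hermite_density.

Section hermite_density_theorem.
Context {R : realType} {n : nat}.
Local Notation gamma := (@std_gaussian R n).
Local Notation sqint := (sq_integrable gamma).
Implicit Types (a b : 'I_n -> nat) (i j k : 'I_n) (x : 'rV[R]_n) (f g : 'rV[R]_n -> R).

Lemma sqint_tensor (f : 'I_n -> R -> R) : (forall k, measurable_fun setT (f k)) ->
  (forall k, gaussian_growth 8^-1 (f k)) -> sqint (fun x => \prod_k f k (x ord0 k)).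
Proof.
move=> mf gf; apply: integrable_sq.
  apply: measurable_prod => k _; apply: measurableT_comp => //.
  exact: measurable_coord.
have ff k : (normal_prob (0 : R) 1).-integrable setT (EFin \o (f k \* f k)).
  apply: gaussian_growth_integrable; first exact: measurable_funM.
  rewrite (_ : 4^-1 = 8^-1 + 8^-1); last by field.
  exact: gaussian_growthM.
have [+ _] := integral_tensor ff.
by under [in X in X -> _]eq_fun do rewrite big_split/= -expr2.
Qed.

Lemma series_exp_coeff_le (y : R) m : `|series (exp_coeff y) m| <= expR `|y|.
Proof.
apply: (@le_trans _ _ (series (exp_coeff `|y|) m)).
  rewrite /series/=; apply: le_trans (ler_norm_sum _ _ _) _.
  by apply: ler_sum => k _; rewrite /exp_coeff/= normrM normrX normfV normr_nat.
apply: nondecreasing_cvgn_le; last exact: is_cvg_series_exp_coeff.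
apply/nondecreasing_seqP => k; rewrite !seriesEnat/= big_nat_recr//= lerDl.
by rewrite exp_coeff_ge0.
Qed.

(* [c] is small enough for [expR (c * t ^+ 2)], which dominates the partial sums
   of the exponential series, to be square integrable against polynomials. *)
Lemma good_multiplier_small_gaussian i (c z : R) : 0 < c <= 32^-1 ->
  good_multiplier (fun x => expR (- (c * (x ord0 i - z) ^+ 2))).
Proof.
move=> /andP[c0 c1].
have mxi : measurable_fun setT (fun x : 'rV[R]_n => - (c * (x ord0 i - z) ^+ 2)).
  apply: measurable_funN; apply: measurable_funM => //; apply: measurable_funX.
  by apply: measurable_funB => //; exact: measurable_coord.
have mf : measurable_fun setT (fun x : 'rV[R]_n => expR (- (c * (x ord0 i - z) ^+ 2))).
  by apply: measurableT_comp.
have y0 x : 0 <= c * (x ord0 i - z) ^+ 2 by rewrite mulr_ge0 ?sqr_ge0// ltW.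
have f1 x : `|expR (- (c * (x ord0 i - z) ^+ 2))| <= 1.
  by rewrite ger0_norm ?expR_ge0// expR_le1 oppr_le0.
split => //; first by exists 1.
move=> a.
pose y x := - (c * (x ord0 i - z) ^+ 2).
pose p m : {poly R} := \sum_(k < m) (k`!%:R)^-1 *: (- (c *: ('X - z%:P) ^+ 2)) ^+ k.
have pE m x : (p m).[x ord0 i] = series (exp_coeff (y x)) m.
  rewrite /p horner_sum /series/= big_mkord; apply: eq_bigr => k _.
  by rewrite hornerZ horner_exp hornerN hornerZ horner_exp hornerXsubC mulrC.
apply: (@approximable_cvg _ _ (fun m x => (p m).[x ord0 i] * herm a x)).
- exact: (sqint_bounded_mul mf f1 (sqint_herm a)).
- move=> m; apply: approximable_span; apply: in_hermite_span_poly.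
  exact: in_hermite_span_herm.
(* The budget: 2 c <= 1/16 for the exponential and 1/16 for the polynomial make the rate 1/8 of
   [sqint_tensor], that is 1/4 after squaring. *)
pose h k t := (if k == i then expR (2 * c * t ^+ 2) else 1) * (hermite (a k)).[t].
have hh : sqint (fun x => \prod_k h k (x ord0 k)).
  have e1 : (0 : R) < 16^-1 by [].
  apply: sqint_tensor => k; rewrite /h; case: eqP => _.
  - apply: measurable_funM; last exact: measurable_horner.
    by apply: measurableT_comp => //; apply: measurable_funM.
  - by apply: measurable_funM => //; exact: measurable_horner.
  - rewrite (_ : 8^-1 = 16^-1 + 16^-1); last by field.
    apply: gaussian_growthM; last exact: gaussian_growth_poly.
    exists 1 => t; rewrite mul1r ger0_norm ?expR_ge0// ler_expR ler_wpM2r ?sqr_ge0//.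
    by lra.
  - rewrite (_ : 8^-1 = 16^-1 + 16^-1); last by field.
    apply: gaussian_growthM; last exact: gaussian_growth_poly.
    by apply: gaussian_growth_cst.
have hE x : \prod_k h k (x ord0 k) = expR (2 * c * x ord0 i ^+ 2) * herm a x.
  rewrite big_split/=; congr (_ * _).
  by rewrite (bigD1 i)//= eqxx big1 ?mulr1// => k /negbTE ->.
(* From (x_i - z)^2 <= 2 x_i^2 + 2 z^2; the factor 2 covers a partial sum and its limit. *)
have [K KE] : exists K, K = 2 * expR (2 * c * z ^+ 2) by eexists.
apply: (dominated_cvgL2 (h := fun x => K * \prod_k h k (x ord0 k))).
- move=> m; apply: measurable_funM; last exact: measurable_tensor_poly.
  by apply: measurableT_comp (measurable_coord i); exact: measurable_horner.
- by apply: measurable_funM => //; exact: measurable_tensor_poly.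
- exact: sq_integrableZ.
- move=> m x; rewrite -mulrBl hE mulrA !normrM ler_wpM2r//.
  rewrite pE; apply: (@le_trans _ _ (expR `|y x| + expR `|y x|)).
    rewrite (le_trans (ler_normB _ _))// lerD//; first exact: series_exp_coeff_le.
    by rewrite ger0_norm ?expR_ge0// ler_expR ler_norm.
  rewrite -[leRHS]normrM [leRHS]ger0_norm; last by rewrite KE !mulr_ge0 ?expR_ge0.
  rewrite (_ : K * _ = 2 * expR (2 * c * z ^+ 2 + 2 * c * x ord0 i ^+ 2)); last first.
    by rewrite KE expRD mulrA.
  rewrite -[leLHS]mulr2n -[leLHS]mulr_natl ler_wpM2l// ler_expR.
  rewrite normrN ger0_norm// -subr_ge0 (_ : _ - _ = c * (x ord0 i + z) ^+ 2); last by ring.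
  by rewrite mulr_ge0 ?sqr_ge0 ?(ltW c0).
- move=> x; apply: cvgMl; under eq_fun do rewrite pE.
  exact: is_cvg_series_exp_coeff.
Qed.

(** A Gaussian of any rate c is the m-th power of one of rate c / m, which is small enough for m
    large. *)
Lemma good_multiplier_gaussian i (c z : R) : 0 < c ->
  good_multiplier (fun x => expR (- (c * (x ord0 i - z) ^+ 2))).
Proof.
move=> c0; pose m := (Num.truncn (32 * c)).+1.
have m0 : 0 < m%:R :> R by rewrite ltr0n.
have cm : 0 < c / m%:R <= 32^-1.
  rewrite divr_gt0//= ler_pdivrMr// -ler_pdivrMl ?invr_gt0// invrK.
  by rewrite ltW// truncnS_gt.
have := good_multiplierX m (good_multiplier_small_gaussian i z cm).
under eq_fun do rewrite -expRM_natl mulrN mulrA [m%:R * _]mulrC divfK ?gt_eqF//.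
by [].
Qed.

Definition good_set (A : set 'rV[R]_n) := measurable A /\ good_multiplier (\1_A : 'rV[R]_n -> R).

(** Products make good sets a sigma-algebra at once: the indicator of a countable union is the limit
    of 1 - prod_(k < m) (1 - 1_(F k)), bounded by 1. *)
Lemma sigma_algebra_good_set : sigma_algebra [set: 'rV[R]_n] good_set.
Proof.
split.
- split => //; rewrite (_ : \1_set0 = cst 0); first exact: good_multiplier_cst.
  by apply/funext => x; rewrite indicE in_set0.
- move=> A [mA gA]; rewrite setTD; split; first exact: measurableC.
  rewrite (_ : \1_(~` A) = (fun x => 1 - \1_A x)); first exact: good_multiplier_onem.
  apply/funext => x; rewrite !indicE in_setC; case: (x \in A) => /=; ring.
- move=> F gF; split; first by apply: bigcupT_measurable => m; have [] := gF m.
  pose P m x : R := \prod_(k < m) (1 - \1_(F k) x).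
  have P01 m x : 0 <= P m x <= 1.
    rewrite prodr_ge0/=; last by move=> k _; rewrite subr_ge0 indicE; case: (_ \in _).
    rewrite prodr_ile1// => k _; rewrite indicE.
    by case: (_ \in _); rewrite ?subrr ?subr0 lexx ler01.
  apply: (@good_multiplier_cvg _ _ (fun m x => 1 - P m x) _ 1).
  + move=> m; apply: good_multiplier_onem; rewrite /P; elim: m => [|m IH].
      by under eq_fun do rewrite big_ord0; exact: good_multiplier_cst.
    under eq_fun do rewrite big_ord_recr/=.
    by apply: good_multiplierM => //; apply: good_multiplier_onem; have [] := gF m.
  + move=> m x; have /andP[P0 P1] := P01 m x.
    by rewrite ger0_norm ?subr_ge0// lerBlDr lerDl.
  + move=> x; rewrite indicE; have [|xF] := boolP (x \in \bigcup_k F k).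
      rewrite inE => -[k _ Fkx]; apply: cvg_near_cst; near=> m.
      have km : (k < m)%N by near: m; exact: nbhs_infty_gt.
      by rewrite /P (bigD1 (Ordinal km))//= indicE mem_set// subrr mul0r subr0.
    apply: cvg_near_cst; apply: nearW => m; rewrite /P big1 ?subrr// => k _.
    rewrite indicE memNset ?subr0// => Fkx; move/negP: xF; apply.
    by rewrite inE; exists k.
Unshelve. all: by end_near. Qed.

Lemma good_set_slab i (z r : R) : 0 < r ->
  good_set [set x | `|x ord0 i - z| <= r].
Proof.
move=> r0; have l2 : 0 < ln 2 :> R by rewrite ln_gt0// ltr1n.
(* With this rate the Gaussian takes the value 1/2, the place of the step of [threshold], exactly at
   distance r from z. *)
have c0 : 0 < ln 2 / r ^+ 2 by rewrite divr_gt0// exprn_gt0.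
split.
  rewrite -[X in measurable X]setTI; apply: measurable_fun_le => //.
  apply: measurableT_comp => //; apply: measurable_funB => //.
  exact: measurable_coord.
pose s x := expR (- (ln 2 / r ^+ 2 * (x ord0 i - z) ^+ 2)).
have s01 x : 0 < s x <= 1.
  by rewrite expR_gt0 expR_le1 oppr_le0 mulr_ge0 ?sqr_ge0// ltW.
apply: (@good_multiplier_cvg _ _ (fun m x => threshold m (s x)) _ 1).
- move=> m; apply: good_multiplier_onem; apply: good_multiplierX.
  apply: good_multiplier_onem; apply: good_multiplierX.
  exact: good_multiplier_gaussian.
- move=> m x; have /andP[s0 s1] := s01 x.
  have /andP[t0 t1] : 0 <= threshold m (s x) <= 1 by apply: threshold_itv; rewrite ltW.
  by rewrite ger0_norm.
- move=> x; have := cvg_threshold (s01 x).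
  have xE : (x \in [set x : 'rV[R]_n | `|x ord0 i - z| <= r]) = (2^-1 <= s x).
    rewrite /s -[2^-1]lnK ?posrE// ler_expR lnV ?posrE// lerN2 mulrAC ler_pdivrMr ?exprn_gt0//.
    rewrite ler_pM2l// -[_ ^+ 2]real_normK ?num_real// ler_sqr ?nnegrE ?(ltW r0)//.
    by apply/idP/idP; rewrite inE.
  by rewrite indicE xE; case: ifP.
Qed.

Lemma good_setT (A : set 'rV[R]_n) : measurable A -> good_set A.
Proof.
move=> mA; apply: (mA _ (conj sigma_algebra_good_set _)) => B.
rewrite -bigcup_seq/= => -[i _ [C mC <-]]; rewrite setTI.
have [gs0 gsD gsU] := sigma_algebra_good_set.
suff : forall C, (<<s @ocitv R >>) C -> good_set ((fun x : 'rV[R]_n => x ord0 i) @^-1` C).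
  by apply.
apply: smallest_sub => //.
  split => /=.
  - by rewrite preimage_set0.
  - by move=> D gD; rewrite setTD preimage_setC -setTD; exact: gsD.
  - by move=> F gF; rewrite preimage_bigcup; exact: gsU.
move=> _ [[u v] _ <-] /=.
have [vu|uv] := leP v u.
  rewrite set_itv_ge ?preimage_set0// bnd_simp -leNgt//.
(* The half-open interval is the union of the closed intervals from u + (v - u) / (m + 2) to v,
   written by center and radius; m + 2 keeps every radius positive. *)
rewrite [X in good_set X](_ : _ = \bigcup_m [set x : 'rV[R]_n | `|x ord0 i -
  (u + (v - u) / m.+2%:R + v) / 2| <= (v - (u + (v - u) / m.+2%:R)) / 2]); last first.
  apply/seteqP; split => x /=; rewrite in_itv/=.
    move=> /andP[ux xv].
    have [m Hm] : exists m : nat, (v - u) / m.+2%:R <= x ord0 i - u.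
      pose q := (v - u) / (x ord0 i - u).
      exists (Num.truncn q); rewrite ler_pdivrMr// mulrC -ler_pdivrMr ?subr_gt0//.
      by rewrite (le_trans (ltW (truncnS_gt _)))// ler_nat.
    exists m => //=; move: Hm; set dm := (v - u) / _ => Hm; rewrite ler_norml; apply/andP; split; lra.
  move=> [m _ /=]; have : 0 < (v - u) / m.+2%:R by rewrite divr_gt0// subr_gt0.
  set dm := (v - u) / _ => h3; rewrite ler_norml => /andP[h1 h2]; apply/andP; split; lra.
apply: gsU => m; apply: good_set_slab.
rewrite divr_gt0// opprD addrA subr_gt0 ltr_pdivrMr//.
by rewrite ltr_pMr ?subr_gt0// ltr1n.
Qed.

Lemma approximable_indic (A : set 'rV[R]_n) : measurable A -> approximable (\1_A : 'rV[R]_n -> R).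
Proof.
move=> /good_setT[_ [_ _ /(_ (fun=> 0%N))]].
rewrite (_ : (fun x => _) = \1_A)//; apply/funext => x.
by rewrite /herm /tensor_poly big1 ?mulr1// => k _; rewrite hornerE.
Qed.

Import HBNNSimple.

Lemma approximable_nnsfun (f : {nnsfun 'rV[R]_n >-> R}) : approximable f.
Proof.
rewrite (_ : (f : _ -> _) = (fun x =>
    \sum_(y <- finmap.enum_fset (fset_set (range f))) y * \1_(f @^-1` [set y]) x)).
  by apply: approximable_sum => y; apply: approximableZ; exact: approximable_indic.
by apply/funext => x; rewrite fimfunE fsbig_finite.
Qed.

Lemma approximable_ge0 f : sqint f -> (forall x, 0 <= f x) -> approximable f.
Proof.
move=> hf f0; have [mf _] := hf.
have mEf : measurable_fun setT (EFin \o f) by exact/measurable_EFinP.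
pose g := nnsfun_approx measurableT mEf.
have gf x : g m x @[m --> \oo] --> f x.
  have : EFin \o g^~ x @ \oo --> (f x)%:E.
    by apply: cvg_nnsfun_approx => // y _; rewrite lee_fin.
  by move/fine_cvgP => [].
have gf_le m x : g m x <= f x.
  rewrite -(cvg_lim _ (gf x))//; apply: (nondecreasing_cvgn_le (u_ := g^~ x)).
    by move=> a b ab; exact/lefP/nd_nnsfun_approx.
  by apply/cvg_ex; exists (f x).
apply: (@approximable_cvg _ _ g) => //; first by move=> m; exact: approximable_nnsfun.
apply: (dominated_cvgL2 (h := f)) => //.
move=> m x; rewrite distrC ger0_norm ?subr_ge0// ger0_norm//.
by rewrite lerBlDr lerDl.
Qed.

Theorem hermite_density : @hermite_dense R n.
Proof.
move=> f hf; have [mf _] := hf; suff [] : approximable f by [].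
have part (h : 'rV[R]_n -> R) : sqint h -> approximable (fun x => Num.max (h x) 0).
  move=> hh; have [mh _] := hh; apply: approximable_ge0.
    apply: (sq_integrable_le _ hh); first exact: measurable_maxr.
    move=> x; rewrite ger0_norm ?le_max ?lexx ?orbT//.
    by rewrite ge_max normr_ge0 ler_norm.
  by move=> x; rewrite le_max lexx orbT.
rewrite (_ : f = (fun x => Num.max (f x) 0) \+
    (fun x => -1 * Num.max ((fun x => -1 * f x) x) 0)).
  apply: approximableD; first exact: part.
  by apply: approximableZ; apply: (part (fun x => -1 * f x)); exact: sq_integrableZ.
apply/funext => x /=; have [fx|fx] := leP 0 (f x).
  by rewrite max_r ?mulr0 ?addr0// mulN1r oppr_le0.
by rewrite max_l ?mulN1r ?opprK ?add0r// oppr_ge0 ltW.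
Qed.

End hermite_density_theorem.

(** * Test functions *)

Section flat_functions.
Context {R : realType}.
Implicit Types (p q : {poly R}) (t : R).

(** p(1/t) exp (- 1/t) extended by 0: with a polynomial factor in 1/t the family is closed under
    differentiation, and all its members are infinitely flat at 0. *)
Definition flat p t : R := if 0 < t then p.[t^-1] * expR (- t^-1) else 0.

Lemma flat_le0 p t : t <= 0 -> flat p t = 0.
Proof. by move=> t0; rewrite /flat ltNge t0. Qed.

Lemma flat_bound p : exists C, 0 <= C /\ forall t, `|flat p t| <= C /\ `|flat p t| <= C * `|t|.
Proof.
(* The bound |p(u)| <= C exp (u / 2) for u >= 0 is the Gaussian growth of p(X^2) at the square root
   of u. *)
have [|C hC] := @gaussian_growth_poly _ (2^-1) (p \Po 'X^2).
  by rewrite invr_gt0.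
have C0 : 0 <= C.
  by have := hC 0; rewrite expr0n mulr0 expR0 mulr1; exact: le_trans.
exists (2 * C); split=> [|t]; first by rewrite mulr_ge0.
rewrite /flat; case: ifPn => [t0|_]; last by rewrite normr0 !mulr_ge0.
have u0 : 0 <= t^-1 by rewrite invr_ge0 ltW.
have H : `|p.[t^-1] * expR (- t^-1)| <= C * expR (- (2^-1 * t^-1)).
  rewrite normrM [`|expR _|]ger0_norm ?expR_ge0//.
  have := hC (Num.sqrt t^-1); rewrite horner_comp hornerXn sqr_sqrtr// => hp.
  rewrite (_ : - (2^-1 * t^-1) = 2^-1 * t^-1 + - t^-1); last by field; rewrite gt_eqF.
  by rewrite expRD mulrA ler_wpM2r ?expR_ge0.
split; apply: (le_trans H).
  rewrite mulrC ler_wpM2r//; apply: (@le_trans _ _ 1); last by rewrite ler1n.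
  by rewrite expR_le1 oppr_le0 mulr_ge0// invr_ge0.
rewrite [2 * C]mulrC -mulrA ler_wpM2l//.
rewrite expRN gtr0_norm// -(invrK (2 * t)) lef_pV2 ?posrE ?expR_gt0 ?invr_gt0 ?mulr_gt0//.
by rewrite invfM; apply: le_trans (expR_ge1Dx _); rewrite lerDr.
Qed.

(** At 0 the difference quotient of [flat p] is [flat ('X * p)], which [flat_bound] sends to 0. *)
Lemma is_derive_flat p t : is_derive t 1 (flat p) (flat ('X^2 * (p - p^`())) t).
Proof.
have [t0|t0|t0] := ltgtP t 0.
- rewrite [X in is_derive _ _ _ X]flat_le0 ?(ltW t0)//.
  apply: (@near_eq_is_derive _ _ _ (cst 0)).
  near=> s; rewrite flat_le0//; near: s; exact: lt_le_nbhsl.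
- have tn0 : t != 0 by rewrite gt_eqF.
  have dinv : is_derive t 1 (fun s : R => s^-1) (- (t ^- 2)).
    have := is_deriveV tn0 (is_derive_id t (1 : R)).
    by rewrite /GRing.scale/= mulr1.
  have d1 := is_derive1_comp (is_derive_poly p t^-1) dinv.
  have d2 := @is_derive1_comp _ expR (fun s => - s^-1) t _ _ (is_derive_expR _)
    (is_deriveN dinv).
  have d3 := is_deriveM d1 d2.
  apply: (near_eq_is_derive _ (is_derive_eq d3 _)).
  + near=> s; rewrite /flat ifT//; near: s; exact: lt_nbhsr.
  + rewrite /flat t0 /GRing.scale/= hornerM hornerXn hornerD hornerN opprK exprVn.
    by ring.
- rewrite t0 [X in is_derive _ _ _ X]flat_le0//.
  have H : h^-1 *: ((flat p \o shift 0) (h *: 1) - flat p 0) @[h --> (0 : R)^'] --> (0 : R).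
    have [C [C0 hC]] := flat_bound ('X * p).
    apply/cvgr0Pnorm_lt => e e0; near=> h.
    have Eh : h^-1 *: ((flat p \o shift 0) (h *: 1) - flat p 0) = flat ('X * p) h.
      rewrite /= addr0 [flat p 0]flat_le0// subr0 /GRing.scale/= mulr1 /flat.
      by case: ifP => _; rewrite ?mulr0// hornerM hornerX mulrA.
    rewrite Eh; apply: le_lt_trans (hC h).2 _.
    apply: (@le_lt_trans _ _ ((C + 1) * `|h|)); first by rewrite ler_wpM2r// lerDl.
    rewrite mulrC -ltr_pdivlMr ?ltr_wpDl//; near: h; apply: dnbhs0_lt.
    by rewrite divr_gt0// ltr_wpDl.
  apply: DeriveDef; first by apply/cvg_ex; exists 0.
  exact: cvg_lim H.
Unshelve. all: by end_near. Qed.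

Lemma cvg_flat p (s : nat -> R) : s m @[m --> \oo] --> +oo ->
  flat p (s m) @[m --> \oo] --> p.[0].
Proof.
move=> soo.
have sinv : (s m)^-1 @[m --> \oo] --> (0 : R).
  by apply/gtr0_cvgV0 => //; exact: (cvgryPgt _).1 soo 0.
have H : p.[(s m)^-1] * expR (- (s m)^-1) @[m --> \oo] --> p.[0].
  rewrite [X in _ --> X](_ : _ = p.[0] * expR (- 0)); last first.
    by rewrite oppr0 expR0 mulr1.
  apply: cvgM.
    by apply: continuous_cvg sinv; exact: continuous_horner.
  apply: continuous_cvg; first exact: continuous_expR.
  exact: cvgN.
apply: cvg_trans H; apply: near_eq_cvg; near=> m.
rewrite /flat ifT//; near: m; exact: (cvgryPgt _).1 soo 0.
Unshelve. all: by end_near. Qed.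

Lemma flat1_itv t : 0 <= flat 1 t <= 1.
Proof.
rewrite /flat; case: ifPn => [t0|_]; last by rewrite lexx ler01.
by rewrite hornerE mul1r expR_ge0 expR_le1 oppr_le0 invr_ge0 ltW.
Qed.

(* Closed under differentiation, hence made of smooth functions, and large
   enough to contain all the test functions needed. *)
Inductive elementary : (R -> R) -> Prop :=
| elementary_poly p : elementary (horner p)
| elementary_gauss : elementary (normal_pdf 0 1)
| elementary_flat p c a : elementary (fun t => flat p (c * t + a))
| elementary_add f g : elementary f -> elementary g -> elementary (fun t => f t + g t)
| elementary_mul f g : elementary f -> elementary g -> elementary (fun t => f t * g t).

Lemma is_derive_flat_affine p c a t : is_derive t 1 (fun t => flat p (c * t + a))
  (c * flat ('X^2 * (p - p^`())) (c * t + a)).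
Proof.
pose q : {poly R} := c *: 'X + a%:P.
have qE s : q.[s] = c * s + a by rewrite hornerD hornerZ hornerX hornerC.
have := is_derive1_comp (is_derive_flat p q.[t]) (is_derive_poly q t).
rewrite (_ : flat p \o horner q = (fun t => flat p (c * t + a))); last first.
  by apply/funext => s /=; rewrite qE.
by rewrite qE derivD derivZ derivX derivC addr0 alg_polyC hornerC mulrC.
Qed.

Lemma elementary_derive f : elementary f ->
  exists2 g, elementary g & forall t, is_derive t 1 f (g t).
Proof.
elim=> [p||p c a|{}f g _ [f' ef df] _ [g' eg dg]|{}f g ef [f' ef' df] eg [g' eg' dg]].
- exists (horner p^`()); first exact: elementary_poly.
  exact: is_derive_poly.
- exists (fun t => (- 'X).[t] * normal_pdf 0 1 t).
    by apply: elementary_mul; [exact: elementary_poly|exact: elementary_gauss].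
  move=> t; rewrite hornerN hornerX; exact: is_derive_normal_pdf.
- exists (fun t => (c%:P).[t] * flat ('X^2 * (p - p^`())) (c * t + a)).
    by apply: elementary_mul; [exact: elementary_poly|exact: elementary_flat].
  by move=> t; rewrite hornerC; exact: is_derive_flat_affine.
- exists (fun t => f' t + g' t); first exact: elementary_add.
  by move=> t; exact: (is_deriveD (df t) (dg t)).
- exists (fun t => f t * g' t + g t * f' t).
    by apply: elementary_add; exact: elementary_mul.
  by move=> t; exact: (is_deriveM (df t) (dg t)).
Qed.

Lemma elementary_continuous f : elementary f -> continuous f.
Proof.
move=> /elementary_derive[g _ df] t.
by apply/differentiable_continuous/derivable1_diffP; have [] := df t.
Qed.

Lemma measurable_elementary f : elementary f -> measurable_fun setT f.
Proof. by move=> ef; apply: continuous_measurable_fun; exact: elementary_continuous. Qed.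

End flat_functions.

Section tensor_test_functions.
Context {R : realType} {n : nat}.
Implicit Types (f : 'I_n -> R -> R) (x : 'rV[R]_n) (i k : 'I_n).

Definition tensor f x : R := \prod_k f k (x ord0 k).

Lemma measurable_tensor f : (forall k, measurable_fun setT (f k)) ->
  measurable_fun setT (tensor f).
Proof.
move=> mf; apply: measurable_prod => k _; apply: measurableT_comp => //.
exact: measurable_coord.
Qed.

Lemma differentiable_tensor f x : (forall k t, derivable (f k) t 1) ->
  differentiable (tensor f) x.
Proof.
move=> df; rewrite /tensor; elim: (index_enum _) => [|k s IH].
  by under eq_fun do rewrite big_nil; exact: differentiable_cst.
under eq_fun do rewrite big_cons.
apply: (@differentiableM _ _ (fun y : 'rV[R]_n => f k (y ord0 k))) => //.
apply: (@differentiable_comp _ _ _ _ (fun y : 'rV[R]_n => y ord0 k)).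
  exact: differentiable_coord.
exact/derivable1_diffP.
Qed.

Lemma partial_tensor f i (g : R -> R) : (forall t : R, is_derive t 1 (f i) (g t)) ->
  partial i (tensor f) = tensor (fun k => if k == i then g else f k).
Proof.
move=> df; apply/funext => x.
pose C := \prod_(k | k != i) f k (x ord0 k).
have -> : tensor (fun k => if k == i then g else f k) x = 'D_1 (C \*: f i) (x ord0 i).
  have [_ ->] := is_deriveZ C (df (x ord0 i)).
  rewrite /tensor (bigD1 i)//= eqxx mulrC; congr (_ * _).
  by apply: eq_bigr => k /negbTE ->.
have E (y : 'rV[R]_n) : (forall k, k != i -> y ord0 k = x ord0 k) -> tensor f y = C * f i (y ord0 i).
  move=> yx; rewrite /tensor (bigD1 i)//= mulrC; congr (_ * _).
  by apply: eq_bigr => k ki; rewrite yx.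
rewrite /partial /derive.
have -> : (fun h : R => h^-1 *: ((tensor f \o shift x) (h *: delta_mx ord0 i) - tensor f x)) =
    (fun h => h^-1 *: ((C \*: f i \o shift (x ord0 i)) (h *: 1) - (C \*: f i) (x ord0 i))).
  apply/funext => h; rewrite /= !E//; last first.
    by move=> k ki; rewrite !mxE eqxx (negbTE ki) mulr0 add0r.
  by rewrite !mxE !eqxx.
by [].
Qed.

Lemma smooth_tensor f : (forall k, elementary (f k)) -> smooth (tensor f).
Proof.
have dif g : (forall k, elementary (g k)) -> forall x, differentiable (tensor g) x.
  move=> eg x; apply: differentiable_tensor => k t.
  by have [h _ dh] := elementary_derive (eg k); have [] := dh t.
move=> ef s; suff [g eg ->] : exists2 g, (forall k, elementary (g k)) &
    foldr partial (tensor f) s = tensor g by exact: dif.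
elim: s => [|i s [g eg IH]] /=; first by exists f.
have [h eh dh] := elementary_derive (eg i).
exists (fun k => if k == i then h else g k); last by rewrite IH; exact: partial_tensor.
by move=> k; case: ifP.
Qed.

Lemma compact_box (a b : 'I_n -> R) :
  compact [set x : 'rV[R]_n | forall k, `[a k, b k]%classic (x ord0 k)].
Proof.
exact: (@rV_compact R n (fun k => `[a k, b k]%classic)
  (fun k => @segment_compact R (a k) (b k))).
Qed.

Lemma test_function_tensor f (a b : 'I_n -> R) : (forall k, elementary (f k)) ->
  (forall k t, t \notin `[a k, b k] -> f k t = 0) -> test_function (tensor f).
Proof.
move=> ef f0; split; first exact: smooth_tensor.
apply: (subclosed_compact _ (@compact_box a b)); first exact: closed_closure.
have cB := compact_closed (@norm_hausdorff _ _) (@compact_box a b).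
rewrite [X in _ `<=` X](closure_id _).1//; apply: closure_subset.
move=> x /= fx k; apply: contraT => /f0 fk; move: fx.
by rewrite /tensor (bigD1 k)//= fk mul0r eqxx.
Qed.

End tensor_test_functions.

Lemma cvg_finite_prod (R : realType) (I : Type) (s : seq I) (F : nat -> I -> R) (l : I -> R) :
  (forall i, F m i @[m --> \oo] --> l i) ->
  \prod_(i <- s) F m i @[m --> \oo] --> \prod_(i <- s) l i.
Proof.
move=> Fl; elim: s => [|i s IH].
  by rewrite big_nil; under eq_fun do rewrite big_nil; exact: cvg_cst.
by rewrite big_cons; under eq_fun do rewrite big_cons; exact: cvgM.
Qed.

(** * Smooth approximations of half-open intervals *)

Section smooth_bump.
Context {R : realType}.
Implicit Types (a b t : R).

(* The second factor vanishes from [b + 1/(m+1)] on but, thanks to its slope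
   [(m+1)^2], equals [flat 1 (m+1)] at [b]: the limit is 0 at [a] and 1 at [b]. *)
Definition smooth_bump m a b t : R :=
  flat 1 (m.+1%:R * t + - (m.+1%:R * a)) *
  flat 1 (- m.+1%:R ^+ 2 * t + (m.+1%:R ^+ 2 * b + m.+1%:R)).

Lemma elementary_bump m a b : elementary (smooth_bump m a b).
Proof. by apply: elementary_mul; exact: elementary_flat. Qed.

Lemma bump_itv m a b t : 0 <= smooth_bump m a b t <= 1.
Proof.
have /andP[h1 h2] := flat1_itv (m.+1%:R * t + - (m.+1%:R * a)).
have /andP[h3 h4] := flat1_itv (- m.+1%:R ^+ 2 * t + (m.+1%:R ^+ 2 * b + m.+1%:R)).
by rewrite mulr_ge0//= mulr_ile1.
Qed.

Lemma bump_eq0 m a b t : t \notin `[a, b + 1] -> smooth_bump m a b t = 0.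
Proof.
have c0 : 0 < m.+1%:R :> R by [].
rewrite in_itv/= negb_and -!ltNge => /orP[ta|bt]; rewrite /smooth_bump.
  by rewrite flat_le0 ?mul0r// subr_le0 ler_pM2l// ltW.
rewrite [X in _ * X]flat_le0 ?mulr0// (_ : _ + _ = m.+1%:R * (1 - m.+1%:R * (t - b))); last by ring.
rewrite pmulr_rle0// subr_le0.
have : 1 <= m.+1%:R :> R by rewrite ler1n.
have : 1 <= t - b by lra.
nra.
Qed.

Lemma bump_shift m a b c t : smooth_bump m a b (t - c) = smooth_bump m (a + c) (b + c) t.
Proof. by rewrite /smooth_bump; congr (flat _ _ * flat _ _); ring. Qed.

Lemma cvg_bump a b t : smooth_bump m a b t @[m --> \oo] --> (\1_(`]a, b]) t : R).
Proof.
rewrite indicE; have cy : (m.+1%:R : R) @[m --> \oo] --> +oo.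
  by rewrite (@cvg_shiftS _ (fun m => m%:R : R)); exact: cvgr_idn.
have [ta|at_] := leP t a.
  rewrite memNset/=; last by rewrite in_itv/= ltNge ta.
  apply: cvg_near_cst; apply: nearW => m.
  by rewrite /smooth_bump flat_le0 ?mul0r// subr_le0 ler_pM2l.
have [tb|bt] := leP t b; last first.
  rewrite memNset/=; last by rewrite in_itv/= leNgt bt andbF.
  apply: cvg_near_cst; near=> m.
  rewrite /smooth_bump [X in _ * X]flat_le0 ?mulr0//.
  rewrite (_ : _ + _ = m.+1%:R * (1 - m.+1%:R * (t - b))); last by ring.
  rewrite pmulr_rle0// subr_le0 -ler_pdivrMr ?subr_gt0//.
  near: m; exact: (cvgryPge _).1 cy _.
rewrite mem_set/=; last by rewrite in_itv/= at_.
rewrite [X in _ --> X](_ : _ = (1 : {poly R}).[0] * (1 : {poly R}).[0]); last first.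
  by rewrite !hornerE ?mulr1.
apply: cvgM; apply: cvg_flat.
  rewrite (_ : (fun m => _) = (fun m => m.+1%:R * (t - a))); last first.
    by apply/funext => m; rewrite mulrBr.
  have ta : 0 < t - a by rewrite subr_gt0.
  exact: (cvg_comp _ _ cy (gt0_cvgMly (f := id) ta cvg_id)).
apply: (ger_cvgy _ cy); near=> m.
rewrite [leRHS](_ : _ = m.+1%:R ^+ 2 * (b - t) + m.+1%:R); last by ring.
by rewrite lerDr mulr_ge0 ?exprn_ge0// subr_ge0.
Unshelve. all: by end_near. Qed.

End smooth_bump.

(** * The fundamental lemma of the calculus of variations, tested on bumps *)

Section boxes.
Context {R : realType} {n : nat}.
Implicit Types (a b : 'I_n -> R) (x : 'rV[R]_n) (A : set 'rV[R]_n) (d : 'rV[R]_n -> R).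
Local Notation leb := (@lebesgue_rV R n).

Definition box a b := [set x : 'rV[R]_n | forall k, `]a k, b k]%classic (x ord0 k)].
Definition closed_box a b := [set x : 'rV[R]_n | forall k, `[a k, b k]%classic (x ord0 k)].

Lemma measurable_cylinders (C : 'I_n -> set R) : (forall k, measurable (C k)) ->
  measurable [set x : 'rV[R]_n | forall k, C k (x ord0 k)].
Proof.
move=> mC; rewrite (_ : [set _ | _] = \big[setI/setT]_(k < n) ((fun x : 'rV[R]_n => x ord0 k) @^-1` C k)).
  apply: bigsetI_measurable => k _; rewrite -[X in measurable X]setTI.
  exact: measurable_coord.
apply/seteqP; split => x /=; rewrite -bigcap_seq/=.
  by move=> H k _; exact: H.
by move=> H k; apply: H; rewrite /= mem_index_enum.
Qed.

Lemma measurable_box a b : measurable (box a b).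
Proof.
apply: (@measurable_cylinders (fun k => `]a k, b k]%classic)) => k.
exact: measurable_itv.
Qed.

Lemma measurable_closed_box a b : measurable (closed_box a b).
Proof.
apply: (@measurable_cylinders (fun k => `[a k, b k]%classic)) => k.
exact: measurable_itv.
Qed.

Lemma setI_box a b a' b' : box a b `&` box a' b' =
  box (fun k => Num.max (a k) (a' k)) (fun k => Num.min (b k) (b' k)).
Proof.
apply/seteqP; split => x /=.
  move=> [H1 H2] k; move: (H1 k) (H2 k); rewrite /= !in_itv/=.
  by move=> /andP[? ?] /andP[? ?]; rewrite gt_max le_min; apply/andP; split; apply/andP.
move=> H; split => k; move: (H k); rewrite /= !in_itv/= gt_max le_min.
  by move=> /andP[/andP[-> _] /andP[-> _]].
by move=> /andP[/andP[_ ->] /andP[_ ->]].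
Qed.

(** Local integrability in the form in which it dominates: a tensor of bumps is at most the
    indicator of a closed box, by [tensor_bump_le]. *)
Definition box_integrable d := measurable_fun setT d /\ forall a b,
  leb.-integrable setT (fun x => (d x * \1_(closed_box a b) x)%:E).

Lemma tensor_bump_le m a b x :
  `|tensor (fun k => smooth_bump m (a k) (b k)) x| <= \1_(closed_box a (fun k => b k + 1)) x.
Proof.
rewrite ger0_norm; last by apply: prodr_ge0 => k _; case/andP: (bump_itv m (a k) (b k) (x ord0 k)).
rewrite indicE; case: (boolP (x \in _)) => [_|].
  by apply: prodr_ile1 => k _; exact: bump_itv.
rewrite notin_setE => /existsNP[k] /negP xk.
by rewrite /tensor (bigD1 k)//= bump_eq0// mul0r.
Qed.

Lemma cvg_tensor_bump a b x :
  tensor (fun k => smooth_bump m (a k) (b k)) x @[m --> \oo] --> (\1_(box a b) x : R).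
Proof.
rewrite (_ : \1_(box a b) x = \prod_k \1_(`]a k, b k]) (x ord0 k)).
  by apply: cvg_finite_prod => k; exact: cvg_bump.
rewrite indicE; case: (boolP (x \in _)) => [|].
  by rewrite inE => H; rewrite big1// => k _; rewrite indicE mem_set//; exact: H.
rewrite notin_setE => /existsNP[k] /negP xk.
rewrite (bigD1 k)//= indicE memNset ?mul0r//; exact/negP.
Qed.

Lemma measurable_tensor_bump m a b :
  measurable_fun setT (tensor (fun k => smooth_bump m (a k) (b k)) : 'rV[R]_n -> R).
Proof. by apply: measurable_tensor => k; apply: measurable_elementary; exact: elementary_bump. Qed.

Lemma integrable_bump d m a b : box_integrable d ->
  leb.-integrable setT (fun x => (d x * tensor (fun k => smooth_bump m (a k) (b k)) x)%:E).
Proof.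
move=> [md dI]; apply: le_integrable (dI a (fun k => b k + 1)) => //.
  by apply/measurable_EFinP/measurable_funM => //; exact: measurable_tensor_bump.
move=> x _; rewrite !abse_EFin lee_fin !normrM ler_wpM2l//.
by rewrite (le_trans (tensor_bump_le _ _ _ _))// ler_norm.
Qed.

Lemma integral_box_eq0 d : box_integrable d ->
  (forall m a b, (\int[leb]_x (d x * tensor (fun k => smooth_bump m (a k) (b k)) x)%:E = 0)%E) ->
  forall a b, (\int[leb]_x (d x * \1_(box a b) x)%:E = 0)%E.
Proof.
move=> dI d0 a b; have [md dB] := dI.
have [|||||_ _ H] := @dominated_convergence _ _ _ leb setT measurableT
  (fun m x => (d x * tensor (fun k => smooth_bump m (a k) (b k)) x)%:E)
  (fun x => (d x * \1_(box a b) x)%:E)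
  (fun x => `|(d x * \1_(closed_box a (fun k => b k + 1)) x)%:E|%E).
- move=> m; apply/measurable_EFinP/measurable_funM => //; exact: measurable_tensor_bump.
- by apply/measurable_EFinP/measurable_funM => //; apply: measurable_indic; exact: measurable_box.
- apply: aeW => x _; apply/cvg_EFin; first exact: nearW.
  by apply: cvgMr; exact: cvg_tensor_bump.
- exact: integrable_abse.
- apply: aeW => x m _; rewrite !abse_EFin lee_fin !normrM ler_wpM2l//.
  by rewrite (le_trans (tensor_bump_le _ _ _ _))// ler_norm.
apply: (cvg_unique (@ereal_hausdorff R) H).
by apply: cvg_near_cst; apply: nearW => m; exact: d0.
Qed.

Let boxes := [set A | exists a b, A = box a b].

Lemma sub_sigma_boxes A : measurable A -> <<s boxes>> A.
Proof.
move=> mA.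
have [s0 sC sU] : sigma_algebra setT <<s boxes>> by exact: smallest_sigma_algebra.
apply: (mA _ (conj _ _)) => //= B.
rewrite -bigcup_seq/= => -[i _ [C mC <-]]; rewrite setTI.
suff : forall C, (<<s @ocitv R >>) C -> <<s boxes>> ((fun x : 'rV[R]_n => x ord0 i) @^-1` C).
  by apply.
apply: smallest_sub => //.
  split => /=.
  - by rewrite preimage_set0.
  - by move=> D gD; rewrite setTD preimage_setC -setTD; exact: sC.
  - by move=> F gF; rewrite preimage_bigcup; exact: sU.
move=> _ [[u v] _ <-] /=.
pose a (m : nat) k := if k == i then u else - m%:R : R.
pose b (m : nat) k := if k == i then v else m%:R : R.
rewrite (_ : _ @^-1` _ = \bigcup_m box (a m) (b m)).
  by apply: sU => m; apply: sub_sigma_algebra; exists (a m), (b m).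
apply/seteqP; split => x /=.
  move=> xi; have [m Hm] : exists m : nat, forall k, `|x ord0 k| < m%:R.
    exists (\max_k (Num.truncn `|x ord0 k|).+1)%N => k.
    apply: (lt_le_trans (truncnS_gt _)); rewrite ler_nat.
    exact: (leq_bigmax (F := fun k => (Num.truncn `|x ord0 k|).+1)).
  exists m => // k; rewrite /= /a /b; case: eqP => [->//|_].
  by have := Hm k; rewrite ltr_norml in_itv/= => /andP[-> /ltW].
by move=> [m _ /(_ i)]; rewrite /= /a /b eqxx.
Qed.

(** Bumps tend to indicators of boxes, and boxes are stable under intersection and generate. As [d]
    is only locally integrable, the lambda-system argument is run on its restriction [e M] to a
    cube, whose integral over any measurable set makes sense. *)
Lemma integral_bump_eq0_ae d : box_integrable d ->
  (forall m a b, (\int[leb]_x (d x * tensor (fun k => smooth_bump m (a k) (b k)) x)%:E = 0)%E) ->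
  {ae leb, forall x, d x = 0}.
Proof.
move=> dI d0; have [md dB] := dI.
pose K (M : nat) := box (fun=> - M%:R) (fun=> M%:R).
pose e M x := d x * \1_(K M) x.
have mK M : measurable (K M) by exact: measurable_box.
have me M : measurable_fun setT (e M) by apply: measurable_funM => //; exact: measurable_indic.
have ei M : leb.-integrable setT (EFin \o e M).
  apply: le_integrable (dB (fun=> - M%:R) (fun=> M%:R)) => //; first exact/measurable_EFinP.
  move=> x _; rewrite !abse_EFin lee_fin !normrM ler_wpM2l// !indicE.
  case: (boolP (x \in K M)); last by rewrite normr0.
  rewrite inE => xK; rewrite mem_set// => k; have := xK k; rewrite /= !in_itv/=.
  by move=> /andP[/ltW -> ->].
have eiA M A : measurable A -> leb.-integrable setT (fun x => (e M x * \1_A x)%:E).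
  move=> mA; apply: le_integrable (ei M) => //.
    by apply/measurable_EFinP/measurable_funM => //; exact: measurable_indic.
  move=> x _; rewrite !abse_EFin lee_fin normrM ler_piMr// indicE.
  by case: (_ \in _); rewrite ?normr1 ?normr0.
have e0 M : ae_eq leb setT (EFin \o e M) (cst 0%E).
  pose H := [set A | measurable A /\ (\int[leb]_x (e M x * \1_A x)%:E = 0)%E].
  have HA A : measurable A -> H A.
    move=> /sub_sigma_boxes; apply: lambda_system_subset => //.
    - by move=> _ _ [a [b ->]] [a' [b' ->]]; rewrite setI_box; eexists; eexists.
    - split => //.
      + split => //; under eq_integral do rewrite indicT mulr1.
        exact: integral_box_eq0.
      + move=> B C CB [mB B0] [mC C0]; split; first exact: measurableD.
        rewrite (eq_integral (fun x => (e M x * \1_B x)%:E - (e M x * \1_C x)%:E)%E).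
          by rewrite integralB//= ?B0 ?C0 ?sube0//; exact: eiA.
        move=> x _; rewrite -EFinB -mulrBr; congr (_ * _)%:E.
        rewrite !indicE in_setD; case: (boolP (x \in C)) => [|_] /=; last by rewrite andbT subr0.
        by rewrite inE => /CB xB; rewrite andbF mem_set// subrr.
      + move=> F ndF HF; have mF m : measurable (F m) by have [] := HF m.
        split; first exact: bigcupT_measurable.
        have [|||||_ _ L] := @dominated_convergence _ _ _ leb setT measurableT
          (fun m x => (e M x * \1_(F m) x)%:E) (fun x => (e M x * \1_(\bigcup_m F m) x)%:E)
          (fun x => `|(e M x)%:E|%E).
        * by move=> m; have /measurable_int := eiA M _ (mF m).
        * by have /measurable_int := eiA M _ (bigcupT_measurable _ mF).
        * apply: aeW => x _; have [|xF] := boolP (x \in \bigcup_m F m).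
            rewrite inE => -[m _ Fmx]; apply: cvg_near_cst; near=> p.
            have mp : (m <= p)%N by near: p; exact: nbhs_infty_ge.
            rewrite !indicE !mem_set//; first by exists m.
            by move: Fmx; exact/subsetPset/ndF.
          apply: cvg_near_cst; apply: nearW => p; rewrite !indicE (negbTE xF) memNset// => Fpx.
          by move/negP: xF; apply; rewrite inE; exists p.
        * exact: (integrable_abse (ei M)).
        * apply: aeW => x m _; rewrite !abse_EFin lee_fin normrM ler_piMr// indicE.
          by case: (_ \in _); rewrite ?normr1 ?normr0.
        apply: (cvg_unique (@ereal_hausdorff R) L).
        apply: cvg_near_cst; apply: nearW => m; exact: (HF m).2.
    - move=> _ [a [b ->]]; split; first exact: measurable_box.
      rewrite -(integral_box_eq0 dI d0 (fun k => Num.max (- M%:R) (a k)) (fun k => Num.min M%:R (b k))).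
      apply: eq_integral => x _; rewrite -setI_box /e -mulrA; congr (_ * _)%:E.
      by rewrite indicI.
  apply: integral_ae_eq => // E _ mE; rewrite integral_cst// mul0e.
  rewrite integral_mkcond -[RHS](HA E mE).2; apply: eq_integral => x _.
  by rewrite patchE indicE; case: ifPn => _; rewrite ?mulr1 ?mulr0.
have : {ae leb, forall x M, e M x = 0}.
  apply/ae_foralln => M; have := e0 M; apply: filterS => x /(_ I)/= [].
  by [].
apply: filterS => x ex0.
have [m Hm] : exists m : nat, forall k, `|x ord0 k| < m%:R.
  exists (\max_k (Num.truncn `|x ord0 k|).+1)%N => k.
  apply: (lt_le_trans (truncnS_gt _)); rewrite ler_nat.
  exact: (leq_bigmax (F := fun k => (Num.truncn `|x ord0 k|).+1)).
have := ex0 m; rewrite /e indicE mem_set ?mulr1// => k /=.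
by have := Hm k; rewrite ltr_norml in_itv/= => /andP[-> /ltW].
Unshelve. all: by end_near. Qed.

End boxes.

(** * Smooth cutoffs exhausting the line *)

Section cutoff.
Context {R : realType}.
Implicit Types t : R.

(** Both ends are translates of one fixed profile, so the derivative is bounded uniformly in m and
    tends to 0 pointwise, while the cutoff tends to 1. *)
Definition cutoff m t : R := flat 1 (1 * t + m%:R) * flat 1 (-1 * t + m%:R).

Let q : {poly R} := 'X^2 * (1 - 1^`()).

Definition dcutoff m t : R :=
  flat 1 (1 * t + m%:R) * (-1 * flat q (-1 * t + m%:R)) +
  flat 1 (-1 * t + m%:R) * (1 * flat q (1 * t + m%:R)).

Lemma elementary_cutoff m : elementary (cutoff m).
Proof. by apply: elementary_mul; exact: elementary_flat. Qed.

Lemma is_derive_cutoff m t : is_derive t 1 (cutoff m) (dcutoff m t).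
Proof.
exact: (is_deriveM (is_derive_flat_affine 1 1 m%:R t) (is_derive_flat_affine 1 (-1) m%:R t)).
Qed.

Lemma cutoff_itv m t : 0 <= cutoff m t <= 1.
Proof.
have /andP[h1 h2] := flat1_itv (1 * t + m%:R).
have /andP[h3 h4] := flat1_itv (-1 * t + m%:R).
by rewrite mulr_ge0//= mulr_ile1.
Qed.

Lemma cutoff_eq0 m t : t \notin `[- m%:R, m%:R] -> cutoff m t = 0.
Proof.
rewrite in_itv/= negb_and -!ltNge => /orP[H|H]; rewrite /cutoff.
  by rewrite flat_le0 ?mul0r//; lra.
by rewrite [X in _ * X]flat_le0 ?mulr0//; lra.
Qed.

Lemma dcutoff_bound : exists C, forall m t, `|dcutoff m t| <= C.
Proof.
have [C [C0 hC]] := flat_bound q; exists (C + C) => m t.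
have f1 s : `|flat 1 s| <= 1 :> R.
  by have /andP[h1 h2] := flat1_itv s; rewrite ger0_norm.
apply: (le_trans (ler_normD _ _)); apply: lerD.
  by rewrite -[leRHS]mul1r normrM ler_pM// mulN1r normrN; exact: (hC _).1.
by rewrite -[leRHS]mul1r normrM ler_pM// mul1r; exact: (hC _).1.
Qed.

Let cvgyD t : t + m%:R @[m --> \oo] --> +oo.
Proof.
apply/cvgryPge => A; near=> m; rewrite -lerBlDl.
by near: m; exact: nbhs_infty_ger.
Unshelve. all: by end_near. Qed.

Lemma cvg_cutoff t : cutoff m t @[m --> \oo] --> (1 : R).
Proof.
rewrite [X in _ --> X](_ : _ = (1 : {poly R}).[0] * (1 : {poly R}).[0]); last first.
  by rewrite !hornerE ?mulr1.
by apply: cvgM; apply: cvg_flat; exact: cvgyD.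
Qed.

Lemma cvg_dcutoff t : dcutoff m t @[m --> \oo] --> (0 : R).
Proof.
have q0 : q.[0] = 0 by rewrite /q hornerM hornerXn expr0n mul0r.
rewrite [X in _ --> X](_ : _ = (1 : {poly R}).[0] * (-1 * q.[0]) +
  (1 : {poly R}).[0] * (1 * q.[0])); last by rewrite q0 !mulr0 addr0.
by apply: cvgD; (apply: cvgM; [|apply: cvgMr]); apply: cvg_flat; exact: cvgyD.
Qed.

End cutoff.

(** * Weak gradients *)

Section weak_gradient_gaussian.
Context {R : realType} {n : nat}.
Local Notation gamma := (@std_gaussian R n).
Local Notation leb := (@lebesgue_rV R n).
Local Notation sqint := (sq_integrable gamma).
Local Notation w := (normal_pdf (0 : R) 1).
Local Notation "<< f , g >>" := (dot gamma f g) (at level 0, format "<< f ,  g >>") : ring_scope.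
Implicit Types (a : 'I_n -> nat) (i k : 'I_n) (x : 'rV[R]_n).

(* The Hermite function [herm a * density], truncated to [-m, m] in each
   coordinate, is an admissible test function. *)
Let phi m a k : R -> R := fun t => ((hermite (a k)).[t] * w t) * cutoff m t.

Let dphi m a k : R -> R := fun t =>
  w t * (- (hermite (a k).+1).[t] * cutoff m t + (hermite (a k)).[t] * dcutoff m t).

Let is_derive_phi m a k (t : R) : is_derive t 1 (phi m a k) (dphi m a k t).
Proof.
have H := is_deriveM (is_deriveM (is_derive_poly (hermite (a k)) t) (is_derive_normal_pdf t))
  (is_derive_cutoff m t).
apply: (is_derive_eq H).
rewrite /dphi hermiteS hornerD hornerN hornerM hornerX !fctE /GRing.scale/=.
ring.
Qed.

Let X m x : R := \prod_k cutoff m (x ord0 k).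
Let Y m i x : R := dcutoff m (x ord0 i) * \prod_(k | k != i) cutoff m (x ord0 k).

Let tensor_phiE m a x : tensor (phi m a) x = herm a x * X m x * gaussian_density x.
Proof.
by rewrite /tensor /phi big_split/= big_split/= /herm /tensor_poly /X /gaussian_density mulrAC.
Qed.

Let partial_phiE m a i x : partial i (tensor (phi m a)) x =
  (-1 * herm (raise i a) x * X m x + herm a x * Y m i x) * gaussian_density x.
Proof.
rewrite (partial_tensor (is_derive_phi m a i)).
rewrite /tensor /herm /tensor_poly /X /Y /gaussian_density !(bigD1 i (P := predT))//= eqxx /raise eqxx addn1.
rewrite (eq_bigr (fun k => (hermite (a k)).[x ord0 k] * w (x ord0 k) * cutoff m (x ord0 k))
  (P := fun k => k != i)); last by move=> k /negbTE ->.
rewrite !big_split/= /dphi.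
rewrite (eq_bigr (fun k => (hermite (a k)).[x ord0 k]) (P := fun k => k != i)
  (F1 := fun k => (hermite (a k + (k == i))%N).[x ord0 k])); last first.
  by move=> k /negbTE ->; rewrite addn0.
ring.
Qed.

Let test_phi m a : test_function (tensor (phi m a)).
Proof.
apply: (test_function_tensor (a := fun=> - m%:R) (b := fun=> m%:R)).
  move=> k; apply: elementary_mul; last exact: elementary_cutoff.
  by apply: elementary_mul; [exact: elementary_poly|exact: elementary_gauss].
by move=> k t /cutoff_eq0; rewrite /phi => ->; rewrite mulr0.
Qed.

Let X_itv m x : `|X m x| <= 1.
Proof.
rewrite ger0_norm; last by apply: prodr_ge0 => k _; case/andP: (cutoff_itv m (x ord0 k)).
by apply: prodr_ile1 => k _; exact: cutoff_itv.
Qed.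

Let Y_le C m i x : (forall m t, `|dcutoff m t| <= C) -> `|Y m i x| <= C.
Proof.
move=> hC; rewrite /Y normrM -[leRHS]mulr1 ler_pM//.
rewrite ger0_norm; last by apply: prodr_ge0 => k _; case/andP: (cutoff_itv m (x ord0 k)).
by apply: prodr_ile1 => k _; exact: cutoff_itv.
Qed.

Let measurable_cutoff m k : measurable_fun setT (fun x : 'rV[R]_n => cutoff m (x ord0 k)).
Proof.
apply: measurableT_comp (measurable_coord k).
exact: (measurable_elementary (elementary_cutoff m)).
Qed.

Let measurable_X m : measurable_fun setT (X m).
Proof. by apply: measurable_prod. Qed.

Let measurable_Y m i : measurable_fun setT (Y m i).
Proof.
apply: measurable_funM.
  apply: measurableT_comp (measurable_coord i).
  have [g eg dg] := elementary_derive (elementary_cutoff (R := R) m).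
  rewrite (_ : dcutoff m = g); first exact: measurable_elementary.
  apply/funext => t; have [_ <-] := is_derive_cutoff m t.
  by have [_ ->] := dg t.
rewrite (_ : (fun x => _) = (fun x : 'rV[R]_n => \prod_k (if k != i then cutoff m (x ord0 k) else 1))).
  by apply: measurable_prod => k _; case: (k != i) => //; exact: measurable_cutoff.
by apply/funext => x; rewrite big_mkcond.
Qed.

Let cvg_X x : X m x @[m --> \oo] --> (1 : R).
Proof.
rewrite [Z in _ --> Z](_ : _ = \prod_(k < n) 1); last by rewrite big1.
by apply: cvg_finite_prod => k; exact: cvg_cutoff.
Qed.

Let cvg_Y i x : Y m i x @[m --> \oo] --> (0 : R).
Proof.
rewrite [Z in _ --> Z](_ : _ = 0 * \prod_(k < n) (if k != i then 1 else 1)); last by rewrite mul0r.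
apply: cvgM; first exact: cvg_dcutoff.
rewrite (_ : (fun m => _) = (fun m => \prod_k (if k != i then cutoff m (x ord0 k) else 1))).
  by apply: cvg_finite_prod => k; case: (k != i); [exact: cvg_cutoff|exact: cvg_cst].
by apply/funext => m; rewrite big_mkcond.
Qed.

(** In each coordinate (H_k w)' = - H_(k+1) w, so the derivative of the test function is minus the
    raised tensor times the density, up to the term [Y] where the cutoff is differentiated. The
    density turns Lebesgue integrals into Gaussian ones, and dominated convergence removes the
    cutoff. *)
Lemma weak_gradient_gaussian_sobolev (g : 'rV[R]_n -> R) (G : 'rV[R]_n -> 'rV[R]_n) :
  is_weak_gradient g G -> sqint g -> (forall i, sqint (fun x => G x ord0 i)) ->
  gaussian_sobolev g (fun i x => G x ord0 i).
Proof.
move=> wG hg hG; split=> // i a.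
have [mg _] := hg; have [mG _] := hG i.
have mh b : measurable_fun setT (herm b : 'rV[R]_n -> R) by exact: measurable_tensor_poly.
have step m : (\int[gamma]_x (g x * (-1 * herm (raise i a) x * X m x + herm a x * Y m i x))%:E =
    - \int[gamma]_x (G x ord0 i * (herm a x * X m x))%:E)%E.
  have := (wG i).2 _ (test_phi m a).
  rewrite !integral_std_gaussian; last 2 first.
  - apply/measurable_EFinP/measurable_funM => //; exact: measurable_funM.
  - apply/measurable_EFinP/measurable_funM => //; apply: measurable_funD.
      by apply: measurable_funM => //; exact: measurable_funM.
    exact: measurable_funM.
  under eq_integral do rewrite partial_phiE mulrA EFinM.
  move=> ->; congr (- _)%E; apply: eq_integral => x _.
  by rewrite tensor_phiE mulrA EFinM.
have [C hC] := @dcutoff_bound R.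
have [|||||_ _ HL] := @dominated_convergence _ _ _ gamma setT measurableT
  (fun m x => (g x * (-1 * herm (raise i a) x * X m x + herm a x * Y m i x))%:E)
  (fun x => (g x * (-1 * herm (raise i a) x))%:E)
  (fun x => `|(g x * herm (raise i a) x)%:E| + `|C%:E * (g x * herm a x)%:E|)%E.
- move=> m; apply/measurable_EFinP/measurable_funM => //; apply: measurable_funD.
    by apply: measurable_funM => //; exact: measurable_funM.
  exact: measurable_funM.
- by apply/measurable_EFinP/measurable_funM => //; exact: measurable_funM.
- apply: aeW => x _; apply/cvg_EFin; first exact: nearW.
  apply: cvgMr; rewrite -[Z in _ --> Z]addr0 -[Z in _ --> Z + _]mulr1 -[Z in _ --> _ + Z](mulr0 (herm a x)).
  by apply: cvgD; apply: cvgMr; [exact: cvg_X|exact: cvg_Y].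
- apply: integrableD => //; apply: integrable_abse.
    exact: (sq_integrable_mul hg (sqint_herm _)).
  by apply: integrableZl => //; exact: (sq_integrable_mul hg (sqint_herm _)).
- apply: aeW => x m _; rewrite -EFinM !abse_EFin -EFinD lee_fin mulrDr.
  rewrite (le_trans (ler_normD _ _))//; apply: lerD.
    rewrite mulN1r mulNr mulrN normrN mulrA normrM ler_piMr//.
  rewrite (mulrA (g x)) !normrM mulrC ler_wpM2r ?mulr_ge0//.
  by rewrite -normrM; exact: le_trans (Y_le _ _ _ hC) (ler_norm _).
have [|||||_ _ HR] := @dominated_convergence _ _ _ gamma setT measurableT
  (fun m x => (G x ord0 i * (herm a x * X m x))%:E)
  (fun x => (G x ord0 i * herm a x)%:E)
  (fun x => `|(G x ord0 i * herm a x)%:E|%E).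
- by move=> m; apply/measurable_EFinP/measurable_funM => //; exact: measurable_funM.
- exact/measurable_EFinP/measurable_funM.
- apply: aeW => x _; apply/cvg_EFin; first exact: nearW.
  apply: cvgMr; rewrite -[Z in _ --> Z]mulr1; apply: cvgMr; exact: cvg_X.
- apply: integrable_abse; exact: (sq_integrable_mul (hG i) (sqint_herm _)).
- by apply: aeW => x m _; rewrite !abse_EFin lee_fin mulrA normrM ler_piMr.
have E : (\int[gamma]_x (g x * (-1 * herm (raise i a) x))%:E =
    - \int[gamma]_x (G x ord0 i * herm a x)%:E)%E.
  apply: (cvg_unique (@ereal_hausdorff R) HL).
  apply: cvg_trans (cvgeN HR); apply: near_eq_cvg; apply: nearW => m.
  by rewrite /= step.
have : << g, fun x => -1 * herm (raise i a) x >> = - << fun x => G x ord0 i, herm a >>.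
  by rewrite /dot /Rintegral E fineN.
rewrite dotZr//; last exact: sqint_herm.
by rewrite mulN1r => /oppr_inj.
Qed.

End weak_gradient_gaussian.

(** * Uniqueness of the weak gradient up to translation *)

Section weak_gradient_translation.
Context {R : realType} {n : nat}.
Local Notation leb := (@lebesgue_rV R n).
Implicit Types (x mu : 'rV[R]_n) (i k : 'I_n).

Lemma closed_box_translation mu (a b : 'I_n -> R) x :
  \1_(closed_box (fun k => a k + mu ord0 k) (fun k => b k + mu ord0 k)) (mu + x) =
  \1_(closed_box a b) x :> R.
Proof.
rewrite !indicE; congr (nat_of_bool _)%:R.
by apply/idP/idP; rewrite !inE => H k; have := H k; rewrite /= !in_itv/= !mxE;
  rewrite (addrC (mu _ _)) !lerD2r.
Qed.

Lemma locally_integrable_box_translation (f : 'rV[R]_n -> R) mu :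
  locally_integrable_rV f -> box_integrable (fun x => f (mu + x)).
Proof.
move=> [mf fK].
have mfmu : measurable_fun setT (fun x => f (mu + x)).
  by apply: measurableT_comp => //; exact: measurable_rV_add.
split => // a b.
pose a' k := a k + mu ord0 k; pose b' k := b k + mu ord0 k.
apply/integrableP; split.
  by apply/measurable_EFinP/measurable_funM => //; apply: measurable_indic; exact: measurable_closed_box.
rewrite (eq_integral (fun x => `|(f (mu + x) * \1_(closed_box a' b') (mu + x))%:E|%E)); last first.
  by move=> x _; rewrite closed_box_translation.
rewrite (integral_lebesgue_rV_translation mu
  (f := fun y => `|(f y * \1_(closed_box a' b') y)%:E|%E)); last first.
  apply: measurableT_comp => //; apply/measurable_EFinP/measurable_funM => //.
  by apply: measurable_indic; exact: measurable_closed_box.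
apply: le_lt_trans (fK (closed_box a' b') (@compact_box _ _ a' b')).
rewrite [leRHS]integral_mkcond le_eqVlt; apply/orP; left; apply/eqP.
apply: eq_integral => y _; rewrite patchE indicE abse_EFin.
by case: ifPn => _; rewrite ?mulr1 ?mulr0 ?normr0.
Qed.

Lemma partial_translation mu i (phi : 'rV[R]_n -> R) x :
  partial i (fun y => phi (y - mu)) (mu + x) = partial i phi x.
Proof.
rewrite /partial /derive.
have -> : (fun h : R => h^-1 *: (((fun y => phi (y - mu)) \o shift (mu + x)) (h *: delta_mx ord0 i) -
      phi (mu + x - mu))) =
    (fun h => h^-1 *: ((phi \o shift x) (h *: delta_mx ord0 i) - phi x)).
  by apply/funext => h /=; rewrite (addrC mu) addrA !addrK.
by [].
Qed.

(** A bump and its translate by mu are tested against [G] and [D] respectively; by translation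
    invariance both give the same integral of [h], so the difference of the gradients is orthogonal
    to all bumps. *)
Lemma weak_gradient_translation_ae mu (h : 'rV[R]_n -> R) (G D : 'rV[R]_n -> 'rV[R]_n) :
  measurable_fun setT (fun x => h (mu + x)) ->
  is_weak_gradient (fun x => h (mu + x)) G -> is_weak_gradient h D ->
  forall i, {ae leb, forall x, G x ord0 i = D (mu + x) ord0 i}.
Proof.
move=> mhmu wG wD i.
have mh : measurable_fun setT h.
  rewrite (_ : h = (fun x => h (mu + x)) \o (fun y => - mu + y)).
    by apply: measurableT_comp => //; exact: measurable_rV_add.
  by apply/funext => y /=; rewrite addNKr.
have [lG idG] := wG i; have [lD idD] := wD i.
have bG : box_integrable (fun x => G x ord0 i).
  have := locally_integrable_box_translation 0 lG.
  by under eq_fun do rewrite add0r.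
have bD := locally_integrable_box_translation mu lD.
have mD : measurable_fun setT (fun x => D x ord0 i) by case: lD.
have bGD : box_integrable (fun x => G x ord0 i - D (mu + x) ord0 i).
  split; first by apply: measurable_funB; [case: bG|case: bD].
  move=> a b; under eq_fun do rewrite mulrBl EFinB.
  by apply: integrableB => //; [exact: bG.2|exact: bD.2].
suff : {ae leb, forall x, G x ord0 i - D (mu + x) ord0 i = 0}.
  by apply: filterS => x /eqP; rewrite subr_eq0 => /eqP.
apply: (integral_bump_eq0_ae bGD) => m a b.
pose T := tensor (fun k => smooth_bump m (a k) (b k)) : 'rV[R]_n -> R.
pose T' := tensor (fun k => smooth_bump m (a k + mu ord0 k) (b k + mu ord0 k)) : 'rV[R]_n -> R.
have T'E : T' = fun y => T (y - mu).
  apply/funext => y; apply: eq_bigr => k _.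
  by rewrite !mxE bump_shift.
have test_bump (u v : 'I_n -> R) : test_function (tensor (fun k => smooth_bump m (u k) (v k))).
  apply: (test_function_tensor (a := u) (b := fun k => v k + 1)) => [k|k t].
    exact: elementary_bump.
  exact: bump_eq0.
(* Translating the integral requires this partial derivative to be measurable, which its tensor form
   shows. *)
have [T1 mT1 T1E] : exists2 T1, measurable_fun setT T1 & partial i T' = T1.
  have [u eu du] := elementary_derive (elementary_bump m (a i + mu ord0 i) (b i + mu ord0 i)).
  exists (partial i T') => //; rewrite /T' (partial_tensor du).
  apply: measurable_tensor => k; case: ifP => _; first exact: measurable_elementary.
  by apply: measurable_elementary; exact: elementary_bump.
rewrite (eq_integral (fun x => (G x ord0 i * T x)%:E - (D (mu + x) ord0 i * T x)%:E)%E); last first.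
  by move=> x _; rewrite mulrBl.
rewrite integralB//; [|exact: integrable_bump|exact: (integrable_bump m a b bD)].
apply/eqP; rewrite sube_eq; last 2 first.
- exact: integrable_fin_num (integrable_bump m a b bG).
- by rewrite fin_num_adde_defl// (integrable_fin_num _ (integrable_bump m a b bD)).
rewrite add0e; apply/eqP.
have E1 := idG _ (test_bump a b).
have E2 := idD _ (test_bump (fun k => a k + mu ord0 k) (fun k => b k + mu ord0 k)).
apply: oppe_inj; rewrite -[LHS]E1.
rewrite [LHS](eq_integral (fun x => (h (mu + x) * partial i T' (mu + x))%:E)); last first.
  by move=> x _; rewrite T'E (partial_translation mu i T).
rewrite (integral_lebesgue_rV_translation mu (f := fun y => (h y * partial i T' y)%:E)); last first.
  by apply/measurable_EFinP/measurable_funM => //; rewrite T1E.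
rewrite E2; apply: (congr1 oppe).
rewrite -(integral_lebesgue_rV_translation mu); last first.
  by apply/measurable_EFinP/measurable_funM => //; exact: measurable_tensor_bump.
apply: eq_integral => x _; rewrite -/T' T'E.
by rewrite (addrC mu) addrK.
Qed.

End weak_gradient_translation.

(** * The error of SURE *)

Section sobolev_combinations.
Context {R : realType} {n : nat}.
Local Notation gamma := (@std_gaussian R n).
Local Notation sqint := (sq_integrable gamma).
Implicit Types (i j : 'I_n) (x : 'rV[R]_n) (g h : 'rV[R]_n -> R) (G H : 'I_n -> 'rV[R]_n -> R).

Lemma gaussian_sobolev_comb c d g G h H :
  gaussian_sobolev g G -> gaussian_sobolev h H ->
  gaussian_sobolev (fun x => c * g x + d * h x) (fun i x => c * G i x + d * H i x).
Proof.
move=> gG hH.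
have := @gaussian_sobolev_lin R n bool [:: true; false] (fun b => if b then c else d)
  (fun b => if b then g else h) (fun b => if b then G else H).
under eq_fun do rewrite !big_cons big_nil addr0.
rewrite (_ : (fun i x => \sum_(l <- _) _) = (fun i x => c * G i x + d * H i x)).
  by apply => -[].
by apply/funext => i; apply/funext => x; rewrite !big_cons big_nil addr0.
Qed.

Lemma herm0 x : herm (fun=> 0%N) x = 1.
Proof. by rewrite /herm /tensor_poly big1// => k _; rewrite hornerE. Qed.

Lemma dherm0 i x : dherm i (fun=> 0%N) x = 0.
Proof. by rewrite dhermE mul0r. Qed.

Lemma gaussian_sobolev_coord j :
  gaussian_sobolev (fun x => x ord0 j) (fun i _ => (i == j)%:R).
Proof.
have := gaussian_sobolev_herm (R := R) (raise j (fun=> 0%N)).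
rewrite (_ : herm _ = (fun x => x ord0 j)); last first.
  apply/funext => x; have := coord_herm j (fun=> 0%N) x.
  by rewrite herm0 dherm0 mulr1 addr0 => ->.
rewrite (_ : (fun i => dherm i _) = (fun i _ => (i == j)%:R))//.
apply/funext => i; apply/funext => x; rewrite dhermE /raise add0n.
case: (eqVneq i j) => [->|]; last by rewrite mul0r.
rewrite mul1r (_ : lower _ _ = (fun=> 0%N)) ?herm0//.
by apply/funext => k; rewrite /lower subnn.
Qed.

Lemma gaussian_sobolev_cst c : gaussian_sobolev (fun _ : 'rV[R]_n => c) (fun _ _ => 0).
Proof.
pose z : 'I_n -> nat := fun=> 0%N.
have -> : (fun _ : 'rV[R]_n => c) = (fun x => c * herm z x + 0 * herm z x).
  by apply/funext => x; rewrite herm0 mulr1 mul0r addr0.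
have -> : (fun (_ : 'I_n) (_ : 'rV[R]_n) => 0 : R) =
    (fun i x => c * dherm i z x + 0 * dherm i z x).
  by apply/funext => i; apply/funext => x; rewrite dherm0 !mulr0 addr0.
by apply: gaussian_sobolev_comb; exact: gaussian_sobolev_herm.
Qed.

Lemma gaussian_sobolev_ae g G H : gaussian_sobolev g G ->
  (forall i, measurable_fun setT (H i)) ->
  (forall i, {ae gamma, forall x, G i x = H i x}) -> gaussian_sobolev g H.
Proof.
move=> [hg hG gG] mH GH.
have mG i : measurable_fun setT (G i) by have [] := hG i.
split=> // [i|i a].
- split => //; have [_] := hG i; rewrite (ae_eq_integral (fun x => (H i x ^+ 2)%:E))//.
  + exact/measurable_EFinP/measurable_funX.
  + exact/measurable_EFinP/measurable_funX.
  + by apply: filterS (GH i) => x -> _.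
- rewrite -gG /dot /Rintegral; congr fine; apply: ae_eq_integral => //.
  + by apply/measurable_EFinP/measurable_funM => //; exact: measurable_tensor_poly.
  + by apply/measurable_EFinP/measurable_funM => //; exact: measurable_tensor_poly.
  + by apply: filterS (GH i) => x -> _.
Qed.

Lemma Rintegral_sum_mul (I : Type) (s : seq I) (F K : I -> 'rV[R]_n -> R) :
  (forall l, sqint (F l)) -> (forall l, sqint (K l)) ->
  gamma.-integrable setT (fun x => (\sum_(l <- s) F l x * K l x)%:E) /\
  \int[gamma]_x (\sum_(l <- s) F l x * K l x) = \sum_(l <- s) dot gamma (F l) (K l).
Proof.
move=> hF hK; elim: s => [|l s [IHi IHe]].
  rewrite big_nil; under eq_fun do rewrite big_nil.
  under eq_Rintegral do rewrite big_nil.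
  by rewrite Rintegral_cst// mul0r; split => //; exact: integrable0.
have il := sq_integrable_mul (hF l) (hK l).
split; first by under eq_fun do rewrite big_cons EFinD; exact: integrableD.
under eq_Rintegral do rewrite big_cons.
by rewrite RintegralD// IHe big_cons.
Qed.

(** The mean is the pairing with the constant Hermite tensor, whose gradient is 0. *)
Lemma integrable_gaussian_div (v : 'I_n -> 'rV[R]_n -> R) V :
  (forall i, gaussian_sobolev (v i) (V i)) ->
  gamma.-integrable setT (EFin \o gaussian_div v V) /\
  \int[gamma]_x gaussian_div v V x = 0.
Proof.
move=> vV; have [hT _] := gaussian_div_norm (@hermite_density R n) vV.
have E : gaussian_div v V = (fun x => gaussian_div v V x * herm (fun=> 0%N) x).
  by apply/funext => x; rewrite herm0 mulr1.
split; first by rewrite E; exact: (sq_integrable_mul hT (sqint_herm _)).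
rewrite E; apply: etrans (dot_gaussian_div_herm vV (fun=> 0%N)) _.
rewrite big1// => i _; rewrite (_ : dherm _ _ = (fun=> 0)).
  by rewrite dotC dot0l.
by apply/funext => x; rewrite dherm0.
Qed.

End sobolev_combinations.

Lemma enorm_sq (R : realType) n (x : 'rV[R]_n) : enorm x ^+ 2 = \sum_i x ord0 i ^+ 2.
Proof. by rewrite sqr_sqrtr// sumr_ge0// => i _; rewrite sqr_ge0. Qed.

(** * Expectations as Gaussian integrals *)

Section std_normal_expectation.
Context {R : realType} {n : nat} {d : measure_display} {Omega : measurableType d}.
Variables (P : probability Omega R) (eps : {RV P >-> 'rV[R]_n}).
Hypothesis heps : std_normal_vector eps.
Local Open Scope ereal_scope.

Lemma ge0_std_normal_expectation (f : 'rV[R]_n -> R) : measurable_fun setT f ->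
  (forall x, 0 <= f x)%R -> 'E_P[fun w => f (eps w)] = \int[std_gaussian]_x (f x)%:E.
Proof.
move=> mf f0; rewrite unlock.
rewrite (@eq_measure_integral _ _ _ _ (distribution P eps)); last first.
  by move=> A mA _; exact/esym/heps.
rewrite ge0_integral_pushforward//.
- exact/measurable_EFinP.
- by move=> x _; rewrite lee_fin.
Qed.

Lemma std_normal_expectation (f : 'rV[R]_n -> R) :
  std_gaussian.-integrable setT (EFin \o f) ->
  P.-integrable setT (fun w => (f (eps w))%:E) /\
  'E_P[fun w => f (eps w)] = \int[std_gaussian]_x (f x)%:E.
Proof.
move=> fi; have mf := measurable_int _ fi.
have fPi : P.-integrable setT (fun w => (f (eps w))%:E).
  apply/integrableP; split; first exact: (measurableT_comp mf (measurable_funP eps)).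
  have /integrableP[_] := fi.
  have := ge0_std_normal_expectation (f := fun x => `|f x|%R)
    (measurableT_comp (@normr_measurable R setT) ((measurable_EFinP _ _).1 mf))
    (fun=> normr_ge0 _).
  by rewrite unlock => <-.
split => //; rewrite unlock.
rewrite (@eq_measure_integral _ _ _ _ (distribution P eps)); last first.
  by move=> A mA _; exact/esym/heps.
by rewrite integral_pushforward.
Qed.

End std_normal_expectation.

Section sure.
Context {R : realType} {n : nat}.
Local Notation gamma := (@std_gaussian R n).
Local Notation sqint := (sq_integrable gamma).
Variables (mu : 'rV[R]_n) (muhat : 'rV[R]_n -> 'rV[R]_n) (Dmuhat : 'rV[R]_n -> 'M[R]_n).
Hypothesis hmuhat : forall i : 'I_n, W12_gaussian (fun x => muhat (mu + x) ord0 i).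
Hypothesis hD : is_weak_derivative muhat Dmuhat.
Implicit Types (i j : 'I_n) (x : 'rV[R]_n).

Let u j x := muhat (mu + x) ord0 j.
Let D x := Dmuhat (mu + x).

(** [Dmuhat] is only assumed locally integrable. Its square integrability is inherited from the
    gradient [G] supplied by [W12_gaussian], with which its translate agrees almost everywhere. *)
Lemma gaussian_sobolev_muhat j : gaussian_sobolev (u j) (fun i x => D x i j).
Proof.
have [[mu_j _] [G wG Gy]] := hmuhat j.
have mG i : measurable_fun setT (fun x => G x ord0 i) by have [[]] := wG i.
have sq_le (f : 'rV[R]_n -> R) : measurable_fun setT f ->
    (forall x, f x ^+ 2 <= u j x ^+ 2 + enorm (G x) ^+ 2) -> sqint f.
  move=> mf fle; split => //; apply: le_lt_trans Gy; apply: ge0_le_integral => //.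
  - by move=> x _; rewrite lee_fin sqr_ge0.
  - by apply/measurable_EFinP/measurable_funX.
  - apply/measurable_EFinP/measurable_funD; first exact: measurable_funX.
    under eq_fun do rewrite enorm_sq.
    by apply: measurable_sum => i; exact: measurable_funX.
  - by move=> x _; rewrite lee_fin.
have hu : sqint (u j) by apply: sq_le => // x; rewrite lerDl sqr_ge0.
have hG i : sqint (fun x => G x ord0 i).
  apply: sq_le => // x; rewrite enorm_sq (bigD1 i)//= addrCA lerDl addr_ge0 ?sqr_ge0//.
  by apply: sumr_ge0 => k _; rewrite sqr_ge0.
apply: gaussian_sobolev_ae (weak_gradient_gaussian_sobolev wG hu hG) _ _ => i.
  have [[mD _] _] := hD j i.
  rewrite (_ : (fun x => _) = (fun y => (col j (Dmuhat y))^T ord0 i) \o (fun x => mu + x)).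
    by apply: measurableT_comp => //; exact: measurable_rV_add.
  by apply/funext => x /=; rewrite !mxE.
have [N [mN N0 subN]] := weak_gradient_translation_ae mu_j wG (hD j) i.
exists N; split => //; first exact: std_gaussian_null.
apply: subset_trans subN => x /= Hx; apply: contra_not Hx => ->.
by rewrite !mxE.
Qed.

(** The field c (muhat (mu + x) - mu) + e x, in the nested shape of [gaussian_sobolev_comb]. Only
    (c, e) = (2, -1) and (4, -3) are used. *)
Let v (c e : R) j x := c * u j x + 1 * (e * x ord0 j + 1 * (- (c * mu ord0 j))).
Let V (c e : R) j i x : R := c * D x i j + 1 * (e * (i == j)%:R + 1 * 0).

Let sobolev_v c e j : gaussian_sobolev (v c e j) (V c e j).
Proof.
apply: gaussian_sobolev_comb; first exact: gaussian_sobolev_muhat.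
by apply: gaussian_sobolev_comb; [exact: gaussian_sobolev_coord|exact: gaussian_sobolev_cst].
Qed.

Let T := gaussian_div (v 2 (-1)) (V 2 (-1)).
Let rhs := \sum_j (\sum_i dot gamma (V 2 (-1) i j) (V 2 (-1) j i) +
  dot gamma (v 2 (-1) j) (v 2 (-1) j)).

Lemma SURE_errorE x :
  SURE muhat Dmuhat (mu + x) - enorm (muhat (mu + x) - mu) ^+ 2 = - T x.
Proof.
have nE : n%:R = \sum_(j < n) 1 :> R by rewrite sumr_const card_ord.
rewrite /SURE /divergence !enorm_sq nE /T /gaussian_div mulr_sumr -big_split/=.
rewrite -!sumrB -sumrN; apply: eq_bigr => j _.
by rewrite /v /V /u /D eqxx !mxE /=; ring.
Qed.

Let Phi x := R_SURE_hat muhat Dmuhat (mu + x).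

Let Psi x := \sum_j (\sum_i V 2 (-1) i j x * V 2 (-1) j i x) +
  \sum_j v 2 (-1) j x * v 2 (-1) j x.

(** Write z for [v 2 (-1)] at x. Then 2 (y - muhat y) = x - z and the Jacobian of z is 2 D - 1.
    Expanding both squares leaves |z|^2 and the trace of the squared Jacobian, which form [Psi],
    minus the divergence of 2 z - x, which is the field [v 4 (-3)]. *)
Let PhiE x : Phi x = Psi x - gaussian_div (v 4 (-3)) (V 4 (-3)) x.
Proof.
have nE : n%:R = \sum_(j < n) 1 :> R by rewrite sumr_const card_ord.
rewrite /Phi /R_SURE_hat enorm_sq /mxtrace nE /Psi /gaussian_div !mulr_sumr.
rewrite -!big_split/= -!sumrB; apply: eq_bigr => j _.
rewrite !mxE.
have -> : \sum_i V 2 (-1) i j x * V 2 (-1) j i x =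
    4 * (\sum_i D x j i * D x i j) + (1 - 4 * D x j j).
  rewrite mulr_sumr -[X in _ + X](_ : \sum_i (if i == j then 1 - 4 * D x j j else 0) = _); last first.
    by rewrite -big_mkcond big_pred1_eq.
  rewrite -big_split/=; apply: eq_bigr => i _; rewrite /V (eq_sym j i).
  by case: eqVneq => [->|_] /=; ring.
by rewrite /v /V /u /D eqxx /=; ring.
Qed.

Let sqint_v c e j : sqint (v c e j). Proof. by have [] := sobolev_v c e j. Qed.
Let sqint_V c e j i : sqint (V c e j i). Proof. by have [] := sobolev_v c e j. Qed.

Let integral_Psi : gamma.-integrable setT (EFin \o Psi) /\ \int[gamma]_x Psi x = rhs.
Proof.
pose F (p : 'I_n * 'I_n) := V 2 (-1) p.2 p.1.
pose K (p : 'I_n * 'I_n) := V 2 (-1) p.1 p.2.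
have [i1 e1] := @Rintegral_sum_mul R n _ (index_enum ('I_n * 'I_n)%type) F K
  (fun p => sqint_V _ _ _ _) (fun p => sqint_V _ _ _ _).
have [i2 e2] := @Rintegral_sum_mul R n _ (index_enum 'I_n) (v 2 (-1)) (v 2 (-1))
  (fun j => sqint_v _ _ _) (fun j => sqint_v _ _ _).
have E x : Psi x = (\sum_p F p x * K p x) + \sum_j v 2 (-1) j x * v 2 (-1) j x.
  by rewrite /Psi pair_bigA.
split; first by rewrite /comp; under eq_fun do rewrite E EFinD; exact: integrableD.
under eq_Rintegral do rewrite E.
by rewrite RintegralD// e1 e2 /rhs big_split/= pair_bigA.
Qed.

Lemma integral_R_SURE_hat : gamma.-integrable setT (EFin \o Phi) /\
  (\int[gamma]_x (Phi x)%:E)%E = rhs%:E.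
Proof.
have [iP eP] := integral_Psi.
have [iW eW] := integrable_gaussian_div (sobolev_v 4 (-3)).
have iPhi : gamma.-integrable setT (EFin \o Phi).
  rewrite /comp; under eq_fun do rewrite PhiE EFinB.
  exact: integrableB.
split => //; rewrite -[LHS]fineK; last exact: integrable_fin_num iPhi.
congr EFin; rewrite -[LHS]/(\int[gamma]_x Phi x).
under eq_Rintegral do rewrite PhiE.
by rewrite RintegralB// eP eW subr0.
Qed.

Lemma integral_SURE_error_sq :
  (\int[gamma]_x ((SURE muhat Dmuhat (mu + x) - enorm (muhat (mu + x) - mu) ^+ 2) ^+ 2)%:E)%E
  = rhs%:E.
Proof.
under eq_integral do rewrite SURE_errorE sqrrN.
have [hT eT] := gaussian_div_norm (@hermite_density R n) (sobolev_v 2 (-1)).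
by rewrite sq_integralE// eT.
Qed.

Lemma measurable_SURE_error : measurable_fun setT
  (fun x => (SURE muhat Dmuhat (mu + x) - enorm (muhat (mu + x) - mu) ^+ 2) ^+ 2).
Proof.
under eq_fun do rewrite SURE_errorE sqrrN.
by apply: measurable_funX; exact: (measurable_gaussian_div (sobolev_v 2 (-1))).
Qed.

End sure.

Theorem theorem3p1 (R : realType) (n : nat)
    (d : measure_display) (Omega : measurableType d) (P : probability Omega R)
    (mu : 'rV[R]_n) (eps : {RV P >-> 'rV[R]_n}) (heps : std_normal_vector eps)
    (muhat : 'rV[R]_n -> 'rV[R]_n)
    (hmuhat : forall i : 'I_n, W12_gaussian (fun x => muhat (mu + x) ord0 i))
    (Dmuhat : 'rV[R]_n -> 'M[R]_n) (hD : is_weak_derivative muhat Dmuhat) :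
  let y := fun w : Omega => mu + eps w in
  ('E_P[(fun w => (SURE muhat Dmuhat (y w) - enorm (muhat (y w) - mu) ^+ 2) ^+ 2)%R]
   = 'E_P[(fun w => 4 * enorm (y w - muhat (y w)) ^+ 2
                    + 4 * \tr (Dmuhat (y w) *m Dmuhat (y w)) - 2 * n%:R)%R])%E
  /\ unbiased_estimate P (fun w => R_SURE_hat muhat Dmuhat (y w))
       (R_SURE P muhat Dmuhat mu y).
Proof.
move=> y.
have [iPhi ePhi] := integral_R_SURE_hat hmuhat hD.
have [iP eP] := std_normal_expectation heps iPhi.
have eS := ge0_std_normal_expectation heps (measurable_SURE_error hmuhat hD)
  (fun x => sqr_ge0 _).
rewrite (integral_SURE_error_sq hmuhat hD) -ePhi -eP in eS.
by split; [exact: eS|split => //; exact/esym/eS].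
Qed.
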